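(* Let $m$ and $n$ be positive integers, let $r=[2m,2n]$ or $r=[2m,-2n]$, where $[2m,\pm 2n]:=\dfrac{1}{2m\pm\frac{1}{2n}}$, and let $K(r)\subset S^3$ be the $2$-bridge knot of slope $r$. Let $(x_\ell,y_\ell)$ be the long upper meridian pair or the long lower meridian pair for $K(r)$. Then the subgroup of the knot group $G(K(r))=\pi_1(S^3-K(r))$ generated by $x_\ell$ and $y_\ell$ is a free group.
   Context: **2-bridge knots.** Let $H$ be the group of isometries of $\mathbb{R}^2$ generated by the $\pi$-rotations about the points of $\mathbb{Z}^2$, and let $(S^2,P):=(\mathbb{R}^2,\mathbb{Z}^2)/H$ be the Conway sphere (a sphere with four marked points). For $s\in\mathbb{Q}\cup\{\infty\}$ let $\alpha_s$ be the essential simple loop in $S^2-P$ which is the image of a line of slope $s$ in $\mathbb{R}^2-\mathbb{Z}^2$. The rational tangle $(B^3,t(s))$ of slope $s$ is the trivial $2$-string tangle with boundary identified with $(S^2,P)$ such that $\alpha_s$ bounds a disk in $B^3-t(s)$ separating the two strings. The $2$-bridge link $K(r)\subset S^3$ is obtained by gluing $(B^3,t(\infty))$ and $(B^3,t(r))$ along their boundaries by the identity; for $r=q/p$ in lowest terms it is a knot iff $p$ is odd. **Tunnels.** The upper tunnel $\tau_1$ is the core arc of $(B^3,t(\infty))$: the arc in $B^3$ with interior disjoint from $t(\infty)$, joining the two strings, such that $(B^3,t(\infty))$ is a regular neighborhood of it in $(S^3,K(r))$. The lower tunnel $\tau_2$ is the core arc of $(B^3,t(r))$, defined in the same way. **Standard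 inversions.** A strong inversion of a knot $K$ is an orientation-preserving involution $h$ of $S^3$ preserving $K$ setwise such that $\mathrm{Fix}(h)$ is a circle meeting $K$ in exactly two points. The translations of $\mathbb{R}^2$ by vectors of $\mathbb{Z}^2$ induce an action of $(\mathbb{Z}/2\mathbb{Z})^2$ on $(S^2,P)$ which extends to an action on both rational tangles, hence on $(S^3,K(r))$. When $r=q/p$ with $p$ odd, $h_1$ denotes the involution coming from translation by $(0,1)$ and $h_2$ the one coming from translation by $(p,q)$. Both are strong inversions, and the extensions are chosen so that $\tau_1\subset\mathrm{Fix}(h_1)$ and $\tau_2\subset\mathrm{Fix}(h_2)$. **Meridian pairs.** Let $E(K)$ be the exterior of $K$ (the complement of an open regular neighborhood). A meridian of $G(K)=\pi_1(E(K))$ is an element freely homotopic to an essential simple loop on $\partial E(K)$ bounding a disk in the regular neighborhood of $K$. A properly embedded arc $\gamma$ in $E(K)$ represents a meridian pair $\{x,y\}$: divide $\gamma$ at an interior point $z$ into subarcs $\gamma_1,\gamma_2$, let $C_i\subset\partial E(K)$ be a meridian loop through the endpoint of $\gamma_i$ on $\partial E(K)$, choose an arc $\delta$ from the base point to $z$, and let $x,y$ be represented by the based loops which follow $\delta$ and $\gamma_i$, go around $C_i$, and return ($i=1,2$). The pair is well defined up to replacing $\{x,y\}$ by $\{x^{\pm1},y^{\pm1}\}$ (independent signs) and simultaneous conjugation. **Long meridian pairs.** For $i=1,2$ let $\tau_i'$ be the component of $\mathrm{Fix}(h_i)\cap E(K(r))$ different from $\tau_i\cap E(K(r))$. The long upper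 (resp. long lower) meridian pair is the meridian pair represented by $\tau_1'$ (resp. $\tau_2'$). *)

(* Defs.v *)
From HB Require Import structures.
From mathcomp Require Import all_boot all_order all_algebra.
From mathcomp Require Import all_classical all_reals all_analysis.
From mathcomp Require Import ring lra.
Set Implicit Arguments.
Unset Strict Implicit.
Unset Printing Implicit Defensive.
Import Order.TTheory GRing.Theory Num.Theory.
Import numFieldNormedType.Exports.
Local Open Scope classical_set_scope.
Local Open Scope ring_scope.

Section Words.
Context {G : groupType}.
Local Open Scope group_scope.

Definition subgroup (S : set G) : Prop :=
  [/\ S 1, forall x y, S x -> S y -> S (x * y) & forall x, S x -> S x^-1].

Definition generated (A : set G) : set G := smallest subgroup A.

(* The letter (g, false) stands for g and (g, true) for its inverse. *)
Definition eval_word (w : seq (G * bool)) : G :=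
  foldr (fun l v => (if l.2 then l.1^-1 else l.1) * v) 1 w.

Definition reduced (w : seq (G * bool)) : bool :=
  sorted (fun k l => ~~ ((k.1 == l.1) && (k.2 != l.2))) w.

Definition free_basis (B F : set G) : Prop :=
  generated B = F /\
  forall w : seq (G * bool), (forall l, l \in w -> B l.1) ->
    reduced w -> w != [::] -> eval_word w <> 1.

Definition is_free (F : set G) : Prop := exists B, free_basis B F.

End Words.

Section Paths.
Context {R : realType}.

(* Paths and homotopies parametrized by [0,1] and [0,1]^2 are represented by
   continuous maps defined on all of R and R^2: continuous maps on an interval
   or a square always extend, and only the values on [0,1] are ever used. *)

Definition I01 (s : R) : bool := 0 <= s <= 1.

Definition is_path {T : topologicalType} (x y : T) (f : R -> T) : Prop :=
  [/\ continuous f, f 0 = x & f 1 = y].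

Definition path_cat {T : Type} (f g : R -> T) (s : R) : T :=
  if s <= 2^-1 then f (2 * s) else g (2 * s - 1).

Definition path_rev {T : Type} (f : R -> T) (s : R) : T := f (1 - s).

Definition path_homotopic {T : topologicalType} (f g : R -> T) : Prop :=
  exists H : R * R -> T, [/\ continuous H,
    forall s, I01 s -> H (s, 0) = f s,
    forall s, I01 s -> H (s, 1) = g s &
    forall t, I01 t -> H (0, t) = f 0 /\ H (1, t) = f 1].

Lemma continuous_paste (X Y : topologicalType) (c : X -> R) (u v : X -> Y) :
  continuous c -> continuous u -> continuous v ->
  (forall x, c x = 0 -> u x = v x) ->
  continuous (fun x => if c x <= 0 then u x else v x).
Proof.
move=> cc cu cv uv x U /=; have [cx|cx|cx] := ltgtP (c x) 0 => HU.
- have h : \forall y \near x, c y < 0 by exact: (cc x [set z | z < 0] (lt_nbhsl cx)).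
  have h' : \forall y \near x, U (u y) by exact: (cu x U).
  by apply: filterS2 h h' => y /ltW /= ->.
- have h : \forall y \near x, 0 < c y by exact: (cc x [set z | 0 < z] (lt_nbhsr cx)).
  have h' : \forall y \near x, U (v y) by exact: (cv x U).
  by apply: filterS2 h h' => y /lt_geF /= ->.
- have h : \forall y \near x, U (v y) by apply: (cv x U); rewrite -(uv x cx).
  have h' : \forall y \near x, U (u y) by exact: (cu x U).
  by apply: filterS2 h h' => y ? ? /=; case: ifP.
Qed.

Lemma continuous_pair (X Y Z : topologicalType) (u : X -> Y) (v : X -> Z) :
  continuous u -> continuous v -> continuous (fun x => (u x, v x)).
Proof. by move=> cu cv x; apply: cvg_pair; [exact: cu|exact: cv]. Qed.

Lemma continuous_compose (X Y Z : topologicalType) (u : X -> Y) (v : Y -> Z) :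
  continuous u -> continuous v -> continuous (fun x => v (u x)).
Proof. by move=> cu cv x; apply: continuous_comp; [exact: cu|exact: cv]. Qed.

Lemma continuous_first (X Y : topologicalType) : continuous (@fst X Y).
Proof. by move=> x; exact: cvg_fst. Qed.

Lemma continuous_second (X Y : topologicalType) : continuous (@snd X Y).
Proof. by move=> x; exact: cvg_snd. Qed.

Section RealValued.
Context {X : topologicalType}.
Implicit Types u v : X -> R.

Lemma continuous_const (Y : topologicalType) (y : Y) :
  continuous (fun _ : X => y).
Proof. by move=> x; exact: cvg_cst. Qed.

Lemma continuous_add u v :
  continuous u -> continuous v -> continuous (fun x => u x + v x).
Proof. by move=> cu cv x; apply: cvgD; [exact: cu|exact: cv]. Qed.

Lemma continuous_opp u : continuous u -> continuous (fun x => - u x).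
Proof. by move=> cu x; apply: cvgN; exact: cu. Qed.

Lemma continuous_mul u v :
  continuous u -> continuous v -> continuous (fun x => u x * v x).
Proof. by move=> cu cv x; apply: cvgM; [exact: cu|exact: cv]. Qed.

Lemma continuous_minr u v :
  continuous u -> continuous v -> continuous (fun x => Num.min (u x) (v x)).
Proof. by move=> cu cv x; apply: continuous_min; [exact: cu|exact: cv]. Qed.

Lemma continuous_maxr u v :
  continuous u -> continuous v -> continuous (fun x => Num.max (u x) (v x)).
Proof. by move=> cu cv x; apply: continuous_max; [exact: cu|exact: cv]. Qed.

End RealValued.

Lemma continuous_ident (X : topologicalType) : continuous (fun x : X => x).
Proof. by move=> x; exact: cvg_id. Qed.

Ltac cont := repeat first
  [ exact: continuous_const | exact: continuous_first
  | exact: continuous_second | exact: continuous_ident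
  | assumption
  | apply: continuous_add | apply: continuous_opp | apply: continuous_mul
  | apply: continuous_minr | apply: continuous_maxr | apply: continuous_pair ].

Definition clamp (s : R) : R := Num.max 0 (Num.min 1 s).

Lemma clampE s : I01 s -> clamp s = s.
Proof. by move=> /andP[s0 s1]; rewrite /clamp min_r// max_r. Qed.

Lemma I01_clamp s : I01 (clamp s).
Proof.
by rewrite /I01 /clamp le_max lexx ge_max ler01 ge_min lexx.
Qed.

Lemma continuous_clamp (X : topologicalType) (u : X -> R) :
  continuous u -> continuous (fun x => clamp (u x)).
Proof. by move=> cu; rewrite /clamp; cont. Qed.

Section Homotopy.
Context {T : topologicalType}.
Implicit Types f g h : R -> T.

Lemma continuous_cat f g : continuous f -> continuous g -> f 1 = g 0 ->
  continuous (path_cat f g).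
Proof.
move=> cf cg fg.
have -> : path_cat f g =
    fun s => if s - 2^-1 <= 0 then f (2 * s) else g (2 * s - 1).
  by apply/funext => s; rewrite /path_cat subr_le0.
apply: continuous_paste.
- by cont.
- by apply: (continuous_compose _ cf); cont.
- by apply: (continuous_compose _ cg); cont.
- move=> s /eqP; rewrite subr_eq0 => /eqP ->.
  by rewrite mulfV ?subrr.
Qed.

Lemma is_path_cat (x y z : T) f g :
  is_path x y f -> is_path y z g -> is_path x z (path_cat f g).
Proof.
move=> [cf f0 f1] [cg g0 g1]; split.
- by apply: continuous_cat => //; rewrite f1.
- by rewrite /path_cat invr_ge0 ler0n mulr0.
- rewrite /path_cat ifF ?mulr1; last by apply/negbTE; rewrite -ltNge; lra.
  by rewrite -g1; congr g; ring.
Qed.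

Lemma is_path_rev (x y : T) f : is_path x y f -> is_path y x (path_rev f).
Proof.
move=> [cf f0 f1]; split; rewrite /path_rev ?subr0 ?subrr //.
by apply: (continuous_compose _ cf); cont.
Qed.

Lemma homotopic_refl f : continuous f -> path_homotopic f f.
Proof.
move=> cf; exists (fun p => f p.1); split=> //.
by apply: (continuous_compose _ cf); cont.
Qed.

Lemma I01_0 : I01 0. Proof. by rewrite /I01 lexx ler01. Qed.
Lemma I01_1 : I01 1. Proof. by rewrite /I01 lexx ler01. Qed.

Lemma homotopic_sym f g : path_homotopic f g -> path_homotopic g f.
Proof.
move=> [H [cH H0 H1 He]]; exists (fun p => H (p.1, 1 - p.2)); split => /=.
- by apply: (continuous_compose _ cH); cont.
- by move=> s /H1 <-; rewrite subr0.
- by move=> s /H0 <-; rewrite subrr.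
- move=> t /andP[t0 t1]; have /He[-> ->] : I01 (1 - t).
    by apply/andP; split; lra.
  have [<- <-] := He _ I01_1.
  by rewrite (H1 _ I01_0) (H1 _ I01_1).
Qed.

Lemma homotopic_trans f g h :
  path_homotopic f g -> path_homotopic g h -> path_homotopic f h.
Proof.
move=> [H [cH H0 H1 He]] [K [cK K0 K1 Ke]].
exists (fun p => if p.2 - 2^-1 <= 0 then H (clamp p.1, 2 * p.2)
                 else K (clamp p.1, 2 * p.2 - 1)).
have fg0 : f 0 = g 0 by have [<- _] := He _ I01_1; rewrite H1 // I01_0.
have fg1 : f 1 = g 1 by have [_ <-] := He _ I01_1; rewrite H1 // I01_1.
split => /=.
- apply: continuous_paste.
  + by cont.
  + apply: (continuous_compose _ cH); apply: continuous_pair; last by cont.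
    by apply: continuous_clamp; cont.
  + apply: (continuous_compose _ cK); apply: continuous_pair; last by cont.
    by apply: continuous_clamp; cont.
  + move=> [s t] /= /eqP; rewrite subr_eq0 => /eqP ->.
    by rewrite mulfV // subrr H1 ?K0 ?I01_clamp.
- by move=> s sI; rewrite ifT ?mulr0 ?clampE ?H0 //; lra.
- move=> s sI; rewrite ifF ?clampE ?mulr1 //; last by apply/negbTE; rewrite -ltNge; lra.
  by rewrite -K1 //; congr (K (_, _)); ring.
- move=> t /andP[t0 t1]; rewrite !clampE ?I01_0 ?I01_1 //.
  case: ifP => ht.
    by have /He[-> ->] : I01 (2 * t) by apply/andP; split; lra.
  move/negbT: ht; rewrite -ltNge => ht.
  have /Ke[-> ->] : I01 (2 * t - 1) by apply/andP; split; lra.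
  by rewrite fg0 fg1.
Qed.

Lemma homotopic_cat f f' g g' : f 1 = g 0 ->
  path_homotopic f f' -> path_homotopic g g' ->
  path_homotopic (path_cat f g) (path_cat f' g').
Proof.
move=> fg [H [cH H0 H1 He]] [K [cK K0 K1 Ke]].
exists (fun p => if p.1 - 2^-1 <= 0 then H (2 * p.1, clamp p.2)
                 else K (2 * p.1 - 1, clamp p.2)).
split => /=.
- apply: continuous_paste.
  + by cont.
  + apply: (continuous_compose _ cH); apply: continuous_pair; first by cont.
    by apply: continuous_clamp; cont.
  + apply: (continuous_compose _ cK); apply: continuous_pair; first by cont.
    by apply: continuous_clamp; cont.
  + move=> [s t] /= /eqP; rewrite subr_eq0 => /eqP ->.
    rewrite mulfV // subrr.
    by have [_ ->] := He _ (I01_clamp t); have [-> _] := Ke _ (I01_clamp t).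
- move=> s /andP[s0 s1]; rewrite /path_cat subr_le0 clampE ?I01_0 //.
  case: ifP => hs; first by rewrite H0 //; apply/andP; split; lra.
  move/negbT: hs; rewrite -ltNge => hs.
  by rewrite K0 //; apply/andP; split; lra.
- move=> s /andP[s0 s1]; rewrite /path_cat subr_le0 clampE ?I01_1 //.
  case: ifP => hs; first by rewrite H1 //; apply/andP; split; lra.
  move/negbT: hs; rewrite -ltNge => hs.
  by rewrite K1 //; apply/andP; split; lra.
- move=> t tI; rewrite /path_cat !subr_le0 clampE //.
  have -> : (0 <= 2^-1 :> R) by rewrite invr_ge0.
  have -> : (1 <= 2^-1 :> R) = false by apply/negbTE; rewrite -ltNge; lra.
  rewrite mulr0 mulr1; have -> : 2 - 1 = 1 :> R by ring.
  by have [-> _] := He _ tI; have [_ ->] := Ke _ tI.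
Qed.

Lemma homotopic_rev f g :
  path_homotopic f g -> path_homotopic (path_rev f) (path_rev g).
Proof.
move=> [H [cH H0 H1 He]]; exists (fun p => H (1 - p.1, p.2)); split => /=.
- by apply: (continuous_compose _ cH); cont.
- by move=> s /andP[s0 s1]; apply: H0; apply/andP; split; lra.
- by move=> s /andP[s0 s1]; apply: H1; apply/andP; split; lra.
- by move=> t /He[h0 h1]; rewrite /path_rev subr0 subrr.
Qed.

Lemma homotopic_reparam f (p q : R -> R) :
  continuous f -> continuous p -> continuous q -> p 0 = q 0 -> p 1 = q 1 ->
  path_homotopic (f \o p) (f \o q).
Proof.
move=> cf cp cq pq0 pq1.
exists (fun x => f ((1 - x.2) * p x.1 + x.2 * q x.1)); split => /=.
- apply: (continuous_compose _ cf); cont.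
    by apply: (continuous_compose _ cp); cont.
  by apply: (continuous_compose _ cq); cont.
- by move=> s _; congr f; ring.
- by move=> s _; congr f; ring.
- by move=> t _; rewrite -pq0 -pq1; split; congr f; ring.
Qed.

Lemma cat_assoc f g h : continuous f -> continuous g -> continuous h ->
  f 1 = g 0 -> g 1 = h 0 ->
  path_homotopic (path_cat f (path_cat g h)) (path_cat (path_cat f g) h).
Proof.
move=> cf cg ch fg gh.
pose u := path_cat f (path_cat g h).
pose p (s : R) := Num.min (2 * s) (Num.min (s + 4^-1) (2^-1 * (s + 1))).
have -> : path_cat (path_cat f g) h = u \o p.
  clear; apply/funext => s; rewrite /u /p /path_cat /=.
  case: (leP (s + 4^-1) (2^-1 * (s + 1))) => h1.
    case: (leP (2 * s) (s + 4^-1)) => h2.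
      have -> : s <= 2^-1 by lra.
      by have -> : 2 * s <= 2^-1 by lra.
    have -> : s <= 2^-1 by lra.
    have -> : (2 * s <= 2^-1) = false by apply/negbTE; rewrite -ltNge; lra.
    have -> : (s + 4^-1 <= 2^-1) = false by apply/negbTE; rewrite -ltNge; lra.
    have -> : 2 * (s + 4^-1) - 1 <= 2^-1 by lra.
    by congr g; field.
  case: (leP (2 * s) (2^-1 * (s + 1))) => h2; first by exfalso; lra.
  have -> : (s <= 2^-1) = false by apply/negbTE; rewrite -ltNge; lra.
  have -> : (2^-1 * (s + 1) <= 2^-1) = false by apply/negbTE; rewrite -ltNge; lra.
  have -> : (2 * (2^-1 * (s + 1)) - 1 <= 2^-1) = false.
    by apply/negbTE; rewrite -ltNge; lra.
  by congr h; field.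
have -> : u = u \o id by [].
have cu : continuous u.
  apply: continuous_cat => //; first exact: continuous_cat.
  by rewrite /path_cat invr_ge0 ler0n mulr0.
apply: homotopic_reparam => //.
- exact: continuous_ident.
- by rewrite /p; cont.
- by clear; rewrite /p /=; case: (leP (0 + 4^-1) _) => ?; case: leP => ? /=; lra.
- by clear; rewrite /p /=; case: (leP (1 + 4^-1) _) => ?; case: leP => ? /=; lra.
Qed.

Lemma cat_const_l f : continuous f ->
  path_homotopic (path_cat (fun=> f 0) f) f.
Proof.
move=> cf; have -> : path_cat (fun=> f 0) f = f \o (fun s => Num.max 0 (2 * s - 1)).
  apply/funext => s; rewrite /path_cat /=.
  by case: leP => h1; case: leP => h2; congr f; lra.
rewrite -[X in path_homotopic _ X]/(f \o id).
apply: homotopic_reparam => //; cont.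
- by case: leP => ?; lra.
- by case: leP => ?; lra.
Qed.

Lemma cat_const_r f : continuous f ->
  path_homotopic (path_cat f (fun=> f 1)) f.
Proof.
move=> cf; have -> : path_cat f (fun=> f 1) = f \o (fun s => Num.min 1 (2 * s)).
  apply/funext => s; rewrite /path_cat /=.
  by case: leP => h1; case: leP => h2; congr f; lra.
rewrite -[X in path_homotopic _ X]/(f \o id).
apply: homotopic_reparam => //; cont.
- by case: leP => ?; lra.
- by case: leP => ?; lra.
Qed.

Lemma cat_rev_r f : continuous f ->
  path_homotopic (path_cat f (path_rev f)) (fun=> f 0).
Proof.
move=> cf; have -> : path_cat f (path_rev f) =
    f \o (fun s => Num.min (2 * s) (2 - 2 * s)).
  apply/funext => s; rewrite /path_cat /path_rev /=.
  by case: leP => h1; case: leP => h2; congr f; lra.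
rewrite -[X in path_homotopic _ X]/(f \o (fun=> 0)).
apply: homotopic_reparam => //; cont.
- by case: leP => ?; lra.
- by case: leP => ?; lra.
Qed.

Lemma path_revK f : path_rev (path_rev f) = f.
Proof. by apply/funext => s; rewrite /path_rev; congr f; ring. Qed.

Lemma cat_rev_l f : continuous f ->
  path_homotopic (path_cat (path_rev f) f) (fun=> f 1).
Proof.
move=> cf; have cr : continuous (path_rev f).
  by apply: (continuous_compose _ cf); cont.
have := cat_rev_r cr; rewrite path_revK.
by rewrite {2}/path_rev subr0.
Qed.

End Homotopy.

Record loop {T : topologicalType} (b : T) : Type := Loop {
  loop_fun :> R -> T;
  loopP : is_path b b loop_fun }.

End Paths.

Arguments loop R {T} b.

HB.instance Definition _ (R : realType) (T : topologicalType) (b : T) :=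
  gen_eqMixin (loop R b).
HB.instance Definition _ (R : realType) (T : topologicalType) (b : T) :=
  gen_choiceMixin (loop R b).

Section FundamentalGroup.
Local Open Scope quotient_scope.
Context {R : realType} {T : topologicalType} (b : T).
Local Notation L := (loop R b).

Let loop_rel' (f g : L) : bool := `[< path_homotopic f g >].

Local Lemma loop_rel_refl : reflexive loop_rel'.
Proof. by move=> [f [cf ? ?]]; apply/asboolP; exact: homotopic_refl. Qed.

Local Lemma loop_rel_sym : symmetric loop_rel'.
Proof.
by move=> f g; apply/asboolP/asboolP; exact: homotopic_sym.
Qed.

Local Lemma loop_rel_trans : transitive loop_rel'.
Proof.
move=> g f h /asboolP fg /asboolP gh; apply/asboolP.
exact: homotopic_trans fg gh.
Qed.

Definition loop_rel := EquivRel loop_rel' loop_rel_refl loop_rel_sym loop_rel_trans.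

Definition pi1 := {eq_quot loop_rel}.
HB.instance Definition _ := Choice.on pi1.
HB.instance Definition _ := EqQuotient.on pi1.

Lemma pi1_eqP (f g : L) : \pi_pi1 f = \pi_pi1 g <-> path_homotopic f g.
Proof. by split => [/eqmodP/asboolP|h]; [|apply/eqmodP/asboolP]. Qed.

Definition loop_one : L :=
  Loop (And3 (@continuous_const R T b) (erefl b) (erefl b)).
Definition loop_mul (f g : L) : L := Loop (is_path_cat (loopP f) (loopP g)).
Definition loop_inv (f : L) : L := Loop (is_path_rev (loopP f)).

Definition pi1_one : pi1 := \pi_pi1 loop_one.
Definition pi1_mul (x y : pi1) : pi1 := \pi_pi1 (loop_mul (repr x) (repr y)).
Definition pi1_inv (x : pi1) : pi1 := \pi_pi1 (loop_inv (repr x)).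

Lemma pi1_mulE (f g : L) :
  pi1_mul (\pi_pi1 f) (\pi_pi1 g) = \pi_pi1 (loop_mul f g).
Proof.
apply/pi1_eqP; apply: homotopic_cat.
- by have [_ _ ->] := loopP (repr (\pi_pi1 f));
     have [_ -> _] := loopP (repr (\pi_pi1 g)).
- by apply/pi1_eqP; rewrite reprK.
- by apply/pi1_eqP; rewrite reprK.
Qed.

Lemma pi1_invE (f : L) : pi1_inv (\pi_pi1 f) = \pi_pi1 (loop_inv f).
Proof.
by apply/pi1_eqP; apply: homotopic_rev; apply/pi1_eqP; rewrite reprK.
Qed.

Local Lemma pi1_mulA : associative pi1_mul.
Proof.
elim/quotW => f; elim/quotW => g; elim/quotW => h.
rewrite (pi1_mulE g h) (pi1_mulE f g) (pi1_mulE f) (pi1_mulE _ h).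
apply/pi1_eqP; have [cf _ f1] := loopP f; have [cg g0 g1] := loopP g; have [ch h0 _] := loopP h.
by apply: (cat_assoc cf cg ch); rewrite ?f1 ?g1.
Qed.

Local Lemma pi1_mul1g : left_id pi1_one pi1_mul.
Proof.
elim/quotW => f; rewrite pi1_mulE; apply/pi1_eqP.
by have [cf f0 _] := loopP f; have := cat_const_l cf; rewrite f0.
Qed.

Local Lemma pi1_mulg1 : right_id pi1_one pi1_mul.
Proof.
elim/quotW => f; rewrite pi1_mulE; apply/pi1_eqP.
by have [cf _ f1] := loopP f; have := cat_const_r cf; rewrite f1.
Qed.

Local Lemma pi1_mulVg : left_inverse pi1_one pi1_inv pi1_mul.
Proof.
elim/quotW => f; rewrite pi1_invE pi1_mulE; apply/pi1_eqP.
by have [cf _ f1] := loopP f; have := cat_rev_l cf; rewrite f1.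
Qed.

Local Lemma pi1_mulgV : right_inverse pi1_one pi1_inv pi1_mul.
Proof.
elim/quotW => f; rewrite pi1_invE pi1_mulE; apply/pi1_eqP.
by have [cf f0 _] := loopP f; have := cat_rev_r cf; rewrite f0.
Qed.

HB.instance Definition _ := isGroup.Build pi1
  pi1_mulA pi1_mul1g pi1_mulg1 pi1_mulVg pi1_mulgV.

Definition loop_class (f : L) : pi1 := \pi_pi1 f.

End FundamentalGroup.

Arguments pi1 R {T} b.

Section MeridianPairs.
Context {R : realType} {X : topologicalType}.
Implicit Types (K S : set X) (f c gamma delta : R -> X).

Definition circle : set (R * R) := [set v | v.1 ^+ 2 + v.2 ^+ 2 = 1].
Definition disk : set (R * R) := [set v | v.1 ^+ 2 + v.2 ^+ 2 <= 1].
Definition open_disk : set (R * R) := [set v | v.1 ^+ 2 + v.2 ^+ 2 < 1].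

(* An open embedding of S^1 x R^2 with zero section K; the associated regular
   neighborhood of K is the image of S^1 x D^2. *)
Definition tubular_nbhd K (phi : (R * R) * (R * R) -> X) : Prop :=
  [/\ {within circle `*` setT, continuous phi},
      set_inj (circle `*` setT) phi,
      forall U, open U -> open (phi @` ((circle `*` setT) `&` U)) &
      phi @` (circle `*` [set 0]) = K].

Definition solid_torus (phi : (R * R) * (R * R) -> X) : set X :=
  phi @` (circle `*` disk).
Definition exterior (phi : (R * R) * (R * R) -> X) : set X :=
  ~` (phi @` (circle `*` open_disk)).
Definition exterior_boundary (phi : (R * R) * (R * R) -> X) : set X :=
  phi @` (circle `*` circle).

Definition null_homotopic_in S c : Prop :=
  exists H : R * R -> X,
    [/\ continuous H,
        forall s, I01 s -> H (s, 0) = c s,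
        forall s, I01 s -> H (s, 1) = H (0, 1),
        forall t, I01 t -> H (0, t) = H (1, t) &
        forall s t, I01 s -> I01 t -> S (H (s, t))].

Definition bounds_disk_in S c : Prop :=
  exists D : R * R -> X,
    [/\ {within disk, continuous D}, set_inj disk D, D @` disk `<=` S &
        forall s, I01 s -> D (cos (2 * pi * s), sin (2 * pi * s)) = c s].

Definition simple_loop_in S c : Prop :=
  [/\ continuous c, c 0 = c 1, {in `[0, 1[ &, injective c} &
      forall s, I01 s -> S (c s)].

Definition meridian_loop (phi : (R * R) * (R * R) -> X) c : Prop :=
  [/\ simple_loop_in (exterior_boundary phi) c,
      ~ null_homotopic_in (exterior_boundary phi) c &
      bounds_disk_in (solid_torus phi) c].

Definition proper_arc (phi : (R * R) * (R * R) -> X) gamma : Prop :=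
  [/\ continuous gamma, {in `[0, 1] &, injective gamma},
      forall s, I01 s -> exterior phi (gamma s) &
      forall s, I01 s -> exterior_boundary phi (gamma s) <-> s = 0 \/ s = 1].

Definition lasso delta gamma c : R -> X :=
  path_cat (path_cat delta gamma)
    (path_cat c (path_rev (path_cat delta gamma))).

Definition represented_by K (b : ~` K) (x : pi1 R b) f : Prop :=
  exists2 l : loop R b, x = loop_class l &
    forall s, I01 s -> set_val (l s) = f s.

Definition represents_meridian_pair K (b : ~` K)
    (phi : (R * R) * (R * R) -> X) gamma (x y : pi1 R b) : Prop :=
  exists a delta c1 c2,
    [/\ 0 < a < 1,
        is_path (set_val b) (gamma a) delta,
        meridian_loop phi c1 /\ c1 0 = gamma 0,
        meridian_loop phi c2 /\ c2 0 = gamma 1 &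
        represented_by x (lasso delta (fun s => gamma (a * (1 - s))) c1) /\
        represented_by y (lasso delta (fun s => gamma (a + (1 - a) * s)) c2)].

Definition components S : set (set X) :=
  [set connected_component S z | z in S].

Definition fixed_set (h : X -> X) : set X := [set z | h z = z].

(* The meridian pair represented by the component of Fix(h) in the exterior
   of K other than the trace of the tunnel tau. *)
Definition long_meridian_pair K (h : X -> X) (tau : set X) (b : ~` K)
    (x y : pi1 R b) : Prop :=
  exists phi gamma,
    [/\ tubular_nbhd K phi,
        proper_arc phi gamma,
        components (fixed_set h `&` exterior phi) =
          [set tau `&` exterior phi; gamma @` `[0, 1]],
        gamma @` `[0, 1] <> tau `&` exterior phi &
        represents_meridian_pair phi gamma x y].

End MeridianPairs.

Section TwoBridge.
Local Open Scope quotient_scope.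
Context {R : realType}.

Definition lattice (k : int * int) : R * R := (k.1%:~R, k.2%:~R).

(* Orbits of the group H generated by the pi-rotations y |-> 2k - y about the
   points k of Z^2. *)
Inductive same_orbit (x : R * R) : R * R -> Prop :=
| same_orbit_refl : same_orbit x x
| same_orbit_rotation y (k : int * int) :
    same_orbit x y -> same_orbit x (lattice k + lattice k - y).

(* None is the slope oo = 1/0. *)
Definition slope_vector (s : option rat) : int * int :=
  if s is Some r then (denq r, numq r) else (0, 1).

Definition slope_line (s : option rat) : set (R * R) :=
  [set (c * (lattice (slope_vector s)).1, c * (lattice (slope_vector s)).2)
  | c in [set: R]].

(* The pair (S^3, K(r)) is a quotient of R^2 x [0,1]: every level R^2 x {t} is
   divided by H, and moreover the lines of slope oo are collapsed at t = 0 and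
   those of slope r at t = 1.  The level t = 1/2 is the Conway sphere, along
   which the slabs t <= 1/2 and t >= 1/2 are glued; they are the tangles
   (B^3, t(oo)) and (B^3, t(r)).  Indeed let s be the slope collapsed at one end,
   v = slope_vector s, (w, v) a basis of Z^2, rho in [0,1] the (rescaled)
   distance to this end. Then (a w + theta v, rho) |-> (a, rho e^(i pi theta))
   identifies the slab with (R/2Z x D^2) / ((a, z) ~ (-a, conj z)), that is,
   with the cylinder [0,1] x D^2 whose two end disks are each folded along
   their real diameter. This is a ball, in which the image of Z^2 x [0,1]
   consists of the two folding diameters, the disks {a} x D^2, 0 < a < 1, are
   bounded by the loops alpha_s and separate these two strings, and the image
   [0,1] x {0} of the collapsed end is the core arc. *)
Definition unit_interval := set_type `[0 : R, 1].
HB.instance Definition _ := Topological.on unit_interval.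

Definition slab := ((R * R) * unit_interval)%type.
HB.instance Definition _ := Topological.on slab.

Definition level (p : slab) : R := set_val p.2.

Definition collapsed (r : rat) (t : R) : set (R * R) :=
  [set d | [\/ d = 0, t = 0 /\ slope_line None d
                    | t = 1 /\ slope_line (Some r) d]].

Definition glued (r : rat) (p q : slab) : bool :=
  `[< p.2 = q.2 /\
      exists2 d, collapsed r (level p) d & same_orbit (p.1 + d) q.1 >].

Lemma same_orbit_trans x y z : same_orbit x y -> same_orbit y z -> same_orbit x z.
Proof. by move=> xy; elim=> // {}z k _ ih; exact: same_orbit_rotation. Qed.

Lemma same_orbit_sym x y : same_orbit x y -> same_orbit y x.
Proof.
elim=> [|{}y k _ ih]; first exact: same_orbit_refl.
apply: same_orbit_trans ih.
rewrite [X in same_orbit _ X](_ : y = lattice k + lattice k - (lattice k + lattice k - y)).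
  exact/same_orbit_rotation/same_orbit_refl.
by rewrite opprB addrC subrK.
Qed.

Lemma same_orbit_shift x y : same_orbit x y ->
  (forall d, same_orbit (x + d) (y + d)) \/ (forall d, same_orbit (x + d) (y - d)).
Proof.
elim=> [|{}y k _ [ih|ih]].
- by left=> d; exact: same_orbit_refl.
- right=> d; rewrite -addrA -opprD.
  exact: same_orbit_rotation.
- left=> d; have := same_orbit_rotation k (ih d).
  by rewrite opprB addrA [in X in X -> _]addrAC.
Qed.

Lemma same_orbit_translate k x y :
  same_orbit x y -> same_orbit (x + lattice k) (y + lattice k).
Proof.
elim=> [|{}y l _ ih]; first exact: same_orbit_refl.
have := same_orbit_rotation (l.1 + k.1, l.2 + k.2) ih.
rewrite (_ : lattice (l.1 + k.1, l.2 + k.2) = lattice l + lattice k); last first.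
  by rewrite /lattice /= !intrD.
congr (same_orbit _ _); rewrite opprD; set a := lattice l; set b := lattice k.
by congr pair; rewrite /=; ring.
Qed.

Lemma slope_lineN s d : slope_line s d -> slope_line s (- d).
Proof. by move=> [c _ <-]; exists (- c) => //; rewrite !mulNr. Qed.

Lemma slope_lineD s d e : slope_line s d -> slope_line s e -> slope_line s (d + e).
Proof. by move=> [c _ <-] [c' _ <-]; exists (c + c') => //; rewrite !mulrDl. Qed.

Lemma collapsedN r t d : collapsed r t d -> collapsed r t (- d).
Proof.
move=> [->|[t0 h]|[t1 h]]; first by rewrite oppr0; constructor 1.
  by constructor 2; split=> //; exact: slope_lineN.
by constructor 3; split=> //; exact: slope_lineN.
Qed.

Lemma collapsedD r t d e :
  collapsed r t d -> collapsed r t e -> collapsed r t (d + e).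
Proof.
move=> [->|[t0 h]|[t1 h]]; first by rewrite add0r.
- move=> [->|[_ h']|[t1 h']]; first by rewrite addr0; constructor 2.
  + by constructor 2; split=> //; exact: slope_lineD.
  + by move: t1; rewrite t0 => /eqP; rewrite eq_sym oner_eq0.
- move=> [->|[t0 h']|[_ h']]; first by rewrite addr0; constructor 3.
  + by move: t1; rewrite t0 => /eqP; rewrite eq_sym oner_eq0.
  + by constructor 3; split=> //; exact: slope_lineD.
Qed.

Local Lemma glued_refl r : reflexive (glued r).
Proof.
move=> p; apply/asboolP; split=> //; exists 0; first by constructor 1.
by rewrite addr0; exact: same_orbit_refl.
Qed.

Local Lemma glued_symW r p q : glued r p q -> glued r q p.
Proof.
move=> /asboolP[pq [d cd o]]; apply/asboolP; split=> //.
rewrite /level -pq -/(level p).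
have [/(_ (- d))|/(_ (- d))] := same_orbit_shift o; rewrite addrK => o'.
  by exists (- d); [exact: collapsedN|exact: same_orbit_sym].
by exists d => //; rewrite opprK in o'; exact: same_orbit_sym.
Qed.

Local Lemma glued_sym r : symmetric (glued r).
Proof. by move=> p q; apply/idP/idP; exact: glued_symW. Qed.

Local Lemma glued_trans r : transitive (glued r).
Proof.
move=> q p z /asboolP[pq [d cd o]] /asboolP[qz [e ce o']].
apply/asboolP; split; first by rewrite pq.
rewrite /level -pq -/(level p) in ce.
have [/(_ e)|/(_ (- e))] := same_orbit_shift o; rewrite -addrA ?opprK => o''.
  exists (d + e); first exact: collapsedD.
  exact: same_orbit_trans o'' o'.
exists (d - e); first by apply: collapsedD => //; exact: collapsedN.
exact: same_orbit_trans o'' o'.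
Qed.

Definition glued_equiv (r : rat) :=
  EquivRel (glued r) (glued_refl r) (glued_sym r) (@glued_trans r).

Definition two_bridge_sphere (r : rat) := {eq_quot (glued_equiv r)}.
HB.instance Definition _ r := Topological.copy (two_bridge_sphere r)
  (quotient_topology (two_bridge_sphere r)).
HB.instance Definition _ r := Quotient.on (two_bridge_sphere r).

Definition pr (r : rat) : slab -> two_bridge_sphere r :=
  \pi_(two_bridge_sphere r).

Lemma continuous_pr r : continuous (pr r).
Proof. exact: pi_continuous. Qed.

(* It is a knot when denq r is odd. *)
Definition two_bridge_knot (r : rat) : set (two_bridge_sphere r) :=
  pr r @` [set p | exists k, p.1 = lattice k].
Arguments two_bridge_knot r : clear implicits.

Definition upper_tunnel (r : rat) : set (two_bridge_sphere r) :=
  pr r @` [set p | level p = 0].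
Definition lower_tunnel (r : rat) : set (two_bridge_sphere r) :=
  pr r @` [set p | level p = 1].

Definition translation (r : rat) (k : int * int) (z : two_bridge_sphere r) :
    two_bridge_sphere r :=
  pr r ((repr z).1 + lattice k, (repr z).2).

Lemma pr_eqP r p q : pr r p = pr r q <-> glued r p q.
Proof. by split=> [/eqmodP|h]; last exact/eqmodP. Qed.

Lemma translation_pr r k p :
  translation k (pr r p) = pr r (p.1 + lattice k, p.2).
Proof.
apply/pr_eqP; have /pr_eqP/asboolP[e [d cd o]] : pr r (repr (pr r p)) = pr r p.
  exact: reprK.
apply/asboolP; split=> //=; exists d => //=.
by rewrite addrAC; exact: same_orbit_translate.
Qed.

Definition upper_inversion (r : rat) :
    two_bridge_sphere r -> two_bridge_sphere r :=
  translation (slope_vector None).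
Definition lower_inversion (r : rat) :
    two_bridge_sphere r -> two_bridge_sphere r :=
  translation (slope_vector (Some r)).

Lemma slope_line_vector s : slope_line s (- lattice (slope_vector s)).
Proof. by exists (- 1) => //; rewrite !mulN1r. Qed.

Lemma upper_tunnel_fixed r :
  @upper_tunnel r `<=` fixed_set (@upper_inversion r).
Proof.
move=> _ [p p0 <-]; rewrite /fixed_set /= /upper_inversion translation_pr.
apply/pr_eqP/asboolP; split=> //=.
exists (- lattice (slope_vector None)); last first.
  by rewrite addrK; exact: same_orbit_refl.
by constructor 2; split=> //; exact: slope_line_vector.
Qed.

Lemma lower_tunnel_fixed r :
  @lower_tunnel r `<=` fixed_set (@lower_inversion r).
Proof.
move=> _ [p p1 <-]; rewrite /fixed_set /= /lower_inversion translation_pr.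
apply/pr_eqP/asboolP; split=> //=.
exists (- lattice (slope_vector (Some r))); last first.
  by rewrite addrK; exact: same_orbit_refl.
by constructor 3; split=> //; exact: slope_line_vector.
Qed.

Definition long_upper_meridian_pair (r : rat) (b : ~` two_bridge_knot r)
    (x y : pi1 R b) : Prop :=
  long_meridian_pair (@upper_inversion r) (@upper_tunnel r) x y.
Definition long_lower_meridian_pair (r : rat) (b : ~` two_bridge_knot r)
    (x y : pi1 R b) : Prop :=
  long_meridian_pair (@lower_inversion r) (@lower_tunnel r) x y.

End TwoBridge.

Arguments two_bridge_knot R r : clear implicits.
Arguments upper_tunnel R r : clear implicits.
Arguments lower_tunnel R r : clear implicits.
Arguments upper_inversion R r : clear implicits.
Arguments lower_inversion R r : clear implicits.

(* 1 / (a + 1 / b) *)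
Definition cfrac2 (a b : int) : rat := (a%:~R + b%:~R^-1)^-1.

(* Main.v *)
From HB Require Import structures.
From mathcomp Require Import all_boot all_order all_algebra.
From mathcomp Require Import all_classical all_reals all_analysis.
From mathcomp Require Import ring lra zify.
Require Import Defs.
Set Implicit Arguments.
Unset Strict Implicit.
Unset Printing Implicit Defensive.
Import Order.TTheory GRing.Theory Num.Theory.
Import numFieldNormedType.Exports.
Local Open Scope classical_set_scope.
Local Open Scope ring_scope.

(* The knot group is mapped to GL(2, R) in such a way that the two meridians of a
   long pair are sent to a pair of matrices playing ping-pong.

   A homomorphism from the fundamental group of the complement is obtained as the
   holonomy of a flat structure, that is, of local group-valued functions which
   differ by locally constant left translations. For the knot of slope r the
   structure is defined by generators a and b, the meridians through the even and the
   odd vertical walls of the slab, subject to the single relation obtained by following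
   a line of slope r. Along the long upper arc the meridian b is conjugated by
   the product D of the walls met by half of such a line, so that the long pair is sent
   to conjugates of powers of a and D b D^-1.

   Write a = Q c, b = c Q with c^2 central, P = Q^m and Z = P^2 c P^-2 c^-1. For the
   slope [2m, -2n] the relation is (Z^-n Q)^2 = c^2 and, up to the center and to
   conjugation, the pair is b, E b E^-1 with E = P^-1 Q^-1 Z^n P; for [2m, 2n] it is
   (Z^n Q)^2 = c^2 and the pair is a, E a E^-1 with E = P^-1 Q Z^n P. In both cases
   the relation says that E is traceless. It is solved in a one-parameter family of
   matrices by the intermediate value theorem, with the trace of a and b so large that
   cones around the eigenvectors of a and around their images by E are disjoint.

   Exchanging the two tangles turns the lower pair of [2m, 2n] (or [2m, -2n]) into the
   upper pair of [2n, 2m] (or [2n, -2m]). *)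

(** * Free pairs and ping-pong *)

Section FreePairs.
Local Open Scope group_scope.

(** Freeness passes back from the image of a homomorphism, so everything reduces to evaluating one
    on two lassos. Two obstacles shape the rest. The tubular neighborhood and the arc of a long pair
    are arbitrary, and a meridian loop is only known to be essential on the torus and to bound a
    disk: it is treated as an unknown nonzero power of a standard small loop, and freeness is proved
    for all nonzero powers, which ping-pong gives at no cost. Next, cones around four directions
    must be made disjoint. Tracelessness makes [E] an involution of the projective line: in an
    eigenbasis of the meridian matrix its position is governed by one diagonal entry, which the
    trace of the product with [E] computes. [Q] is hyperbolic of determinant -1 in one case and a
    rotation in the other. In both, a symmetry conjugating [P ^ 2] to its inverse makes [Z], up to
    conjugation, a square [r ^ 2] with [det r = -1]. Hence the powers of [Z] have explicit
    nonnegative coefficients ([luc]), and the trace equation changes sign on an explicit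
    interval. *)

Definition free_pair {G : groupType} (x y : G) : Prop :=
  x <> y /\ forall w : seq (G * bool),
    (forall l, l \in w -> l.1 = x \/ l.1 = y) ->
    reduced w -> w != [::] -> eval_word w <> 1.

Lemma free_pair_is_free (G : groupType) (x y : G) :
  free_pair x y -> is_free (generated [set x; y]).
Proof.
by move=> [_ xy]; exists [set x; y]; split=> // w wxy; apply: xy => l /wxy.
Qed.

(** Since [f x <> f y], distinct letters stay distinct, so a reduced word in [x] and [y] has a
    reduced image. *)
Lemma free_pair_morph (G H : groupType) (f : G -> H) (x y : G) :
  {morph f : u v / u * v} -> free_pair (f x) (f y) -> free_pair x y.
Proof.
move=> fM [fxy fF]; split=> [xy|w wxy wr w0 w1]; first by apply: fxy; rewrite xy.
have f1 : f 1 = 1 by apply: (mulgI (f 1)); rewrite -fM !mulg1.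
have fV u : f u^-1 = (f u)^-1 by apply: (mulgI (f u)); rewrite -fM !mulgV.
pose F (l : G * bool) := (f l.1, l.2).
have fw v : eval_word (map F v) = f (eval_word v).
  by elim: v => //= -[u []] v /= ->; rewrite fM ?fV.
apply: (fF (map F w)); last by rewrite fw w1.
- by move=> _ /mapP[l /wxy lxy ->] /=; case: lxy => ->; [left|right].
- rewrite /reduced; case: w wr wxy {w0 w1} => //= l w.
  elim: w l => //= k w ih l /andP[kl kw] wxy; apply/andP; split.
    move: kl; apply: contra => /andP[/eqP fkl ->]; rewrite andbT.
    have := wxy l (mem_head _ _).
    have := wxy k; rewrite !inE eqxx orbT => /(_ isT).
    by move=> [ek|ek] [el|el]; rewrite ?ek ?el //;
      exfalso; apply: fxy; rewrite -?ek -?el.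
  by apply: ih => // u uw; apply: wxy; rewrite inE uw orbT.
- by case: w w0 {wr wxy w1}.
Qed.

Lemma free_pair_conj (G : groupType) (g x y : G) :
  free_pair x y -> free_pair (g * x * g^-1) (g * y * g^-1).
Proof.
move=> xy; apply: (@free_pair_morph _ _ (fun u => g^-1 * u * g)).
  by move=> u v; rewrite !mulgA mulgK.
by rewrite !mulgA !mulVg !mul1g !mulgVK.
Qed.

Lemma free_pair_sym (G : groupType) (x y : G) : free_pair x y -> free_pair y x.
Proof.
move=> [xy h]; split=> [yx|w wyx]; first exact: xy.
by apply: h => l /wyx[]; [right|left].
Qed.

Section PingPong.
Context {G : groupType} {T : Type} (act : G -> T -> T).
Hypothesis act1 : forall v, act 1 v = v.
Hypothesis actM : forall g h v, act (g * h) v = act g (act h v).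
Implicit Types (D : set T) (S : bool -> set T) (g : G).

(** [S false] attracts under [g] and [S true] under [g^-1]: whatever lies in [D] outside the
    repelling set moves into the attracting one. [D] will be the set of nonzero vectors, so that
    cones can stand for intervals of the projective line. *)
Definition ping_pong D S g : Prop :=
  [/\ forall s, S s !=set0, forall s, S s `<=` D, S true `&` S false = set0 &
      forall s v, D v -> ~ S (~~ s) v -> S s (act (if s then g^-1 else g) v)].

Lemma ping_pong_sign D S g s v : ping_pong D S g -> S s v -> ~ S (~~ s) v.
Proof.
move=> [_ _ S0 _] Sv Sv'; suff : (S true `&` S false) v by rewrite S0.
by case: s Sv Sv'.
Qed.

Lemma ping_pongV D S g : ping_pong D S g -> ping_pong D (S \o negb) g^-1.
Proof.
move=> [Sn SD S0 Sg]; split=> [s|s|/=|s v Dv /=].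
- exact: Sn.
- exact: SD.
- by rewrite setIC.
- by move/(Sg (~~ s) _ Dv); case: s; rewrite //= invgK.
Qed.

(** After one application the point is in the attracting set, hence outside the repelling one, and
    the next application keeps it there. This absorbs the unknown exponents of the meridians. *)
Lemma ping_pongX D S g k : ping_pong D S g -> ping_pong D S (g ^+ k.+1).
Proof.
move=> gS; have [Sn SD S0 Sg] := gS; split=> // s v Dv Sv.
elim: k => [|k ih]; first exact: Sg.
have -> : (if s then (g ^+ k.+2)^-1 else g ^+ k.+2) =
   (if s then g^-1 else g) * (if s then (g ^+ k.+1)^-1 else g ^+ k.+1).
  by case: s {Sv ih} => //; rewrite -invgM -expgSr.
rewrite actM; apply: Sg; first exact: SD ih.
exact: ping_pong_sign gS ih.
Qed.

Lemma ping_pong_free D S1 S2 g1 g2 :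
  ping_pong D S1 g1 -> ping_pong D S2 g2 ->
  (forall s t, S1 s `&` S2 t = set0) -> free_pair g1 g2.
Proof.
move=> P1 P2 S12.
pose S (b : bool) := if b then S2 else S1; pose g (b : bool) := if b then g2 else g1.
have P b : ping_pong D (S b) (g b) by case: b.
have disj b s c t v : S b s v -> S c t v -> b = c /\ s = t.
  move=> h1 h2; have [bc|] := eqVneq b c.
    subst c; split=> //; case: (eqVneq s t) => // /negbTE st.
    case: (ping_pong_sign (P b) h1); suff -> : ~~ s = t by [].
    by case: s t st {h1 h2} => -[].
  case: b c h1 h2 => -[] //= h1 h2 _.
    by have : (S1 t `&` S2 s) v by []; rewrite S12.
  by have : (S1 s `&` S2 t) v by []; rewrite S12.
(* The last letter acts first. A point outside its repelling set is carried to the attracting set of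
   the first letter; reducedness ensures that each attracting set reached on the way avoids the next
   repelling set. *)
have key (w : seq (bool * bool)) l v : sorted (fun k m => ~~ ((k.1 == m.1) && (k.2 != m.2))) (rcons w l) ->
   D v -> ~ S l.1 (~~ l.2) v ->
   S (head l w).1 (head l w).2
     (act (foldr (fun m u => (if m.2 then (g m.1)^-1 else g m.1) * u) 1 (rcons w l)) v).
  elim: w => /= [_ Dv Sv|k w ih kw Dv Sv].
    by rewrite actM act1; have [_ _ _ Pg] := P l.1; have := Pg l.2 v Dv Sv.
  have ws := path_sorted kw; have {ih} := ih ws Dv Sv.
  set u := act _ v => Su; rewrite actM -/u.
  have [_ SD _ Pg] := P k.1; apply: Pg.
    by have [_ SD' _ _] := P (head l w).1; exact: SD' Su.
  move=> Su'; have [e1 e2] := disj _ _ _ _ _ Su Su'.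
  have : ~~ ((k.1 == (head l w).1) && (k.2 != (head l w).2)).
    by case: (w) kw => /= [|m w'] /andP[].
  by rewrite e1 e2 eqxx /=; case: (k.2).
have main (w : seq (bool * bool)) :
   sorted (fun k m => ~~ ((k.1 == m.1) && (k.2 != m.2))) w -> w != [::] ->
   foldr (fun m u => (if m.2 then (g m.1)^-1 else g m.1) * u) 1 w <> 1.
  case/lastP: w => // w l ws _ w1.
  pose f := head l w.
  (* One of the four sets is neither the attracting set of the first letter nor the repelling set of
     the last. A trivial word would fix its points and also move them into the attracting set of the
     first letter, which is disjoint from it. *)
  have [b [s [h1 h2]]] : exists b s, ~ (b = f.1 /\ s = f.2) /\ ~ (b = l.1 /\ s = ~~ l.2).
    exists (~~ f.1); have [fl|fl] := eqVneq (~~ f.1) l.1.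
      by exists l.2; split=> -[]; case: (f.1) => //; case: (l.2).
    by exists true; split=> -[e _]; [case: (f.1) e|rewrite e eqxx in fl].
  have [Sn SD _ _] := P b; have [v Sv] := Sn s.
  have := key w l v ws (SD _ _ Sv) (fun h => h2 (disj _ _ _ _ _ Sv h)).
  rewrite w1 act1 => /(disj _ _ _ _ _ Sv) [e1 e2].
  exact: h1.
have g12 : g1 <> g2.
  move=> e; apply: (main [:: (false, false); (true, true)]) => //=.
  by rewrite e mulg1 mulgV.
split=> // w wg wr w0.
pose F (l : G * bool) := (l.1 == g2, l.2).
have FK : {in w, forall l, l.1 = g (F l).1}.
  move=> l /wg[e|e]; rewrite /F /= e ?eqxx //.
  by case: eqP => // /g12.
have -> : eval_word w =
  foldr (fun m u => (if m.2 then (g m.1)^-1 else g m.1) * u) 1 (map F w).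
  elim: (w) FK => //= l v ih h; rewrite -ih; last first.
    by move=> k kv; apply: h; rewrite inE kv orbT.
  by rewrite -(h l (mem_head _ _)).
apply: main; last by case: (w) w0.
move: wr; rewrite /reduced; case: (w) FK => //= l v.
elim: v l => //= k v ih l FK /andP[kl kv]; apply/andP; split.
  move: kl; apply: contra => /andP[/eqP fkl ->]; rewrite andbT.
  rewrite (FK l (mem_head _ _)) (FK k); last by rewrite !inE eqxx orbT.
  by rewrite /F /= fkl.
by apply: ih => // m mv; apply: FK; rewrite inE mv orbT.
Qed.

End PingPong.
End FreePairs.

(** * Flat structures and holonomy *)

Section Intervals.
Context {R : realType}.

(** Real induction: the supremum of the points reachable from [a] is reachable by the local
    property, and by the same property cannot be smaller than [b]. It plays the part of compactness
    below. *)
Lemma interval_induction (P : R -> R -> Prop) (a b : R) : a <= b ->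
  (forall x y z, a <= x -> x <= y -> y <= z -> z <= b ->
    P x y -> P y z -> P x z) ->
  (forall x, a <= x <= b -> exists2 e, 0 < e & forall u v,
    a <= u -> u <= v -> v <= b -> x - e < u -> v < x + e -> P u v) ->
  P a b.
Proof.
move=> ab Ptrans Ploc.
pose S := [set x | a <= x <= b /\ P a x].
have [|e0 e0p h0] := Ploc a; first by rewrite lexx.
have Sa : S a by split; [rewrite lexx|apply: h0; lra].
have Sb : has_ubound S by exists b => x [/andP[]].
have Ssup : has_sup S by split=> //; exists a.
set s := sup S.
have as_ : a <= s by exact: ub_le_sup.
have sb : s <= b by apply: ge_sup => //; [exists a|move=> x [/andP[]]].
have [|e e_gt0 he] := Ploc s; first by rewrite as_.
have [x [/andP[ax xb] Px] sx] := sup_adherent e_gt0 Ssup.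
have xs : x <= s by apply: ub_le_sup => //; split=> //; rewrite ax.
pose v := Num.min b (s + e / 2).
have sv : s <= v by rewrite /v le_min sb /=; lra.
have vb : v <= b by rewrite /v ge_min lexx.
have vs : v <= s + e / 2 by rewrite /v ge_min lexx orbT.
have Pv : P a v.
  apply: (Ptrans a x v) => //; first exact: le_trans sv.
  by apply: he => //; rewrite -/s; [exact: le_trans sv|lra].
have [vb'|vltb] := eqVneq v b; first by move: Pv; rewrite vb'.
have vE : v = s + e / 2.
  by move: vltb; rewrite /v; case: leP => //; rewrite eqxx.
have : v <= s by apply: ub_le_sup => //; split=> //; rewrite vb (le_trans as_ sv).
by rewrite vE; lra.
Qed.

Lemma locally_constant_interval (T : Type) (f : R -> T) (a b : R) : a <= b ->
  (forall p, a <= p <= b -> \forall q \near p, a <= q <= b -> f q = f p) ->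
  f a = f b.
Proof.
move=> ab fl; pose P x y := f x = f y.
apply: (@interval_induction P a b) => //; first by move=> x y z _ _ _ _; exact: etrans.
move=> x /fl /nbhs_ballP[e /= e0 he]; exists e => // u v au uv vb xu vx.
rewrite /P; transitivity (f x).
  by apply: he; rewrite ?/ball /= ?ltr_distlC; lra.
by symmetry; apply: he; rewrite ?/ball /= ?ltr_distlC; lra.
Qed.

End Intervals.

Section Holonomy.
Context {R : realType} {X : topologicalType} {G : groupType}.
Local Open Scope group_scope.
Implicit Types (O : set X) (C : set (set X * (X -> G))).

(* A principal G-bundle on O with a flat connection, given by local
   trivializations that differ by locally constant left translations. The
   functions c.2 themselves may vary: with G the additive group of R and
   c.2 a branch of the angle, holonomy is the variation of the angle. *)
Definition flat_structure O C : Prop :=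
  [/\ forall c, C c -> open c.1, forall y, O y -> exists2 c, C c & c.1 y &
      forall c d y, C c -> C d -> c.1 y -> d.1 y ->
        \forall z \near y, c.2 z * (d.2 z)^-1 = c.2 y * (d.2 y)^-1].

(** [h] is an analytic continuation of the chart functions along [H]: locally a left translate of
    [c.2 \o H]. Only points of [A] are compared, so that closed sets such as squares are allowed. *)
Definition flat_section {D : topologicalType} C (A : set D) (H : D -> X)
    (h : D -> G) : Prop :=
  forall p c, A p -> C c -> c.1 (H p) ->
    \forall q \near p, A q -> h q * (c.2 (H q))^-1 = h p * (c.2 (H p))^-1.

Section Sections.
Context {D : topologicalType} {O : set X} {C : set (set X * (X -> G))}.
Hypothesis OC : flat_structure O C.
Implicit Types (A : set D) (H : D -> X) (h : D -> G).

(** Any other chart differs from the given one by a locally constant left translation, so one chart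
    per point suffices. *)
Lemma flat_sectionP A H h : continuous H ->
  (forall p, A p -> exists c, [/\ C c, c.1 (H p) &
    \forall q \near p, A q -> h q * (c.2 (H q))^-1 = h p * (c.2 (H p))^-1]) ->
  flat_section C A H h.
Proof.
have [_ _ Ccomp] := OC; move=> cH loc p d Ap Cd dp.
have [c [Cc cp hc]] := loc p Ap.
have := cH p _ (Ccomp c d _ Cc Cd cp dp) => /= hcd.
apply: filterS2 hc hcd => q hq e2 Aq.
have -> : h q = h p * (c.2 (H p))^-1 * c.2 (H q) by rewrite -(hq Aq) mulgVK.
by rewrite -mulgA e2 !mulgA mulgVK.
Qed.

Lemma flat_section_sub A B H h : A `<=` B ->
  flat_section C B H h -> flat_section C A H h.
Proof.
move=> AB hB p c Ap Cc cp.
by apply: filterS (hB p c (AB _ Ap) Cc cp) => q hq /AB.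
Qed.

Lemma flat_section_mull A H h g :
  flat_section C A H h -> flat_section C A H (fun p => g * h p).
Proof.
move=> hA p c Ap Cc cp.
by apply: filterS (hA p c Ap Cc cp) => q hq /hq; rewrite -!mulgA => ->.
Qed.

Lemma flat_section_ratio A H h k p : (forall q, A q -> O (H q)) ->
  flat_section C A H h -> flat_section C A H k -> A p ->
  \forall q \near p, A q -> h q * (k q)^-1 = h p * (k p)^-1.
Proof.
have [_ Ccov _] := OC; move=> AO hA kA Ap.
have [c Cc cp] := Ccov _ (AO _ Ap).
apply: filterS2 (hA p c Ap Cc cp) (kA p c Ap Cc cp) => q hq kq Aq.
rewrite -[h q](mulgVK (c.2 (H q))) -[k q](mulgVK (c.2 (H q))).
rewrite (hq Aq) (kq Aq) !invgM !mulgA mulgK invgK.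
by rewrite mulgVK.
Qed.

Lemma flat_section_local H p : continuous H -> O (H p) ->
  exists2 U, nbhs p U & exists h, flat_section C U H h.
Proof.
have [Cop Ccov _] := OC; move=> cH Op; have [c Cc cp] := Ccov _ Op.
exists (H @^-1` c.1).
  by apply: cH; apply: open_nbhs_nbhs; split=> //; exact: Cop.
exists (c.2 \o H); apply: flat_sectionP => // q cq; exists c; split=> //.
by apply: nearW => q' _ /=; rewrite !mulgV.
Qed.

(** The two sections differ on the level set [u = y] by a locally constant left factor. The
    assumption on [f] expresses connectedness of that level set, so there is a single factor, and
    translating [k] by it makes the sections match. *)
Lemma flat_section_glue A H (u : D -> R) (y : R) :
  continuous H -> continuous u -> (forall q, A q -> O (H q)) ->
  (forall f : D -> G,
    (forall p, A p /\ u p = y -> \forall q \near p, A q /\ u q = y -> f q = f p) ->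
    forall p q, A p /\ u p = y -> A q /\ u q = y -> f p = f q) ->
  (exists h, flat_section C (A `&` [set p | (u p <= y)%R]) H h) ->
  (exists h, flat_section C (A `&` [set p | (y <= u p)%R]) H h) ->
  exists h, flat_section C A H h.
Proof.
have [_ Ccov _] := OC; move=> cH cu AO conn [h hA] [k kA].
have sec g : (forall p, A p -> u p = y -> h p = g * k p) -> exists h, flat_section C A H h.
  move=> hg; exists (fun p => if (u p <= y)%R then h p else g * k p).
  apply: flat_sectionP => // p Ap; have [c Cc cp] := Ccov _ (AO _ Ap).
  exists c; split=> //.
  have {}kA := flat_section_mull g kA.
  have [upy|upy|upy] := ltgtP (u p) y.
  - have hA' := hA p c (conj Ap (ltW upy)) Cc cp.
    have ny : \forall q \near p, (u q < y)%R by exact: (cu p _ (lt_nbhsl upy)).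
    by apply: filterS2 hA' ny => q hq qy Aq; rewrite (ltW qy) hq //; split=> //; exact: ltW.
  - have kA' := kA p c (conj Ap (ltW upy)) Cc cp.
    have ny : \forall q \near p, (y < u q)%R by exact: (cu p _ (lt_nbhsr upy)).
    apply: filterS2 kA' ny => q hq qy Aq; rewrite leNgt qy /= hq //.
    by split=> //; exact: ltW.
  - have hA' : \forall q \near p, (A `&` [set p | (u p <= y)%R]) q ->
      h q * (c.2 (H q))^-1 = h p * (c.2 (H p))^-1.
      by apply: hA => //; split=> //=; rewrite upy.
    have kA' : \forall q \near p, (A `&` [set p | (y <= u p)%R]) q ->
      (g * k q) * (c.2 (H q))^-1 = (g * k p) * (c.2 (H p))^-1.
      by apply: kA => //; split=> //=; rewrite upy.
    apply: filterS2 hA' kA' => q hq kq Aq.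
    have [uqy|uqy] := leP (u q) y; first by rewrite hq.
    by rewrite kq ?hg //; split=> //=; exact: ltW.
have [[p0 [Ap0 up0]]|nE] := pselect (exists p, A p /\ u p = y); last first.
  by apply: (sec 1) => p Ap uy; exfalso; apply: nE; exists p.
apply: (sec (h p0 * (k p0)^-1)) => p Ap uy.
have := conn (fun q => h q * (k q)^-1) _ p p0 (conj Ap uy) (conj Ap0 up0).
move=> <-; first by rewrite mulgVK.
move=> q [Aq uq].
have := @flat_section_ratio (A `&` [set p | u p = y]) H h k q.
move=> /(_ (fun q Aq => AO q Aq.1)); apply => //.
- by apply: flat_section_sub hA => x [Ax ux]; split=> //=; rewrite ux.
- by apply: flat_section_sub kA => x [Ax ux]; split=> //=; rewrite ux.
Qed.

End Sections.

(** * Existence of flat sections over a square *)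

Section Square.
Context {O : set X} {C : set (set X * (X -> G))}.
Hypothesis OC : flat_structure O C.
Local Open Scope ring_scope.

Definition rectangle (a b c d : R) : set (R * R) :=
  [set p | a <= p.1 <= b /\ c <= p.2 <= d].

Lemma nbhs_pair_rect (p : R * R) (U : set (R * R)) : nbhs p U ->
  exists2 e, 0 < e & forall q : R * R,
    p.1 - e < q.1 < p.1 + e -> p.2 - e < q.2 < p.2 + e -> U q.
Proof.
move=> /nbhs_ballP[e /= e0 he]; exists e => // q q1 q2; apply: he.
by split; rewrite /ball /= ltr_distlC.
Qed.

(** Subdivision of the square: gluing along vertical segments yields a section on a thin strip
    around each height, and gluing along horizontal segments then builds up the square. *)
Lemma square_section (H : R * R -> X) : continuous H ->
  (forall s t, I01 s -> I01 t -> O (H (s, t))) ->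
  exists h, flat_section C (rectangle 0 1 0 1) H h.
Proof.
move=> cH HO.
pose good A := exists h, flat_section C A H h.
have goodS A B : A `<=` B -> good B -> good A.
  by move=> AB [h hB]; exists h; exact: flat_section_sub hB.
have glue1 x y z c d : 0 <= x -> x <= y -> y <= z -> z <= 1 -> 0 <= c -> d <= 1 ->
    good (rectangle x y c d) -> good (rectangle y z c d) -> good (rectangle x z c d).
  move=> x0 xy yz z1 c0 d1 g1 g2.
  apply: (@flat_section_glue _ _ _ OC _ H fst y) => //.
  - by move=> p; exact: cvg_fst.
  - by case=> s t [/= /andP[? ?] /andP[? ?]]; apply: HO; rewrite /I01; lra.
  - move=> f fl; suff main t t' : c <= t -> t <= t' -> t' <= d -> f (y, t) = f (y, t').
      move=> [s t] [s' t'] [[/= _ /andP[ct td]] ->] [[/= _ /andP[ct' td']] ->].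
      have [tt'|tt'] := leP t t'; first exact: main.
      by symmetry; apply: main => //; exact: ltW.
    move=> ct tt' td.
    apply: (@locally_constant_interval _ _ (fun u => f (y, u))) => // u tu.
    have [|e e0 he] := nbhs_pair_rect (fl (y, u) _); first by rewrite /rectangle /=; lra.
    apply/nbhs_ballP; exists e => //= w; rewrite /ball /= ltr_distlC => uw tw.
    by apply: he; rewrite /rectangle /=; lra.
  - by apply: goodS g1 => p [[/= ? ?] /= ?]; split=> /=; lra.
  - by apply: goodS g2 => p [[/= ? ?] /= ?]; split=> /=; lra.
have glue2 c d e : 0 <= c -> c <= d -> d <= e -> e <= 1 ->
    good (rectangle 0 1 c d) -> good (rectangle 0 1 d e) -> good (rectangle 0 1 c e).
  move=> c0 cd de e1 g1 g2.
  apply: (@flat_section_glue _ _ _ OC _ H snd d) => //.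
  - by move=> p; exact: cvg_snd.
  - by case=> s t [/= /andP[? ?] /andP[? ?]]; apply: HO; rewrite /I01; lra.
  - move=> f fl; suff main t t' : 0 <= t -> t <= t' -> t' <= 1 -> f (t, d) = f (t', d).
      move=> [t s] [t' s'] [[/= /andP[ct td] _] ->] [[/= /andP[ct' td'] _] ->].
      have [tt'|tt'] := leP t t'; first exact: main.
      by symmetry; apply: main => //; exact: ltW.
    move=> ct tt' td.
    apply: (@locally_constant_interval _ _ (fun u => f (u, d))) => // u tu.
    have [|r r0 hr] := nbhs_pair_rect (fl (u, d) _); first by rewrite /rectangle /=; lra.
    apply/nbhs_ballP; exists r => //= w; rewrite /ball /= ltr_distlC => uw tw.
    by apply: hr; rewrite /rectangle /=; lra.
  - by apply: goodS g1 => p [[/= ? ?] /= ?]; split=> /=; lra.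
  - by apply: goodS g2 => p [[/= ? ?] /= ?]; split=> /=; lra.
apply: (@interval_induction _ (fun c d => good (rectangle 0 1 c d))) => //.
move=> t t01.
(* The thickness [e] depends on the rectangle and a union takes the smaller one; induction in the
   first coordinate thus still ends with a strip of positive thickness. *)
pose P x y := exists2 e, 0 < e & good (rectangle x y (Num.max 0 (t - e)) (Num.min 1 (t + e))).
suff [e e0 ge] : P 0 1.
  exists e => // u v u0 uv v1 tu vt; apply: goodS ge => p [p1 p2].
  by split=> //; rewrite ge_max le_min; lra.
apply: interval_induction => //.
- move=> x y z x0 xy yz z1 [e e0 ge] [e' e'0 ge'].
  exists (Num.min e e'); first by rewrite lt_min e0.
  have ee : Num.min e e' <= e by rewrite ge_min lexx.
  have ee' : Num.min e e' <= e' by rewrite ge_min lexx orbT.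
  apply: glue1 x0 xy yz z1 _ _ _ _; rewrite ?le_max ?ge_min ?lexx //.
  + apply: goodS ge => p [p1]; rewrite /= ge_max le_min => p2; split=> //.
    by rewrite ge_max le_min; lra.
  + apply: goodS ge' => p [p1]; rewrite /= ge_max le_min => p2; split=> //.
    by rewrite ge_max le_min; lra.
- move=> x x01; have [|U nU [h hU]] := flat_section_local OC (p := (x, t)) cH; first exact: HO.
  have [e e0 he] := nbhs_pair_rect nU.
  exists e => // u v u0 uv v1 xu vx; exists (e / 2); first by lra.
  exists h; apply: flat_section_sub hU => p [p1]; rewrite /= ge_max le_min => p2.
  by apply: he => /=; lra.
Qed.

End Square.
End Holonomy.

(** * Holonomy of paths: homotopy invariance, concatenation, reversal *)

Section PathHolonomy.
Context {R : realType} {X : topologicalType} {G : groupType}.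
Local Open Scope group_scope.
Implicit Types (O : set X) (C : set (set X * (X -> G))).

Lemma flat_section_comp (D E : topologicalType) C (A : set D) (H : D -> X)
    (h : D -> G) (u : E -> D) : continuous u -> flat_section C A H h ->
  flat_section C (u @^-1` A) (H \o u) (h \o u).
Proof. by move=> cu hA p c Ap Cc cp; exact: (cu p _ (hA (u p) c Ap Cc cp)). Qed.

(** By [holonomyE] the value does not depend on the section, and by [path_section] the default [1]
    is not reached for a path in [O]. *)
Definition holonomy C (f : R -> X) : G :=
  xget 1 [set g | exists2 h, flat_section C [set s | I01 s] f h &
                             g = (h 0%R)^-1 * h 1%R].

Section Flat.
Context {O : set X} {C : set (set X * (X -> G))}.
Hypothesis OC : flat_structure O C.
Implicit Types (f : R -> X).

Definition path_in f : Prop := continuous f /\ forall s, I01 s -> O (f s).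

Lemma path_section f : path_in f -> exists h, flat_section C [set s | I01 s] f h.
Proof.
move=> [cf fO].
have [||h hC] := @square_section _ _ _ _ _ OC (f \o fst).
- by apply: (continuous_compose _ cf); exact: continuous_first.
- by move=> s t sI _; exact: fO.
exists (fun s => h (s, 0%R)).
have cu : continuous (fun s : R => (s, 0%R : R)).
  by apply: continuous_pair; [exact: continuous_ident|exact: continuous_const].
apply: (flat_section_sub _ (flat_section_comp cu hC)) => s sI /=.
by rewrite /rectangle /= !lexx ler01.
Qed.

Lemma holonomyE f h : path_in f -> flat_section C [set s | I01 s] f h ->
  holonomy C f = (h 0%R)^-1 * h 1%R.
Proof.
move=> [cf fO] hC; rewrite /holonomy; case: xgetP => [g _ [k kC ->]|]; last first.
  by move=> /(_ ((h 0%R)^-1 * h 1%R)) []; exists h.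
have e : h 0%R * (k 0%R)^-1 = h 1%R * (k 1%R)^-1.
  apply: (@locally_constant_interval _ _ (fun s => h s * (k s)^-1)) => // p pI.
  exact: (@flat_section_ratio _ _ _ _ _ OC [set s | I01 s] f h k p).
apply: (mulgI (k 0%R)); apply: (mulIg (k 1%R)^-1); rewrite !mulgA mulgV mul1g mulgV.
by rewrite -!mulgA -e !mulgA mulgVK mulgV.
Qed.

Lemma eq_holonomy f g : path_in f -> path_in g -> (forall s, I01 s -> f s = g s) ->
  holonomy C f = holonomy C g.
Proof.
move=> fO gO fg; have [h hC] := path_section fO.
rewrite (holonomyE fO hC); symmetry; apply: holonomyE => // p c pI Cc.
rewrite -fg // => cp; apply: filterS (hC p c pI Cc cp) => q hq qI.
by rewrite -fg // hq.
Qed.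

(** Both sides compare the values of one section at the opposite corners [(0, 0)] and [(1, 1)]. *)
Lemma holonomy_square (H : R * R -> X) : continuous H ->
  (forall s t, I01 s -> I01 t -> O (H (s, t))) ->
  holonomy C (fun s => H (s, 0%R)) * holonomy C (fun t => H (1%R, t)) =
  holonomy C (fun t => H (0%R, t)) * holonomy C (fun s => H (s, 1%R)).
Proof.
move=> cH HO; have [h hC] := square_section OC cH HO.
have edge (u : R -> R * R) : continuous u ->
    (forall s, I01 s -> I01 (u s).1 /\ I01 (u s).2) ->
    holonomy C (H \o u) = (h (u 0%R))^-1 * h (u 1%R).
  move=> cu uI; apply: (@holonomyE _ (h \o u)).
    split; first exact: (continuous_compose cu cH).
    by move=> s /uI[? ?] /=; rewrite [u s]surjective_pairing; exact: HO.
  apply: flat_section_sub (flat_section_comp cu hC) => s sI /=.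
  exact: uI.
have cid : continuous (fun s : R => s) by exact: continuous_ident.
have cc (a : R) : continuous (fun _ : R => a) by exact: continuous_const.
rewrite (edge (fun s => (s, 0%R))); last 2 first.
- exact: continuous_pair.
- by move=> s sI; split=> //=; exact: I01_0.
rewrite (edge (fun s => (1%R, s))); last 2 first.
- exact: continuous_pair.
- by move=> s sI; split=> //=; exact: I01_1.
rewrite (edge (fun s => (0%R, s))); last 2 first.
- exact: continuous_pair.
- by move=> s sI; split=> //=; exact: I01_0.
rewrite (edge (fun s => (s, 1%R))); last 2 first.
- exact: continuous_pair.
- by move=> s sI; split=> //=; exact: I01_1.
by rewrite -!mulgA !mulVKg.
Qed.

Lemma holonomy_const f (x : X) : continuous f -> O x ->
  (forall s, I01 s -> f s = x) -> holonomy C f = 1.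
Proof.
move=> cf Ox fx; have fO : path_in f by split=> // s /fx ->.
rewrite (@holonomyE f (fun=> 1)) ?invg1 ?mulg1 //.
by move=> p c pI Cc cp; apply: filterE => q qI; rewrite !fx.
Qed.

Lemma homotopic_holonomy (H : R * R -> X) f g : continuous H ->
  (forall s t, I01 s -> I01 t -> O (H (s, t))) ->
  (forall s, I01 s -> H (s, 0%R) = f s) -> (forall s, I01 s -> H (s, 1%R) = g s) ->
  (forall t, I01 t -> H (0%R, t) = f 0%R /\ H (1%R, t) = f 1%R) ->
  path_in f -> path_in g -> holonomy C f = holonomy C g.
Proof.
move=> cH HO Hf Hg Hc fO gO; have := holonomy_square cH HO.
have cs (t : R) : continuous (fun s => H (s, t)).
  apply: (continuous_compose _ cH); apply: continuous_pair => //.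
    exact: continuous_ident.
  exact: continuous_const.
have cv (s : R) : continuous (fun t => H (s, t)).
  apply: (continuous_compose _ cH); apply: continuous_pair => //.
    exact: continuous_const.
  exact: continuous_ident.
have [_ fI] := fO; have I0 := @I01_0 R; have I1 := @I01_1 R.
rewrite (@holonomy_const (fun t => H (1%R, t)) (f 1%R)) ?mulg1 //; last 2 first.
- exact: fI.
- by move=> t /Hc[].
rewrite (@holonomy_const (fun t => H (0%R, t)) (f 0%R)) ?mul1g //; last 2 first.
- exact: fI.
- by move=> t /Hc[].
rewrite (@eq_holonomy (fun s => H (s, 0%R)) f) //; last first.
  by split=> // s sI; exact: HO.
by rewrite (@eq_holonomy (fun s => H (s, 1%R)) g) //; split=> // s sI; exact: HO.
Qed.

Lemma path_in_cat f g : path_in f -> path_in g -> f 1%R = g 0%R ->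
  path_in (path_cat f g).
Proof.
move=> [cf fO] [cg gO] fg; split; first exact: continuous_cat.
move=> s /andP[s0 s1]; rewrite /path_cat; case: ifP => hs.
  by apply: fO; apply/andP; split; lra.
by move/negbT: hs; rewrite -ltNge => hs; apply: gO; apply/andP; split; lra.
Qed.

Lemma path_in_rev f : path_in f -> path_in (path_rev f).
Proof.
move=> [cf fO]; split=> [|s /andP[s0 s1]]; last by apply: fO; apply/andP; split; lra.
apply: (continuous_compose _ cf); apply: continuous_add; first exact: continuous_const.
by apply: continuous_opp; exact: continuous_ident.
Qed.

Lemma path_in_comp f (u : R -> R) : path_in f -> continuous u ->
  (forall s, I01 s -> I01 (u s)) -> path_in (f \o u).
Proof.
by move=> [cf fO] cu uI; split; [exact: continuous_compose|move=> s /uI /fO].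
Qed.

Lemma holonomy_sub f h (u : R -> R) : path_in f ->
  flat_section C [set s | I01 s] f h -> continuous u ->
  (forall s, I01 s -> I01 (u s)) -> holonomy C (f \o u) = (h (u 0%R))^-1 * h (u 1%R).
Proof.
move=> fO hC cu uI; apply: (@holonomyE _ (h \o u)); first exact: path_in_comp.
by apply: flat_section_sub (flat_section_comp cu hC) => s; exact: uI.
Qed.

Lemma holonomy_one_chart f c : path_in f -> C c -> (forall s, I01 s -> c.1 (f s)) ->
  holonomy C f = (c.2 (f 0%R))^-1 * c.2 (f 1%R).
Proof.
move=> fO Cc fc; apply: (holonomyE fO (h := c.2 \o f)).
apply: (flat_sectionP OC); first by case: fO.
move=> s sI; exists c; split=> //; first exact: fc.
by apply: filterE => q qI; rewrite /= !mulgV.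
Qed.

Lemma holonomy_cat f g : path_in f -> path_in g -> f 1%R = g 0%R ->
  holonomy C (path_cat f g) = holonomy C f * holonomy C g.
Proof.
move=> fO gO fg; have cO := path_in_cat fO gO fg.
have [h hC] := path_section cO; rewrite (holonomyE cO hC).
have cl : continuous (fun s : R => 2^-1 * s)%R.
  by apply: continuous_mul; [exact: continuous_const|exact: continuous_ident].
have cr : continuous (fun s : R => 2^-1 * s + 2^-1)%R.
  by apply: continuous_add => //; exact: continuous_const.
have -> : holonomy C f = holonomy C (path_cat f g \o (fun s => 2^-1 * s))%R.
  apply: eq_holonomy => //.
    by apply: path_in_comp => // s /andP[s0 s1]; apply/andP; split; lra.
  move=> s /andP[s0 s1]; rewrite /path_cat /= ifT; last by lra.
  by congr f; field.
have -> : holonomy C g = holonomy C (path_cat f g \o (fun s => 2^-1 * s + 2^-1))%R.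
  apply: eq_holonomy => //.
    by apply: path_in_comp => // s /andP[s0 s1]; apply/andP; split; lra.
  move=> s /andP[s0 s1]; rewrite /path_cat /=.
  case: ifP => hs; last by congr g; field.
  have -> : s = 0%R by lra.
  by rewrite -fg; congr f; field.
rewrite !(holonomy_sub cO hC) //; last 2 first.
- by move=> s /andP[s0 s1]; apply/andP; split; lra.
- by move=> s /andP[s0 s1]; apply/andP; split; lra.
rewrite mulr0 mulr1 add0r -!mulgA mulVKg; congr (_ * h _).
by field.
Qed.

Lemma holonomy_rev f : path_in f -> holonomy C (path_rev f) = (holonomy C f)^-1.
Proof.
move=> fO; have [h hC] := path_section fO; rewrite (holonomyE fO hC).
rewrite (@holonomy_sub f h (fun s => 1 - s)%R) //.
- by rewrite subr0 subrr invgM invgK.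
- apply: continuous_add; first exact: continuous_const.
  by apply: continuous_opp; exact: continuous_ident.
- by move=> s /andP[s0 s1]; apply/andP; split; lra.
Qed.

End Flat.

End PathHolonomy.
Arguments path_in {R X} O f.

Section Pullback.
Context {R : realType} {X Y : topologicalType} {G : groupType}.
Implicit Types (O : set X) (C : set (set X * (X -> G))).

Lemma flat_structure_pullback O C (F : Y -> X) :
  continuous F -> flat_structure O C ->
  flat_structure (F @^-1` O) [set (F @^-1` c.1, c.2 \o F) | c in C].
Proof.
move=> cF [Cop Ccov Ccomp]; split.
- by move=> _ [c Cc <-] /=; apply: open_comp; [move=> y _; exact: cF|exact: Cop].
- by move=> y /Ccov[c Cc cy]; exists (F @^-1` c.1, c.2 \o F) => //; exists c.
- move=> _ _ y [c Cc <-] [d Cd <-] /= cy dy.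
  exact: (cF y _ (Ccomp c d _ Cc Cd cy dy)).
Qed.

Lemma holonomy_pullback O C (F : Y -> X) (f : R -> Y) :
  continuous F -> flat_structure O C -> path_in (F @^-1` O) f ->
  holonomy [set (F @^-1` c.1, c.2 \o F) | c in C] f = holonomy C (F \o f).
Proof.
move=> cF OC [cf fO].
have fO' : path_in O (F \o f) by split; [exact: continuous_compose|].
have [h hC] := path_section OC fO'.
rewrite (holonomyE OC fO' hC).
apply: (holonomyE (flat_structure_pullback cF OC)); first by [].
by move=> p _ pI [c Cc <-] cp; exact: hC.
Qed.

End Pullback.

Section FundamentalGroupHolonomy.
Context {R : realType} {X : topologicalType} {G : groupType}.
Local Open Scope group_scope.
Local Open Scope quotient_scope.
Context {K : set X} {C : set (set X * (X -> G))}.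
Hypothesis KC : flat_structure (~` K) C.

Lemma continuous_set_val (A : set X) : continuous (@set_val X A).
Proof. exact: initial_continuous. Qed.

Lemma path_in_loop (b : ~` K) (l : loop R b) : path_in (~` K) (set_val \o l).
Proof.
have [cl _ _] := loopP l; split=> [|s _]; last exact: set_valP.
by apply: continuous_compose cl _; exact: continuous_set_val.
Qed.

Definition pi1_holonomy (b : ~` K) (x : pi1 R b) : G :=
  holonomy C (set_val \o (repr x : loop R b)).

Lemma pi1_holonomy_class (b : ~` K) (l : loop R b) :
  pi1_holonomy (loop_class l) = holonomy C (set_val \o l).
Proof.
have /pi1_eqP[H [cH H0 H1 He]] : \pi_(pi1 R b) (repr (loop_class l)) = \pi_(pi1 R b) l.
  exact: reprK.
apply: (homotopic_holonomy KC (H := set_val \o H)).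
- by apply: continuous_compose cH _; exact: continuous_set_val.
- by move=> s t _ _; exact: set_valP.
- by move=> s sI /=; rewrite H0.
- by move=> s sI /=; rewrite H1.
- by move=> t /He[/= -> ->].
- exact: path_in_loop.
- exact: path_in_loop.
Qed.

Lemma pi1_holonomyM (b : ~` K) :
  {morph @pi1_holonomy b : x y / x * y}.
Proof.
move=> x y; have -> : x * y = loop_class (loop_mul (repr x) (repr y)) by [].
rewrite pi1_holonomy_class.
have [_ x0 x1] := loopP (repr x); have [_ y0 y1] := loopP (repr y).
rewrite -(@holonomy_cat _ _ _ _ _ KC) /=; last by rewrite x1 y0.
- by congr holonomy; apply/funext => s; rewrite /= /path_cat; case: ifP.
- exact: path_in_loop.
- exact: path_in_loop.
Qed.

End FundamentalGroupHolonomy.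

(** * Angles *)

Lemma continuous_cosf (R : realType) (X : topologicalType) (u : X -> R) :
  continuous u -> continuous (fun x => cos (u x)).
Proof. by move=> cu; exact: (continuous_compose cu (@continuous_cos R)). Qed.

Lemma continuous_sinf (R : realType) (X : topologicalType) (u : X -> R) :
  continuous u -> continuous (fun x => sin (u x)).
Proof. by move=> cu; exact: (continuous_compose cu (@continuous_sin R)). Qed.

Lemma continuous_fstf (X Y Z : topologicalType) (u : X -> Y * Z) :
  continuous u -> continuous (fun x => (u x).1).
Proof. by move=> cu; exact: (continuous_compose cu (@continuous_first _ _)). Qed.

Lemma continuous_sndf (X Y Z : topologicalType) (u : X -> Y * Z) :
  continuous u -> continuous (fun x => (u x).2).
Proof. by move=> cu; exact: (continuous_compose cu (@continuous_second _ _)). Qed.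

Lemma continuous_opp_id (R : realType) : continuous (-%R : R -> R).
Proof. by apply: (@continuous_opp R R (fun x => x)); exact: continuous_ident. Qed.

Lemma continuous_mul_id (R : realType) (c : R) : continuous ( *%R c).
Proof.
by apply: (@continuous_mul R R (fun=> c) (fun x => x)); [exact: continuous_const|exact: continuous_ident].
Qed.

Lemma continuous_add_id (R : realType) (c : R) : continuous (+%R c).
Proof.
by apply: (@continuous_add R R (fun=> c) (fun x => x)); [exact: continuous_const|exact: continuous_ident].
Qed.
Ltac cont := repeat (try assumption; lazymatch goal with
  | |- continuous (fun x => x) => exact: continuous_ident
  | |- continuous -%R => exact: continuous_opp_id
  | |- continuous ( *%R _) => exact: continuous_mul_id
  | |- continuous (+%R _) => exact: continuous_add_id
  | |- continuous (fun x => (_, _)) => apply: continuous_pair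
  | |- continuous (fun x => _ + _) => apply: continuous_add
  | |- continuous (fun x => - _) => apply: continuous_opp
  | |- continuous (fun x => _ * _) => apply: continuous_mul
  | |- continuous (fun x => cos _) => apply: continuous_cosf
  | |- continuous (fun x => sin _) => apply: continuous_sinf
  | |- continuous (fun x => fst x) => exact: continuous_first
  | |- continuous (fun x => snd x) => exact: continuous_second
  | |- continuous (fun x => fst _) => apply: continuous_fstf
  | |- continuous (fun x => snd _) => apply: continuous_sndf
  | |- continuous (@fst _ _) => exact: continuous_first
  | |- continuous (@snd _ _) => exact: continuous_second
  | |- continuous (pair _) => apply: continuous_pair
  | |- continuous (fun x => ?c) => exact: continuous_const
  end).

Section Angles.
Context {R : realType}.
Implicit Types (v : R * R) (a b r : R).

Lemma cosD2pin a n : cos (a + pi *+ 2 *+ n) = cos a.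
Proof. exact: (periodicn (@cosD2pi R)). Qed.

Lemma sinD2pin a n : sin (a + pi *+ 2 *+ n) = sin a.
Proof. exact: (periodicn (@sinD2pi R)). Qed.

Lemma cosD2piz a (k : int) : cos (a + pi *+ 2 *~ k) = cos a.
Proof.
case: k => n; first exact: cosD2pin.
by rewrite NegzE mulrNz; have := cosD2pin (a - pi *+ 2 *+ n.+1) n.+1; rewrite subrK => ->.
Qed.

Lemma sinD2piz a (k : int) : sin (a + pi *+ 2 *~ k) = sin a.
Proof.
case: k => n; first exact: sinD2pin.
by rewrite NegzE mulrNz; have := sinD2pin (a - pi *+ 2 *+ n.+1) n.+1; rewrite subrK => ->.
Qed.

Lemma cos_eq1 a : cos a = 1 -> exists k : int, a = pi *+ 2 *~ k.
Proof.
move=> ca; have p0 : 0 < pi *+ 2 :> R by rewrite pmulrn_lgt0 ?pi_gt0.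
pose k := Num.floor (a / (pi *+ 2)); exists k.
pose d := a - pi *+ 2 *~ k.
have d0 : 0 <= d.
  have := ge_floor (a / (pi *+ 2)); rewrite ler_pdivlMr // => h.
  by rewrite /d subr_ge0 -[_ *~ k]mulrzl.
have d1 : d < pi *+ 2.
  have := lt_succ_floor (a / (pi *+ 2)); rewrite ltr_pdivrMr // => h.
  rewrite /d ltrBlDl; apply: lt_le_trans h _.
  by rewrite -[pi *+ 2 *~ k]mulrzl intrD1 mulrDl mul1r.
have cd : cos d = 1 by rewrite -ca -(cosD2piz d k) subrK.
suff : d = 0 by move/eqP; rewrite subr_eq0 => /eqP.
apply/eqP; rewrite eq_le d0 andbT leNgt; apply/negP => dp.
have : 0 < sin (d / 2).
  by apply: sin_gt0_pi; apply/andP; split; [lra|move: d1; rewrite mulr2n; lra].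
have -> : sin (d / 2) = 0; last by rewrite ltxx.
have dd : d = d / 2 *+ 2 by rewrite mulr2n; lra.
have := cos2Dsin2 (d / 2); have := cos_mulr2n (d / 2); rewrite -dd cd mulr2n => h1 h2.
by apply/eqP; rewrite -sqrf_eq0; apply/eqP; lra.
Qed.

Definition norm2 v : R := Num.sqrt (v.1 ^+ 2 + v.2 ^+ 2).
Definition polar r a : R * R := (r * cos a, r * sin a).

Lemma norm2_gt0 v : v <> 0 -> 0 < norm2 v.
Proof.
move=> v0; rewrite sqrtr_gt0 lt0r addr_ge0 ?sqr_ge0 // andbT.
apply/negP; rewrite paddr_eq0 ?sqr_ge0 // !sqrf_eq0 => /andP[/eqP v1 /eqP v2].
by apply: v0; rewrite [v]surjective_pairing v1 v2.
Qed.

Lemma norm2_polar r a : 0 <= r -> norm2 (polar r a) = r.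
Proof.
by move=> r0; rewrite /norm2 /= !exprMn -mulrDr cos2Dsin2 mulr1 sqrtr_sqr ger0_norm.
Qed.

Lemma polar_neq0 r a : 0 < r -> polar r a <> 0.
Proof.
move=> r0 /(congr1 norm2); rewrite norm2_polar ?ltW //.
by rewrite /norm2 /= !expr0n /= addr0 sqrtr0 => rE; rewrite rE ltxx in r0.
Qed.

Lemma polarD2pi r a (k : int) : polar r (a + pi *+ 2 *~ k) = polar r a.
Proof. by rewrite /polar cosD2piz sinD2piz. Qed.

Lemma polarD_eq r a b : 0 < r ->
  (polar r (a + b) = polar r a) <-> (cos b = 1 /\ sin b = 0).
Proof.
move=> r0; have rU : r != 0 by rewrite gt_eqF.
split=> [[/(mulfI rU) ec /(mulfI rU) es]|[c1 s0]]; last first.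
  by rewrite /polar cosD sinD c1 s0 !mulr0 !mulr1 subr0 addr0.
have -> : b = (a + b) - a by ring.
rewrite cosB sinB ec es; split; last by ring.
by rewrite -(cos2Dsin2 a); ring.
Qed.

Lemma polar_inj2pi r a b : 0 < r -> polar r a = polar r b ->
  exists k : int, a = b + pi *+ 2 *~ k.
Proof.
move=> r0; have {1}-> : a = b + (a - b) by ring.
move=> /(polarD_eq _ _ r0)[/cos_eq1[k kE] _]; exists k.
by rewrite -kE; ring.
Qed.

Lemma continuous_polar (X : topologicalType) (u v : X -> R) :
  continuous u -> continuous v -> continuous (fun x => polar (u x) (v x)).
Proof.
by move=> cu cv; rewrite /polar; cont.
Qed.

Lemma continuous_norm2 : continuous norm2.
Proof.
have cq : continuous (fun v : R * R => v.1 ^+ 2 + v.2 ^+ 2).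
  by rewrite (_ : (fun _ => _) = fun v => v.1 * v.1 + v.2 * v.2); [cont|].
exact: (continuous_compose cq (@sqrt_continuous R)).
Qed.

(** All continuous branches of the argument on open sets. [Algebra.to_multiplicative] turns addition
    into the group law, so that holonomy is the variation of the angle. *)
Definition angle_charts : set (set (R * R) * (R * R -> Algebra.to_multiplicative R)) :=
  [set c | open c.1 /\ forall v, c.1 v -> [/\ v <> 0,
     v = polar (norm2 v) (c.2 v : R) & {for v, continuous (c.2 : R * R -> R)}]].

Lemma polar_atan v : 0 < v.1 -> v = polar (norm2 v) (atan (v.2 / v.1)).
Proof.
case: v => x y /= x0; have xU : x != 0 by rewrite gt_eqF.
have sq : Num.sqrt (1 + (y / x) ^+ 2) = norm2 (x, y) / x.
  rewrite -[RHS]ger0_norm; last first.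
    by rewrite divr_ge0 // ?sqrtr_ge0 // ltW.
  rewrite -sqrtr_sqr; congr Num.sqrt; rewrite /norm2 !expr_div_n sqr_sqrtr ?addr_ge0 ?sqr_ge0 //=.
  by field.
have nU : norm2 (x, y) != 0.
  by rewrite gt_eqF // norm2_gt0 // => -[e]; rewrite e eqxx in xU.
have ca : cos (atan (y / x)) = x / norm2 (x, y).
  by rewrite cos_atan sq invf_div.
rewrite /polar ca; congr pair; first by field.
have -> : sin (atan (y / x)) = tan (atan (y / x)) * cos (atan (y / x)).
  by rewrite /tan divfK // ca mulf_neq0 // invr_neq0.
by rewrite atanK ca; field; rewrite xU nU.
Qed.

Lemma angle_chart_exists v : v <> 0 -> exists2 c, angle_charts c & c.1 v.
Proof.
(* [g x] is linear with [g v] in the right half-plane; it is a rotation of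
   angle [- a]. *)
pose chart (l k : R * R -> R) (a : R) : set (R * R) * (R * R -> Algebra.to_multiplicative R) :=
  ([set x | 0 < l x], fun x => atan (k x / l x) + a).
have chartP (l k : R * R -> R) (a : R) : continuous l -> continuous k ->
    (forall x, x = (l x * cos a - k x * sin a, l x * sin a + k x * cos a)) ->
    angle_charts (chart l k a).
  move=> cl ck lk; split=> [|x /= lx].
    rewrite /= (_ : [set x | _] = l @^-1` [set y | 0 < y]) //.
    by apply: open_comp; [move=> x _; exact: cl|exact: open_gt].
  have nlk : norm2 (l x, k x) = norm2 x.
    rewrite [in RHS](lk x) /norm2 /=; congr Num.sqrt.
    rewrite -[LHS]mulr1 -(cos2Dsin2 a); ring.
  split.
  - move=> x0; have := lk x; rewrite x0 => -[e1 e2].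
    have : l x ^+ 2 + k x ^+ 2 = 0.
      rewrite x0 -[LHS]mulr1 -(cos2Dsin2 a).
      transitivity ((l 0 * cos a - k 0 * sin a) ^+ 2 + (l 0 * sin a + k 0 * cos a) ^+ 2).
        by ring.
      by rewrite -e1 -e2 /=; ring.
    move/eqP; rewrite paddr_eq0 ?sqr_ge0 // sqrf_eq0 => /andP[/eqP l0 _].
    by rewrite l0 ltxx in lx.
  - have /= := @polar_atan (l x, k x) lx; rewrite nlk /polar => -[el ek].
    rewrite cosD sinD [LHS]lk; move: el ek; move: (atan (k x / l x)) => th -> ->.
    by congr pair; ring.
  - apply: (@cvgD _ _ _ _ _ (fun x => atan (k x / l x)) (fun=> a)); last exact: cvg_cst.
    apply: continuous_comp; last exact: continuous_atan.
    apply: cvgM; first exact: ck.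
    by apply: cvgV; [rewrite gt_eqF|exact: cl].
have cv1 : continuous (fun x : R * R => x.1) by cont.
have cv2 : continuous (fun x : R * R => x.2) by cont.
have cn1 : continuous (fun x : R * R => - x.1) by cont.
have cn2 : continuous (fun x : R * R => - x.2) by cont.
move=> v0; have : [\/ 0 < v.1, 0 < - v.1, 0 < v.2 | 0 < - v.2].
  have [h|h|h1] := ltgtP v.1 0; [by constructor 2; lra|by constructor 1|].
  have [h|h|h2] := ltgtP v.2 0; [by constructor 4; lra|by constructor 3|].
  by exfalso; apply: v0; rewrite [v]surjective_pairing h1 h2.
move=> [h|h|h|h].
- exists (chart (fun x => x.1) (fun x => x.2) 0) => //; apply: (chartP _ _ _ cv1 cv2) => x.
  by rewrite cos0 sin0 {1}[x]surjective_pairing; congr pair; ring.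
- exists (chart (fun x => - x.1) (fun x => - x.2) pi) => //; apply: (chartP _ _ _ cn1 cn2) => x.
  by rewrite cospi sinpi {1}[x]surjective_pairing; congr pair; ring.
- exists (chart (fun x => x.2) (fun x => - x.1) (pi / 2)) => //; apply: (chartP _ _ _ cv2 cn1) => x.
  by rewrite cos_pihalf sin_pihalf {1}[x]surjective_pairing; congr pair; ring.
- exists (chart (fun x => - x.2) (fun x => x.1) (- (pi / 2))) => //; apply: (chartP _ _ _ cn2 cv1) => x.
  by rewrite cosN sinN cos_pihalf sin_pihalf {1}[x]surjective_pairing; congr pair; ring.
Qed.

(** Two branches differ by a number of cosine 1 and sine 0. At nearby points these differences are
    less than [1 <= pi / 2] apart, hence equal by injectivity of the sine. *)
Lemma angle_flat :
  @flat_structure (R * R)%type (Algebra.to_multiplicative R) [set v | v <> 0] angle_charts.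
Proof.
split=> [c []//|y /= y0|c d y [co cP] [do_ dP] cy dy]; first exact: angle_chart_exists.
have [y0 yc cc] := cP y cy; have [_ yd cd] := dP y dy.
pose k (z : R * R) : R := (c.2 z : R) - (d.2 z : R).
have ck : {for y, continuous k}.
  by apply: cvgB; [exact: cc|exact: cd].
have nc : nbhs y c.1 by apply: open_nbhs_nbhs; split.
have nd : nbhs y d.1 by apply: open_nbhs_nbhs; split.
have nk : \forall z \near y, `|k y - k z| < 1.
  by move/cvgrPdist_lt : ck; apply.
near=> z; have cz : c.1 z by near: z.
have dz : d.1 z by near: z.
have sin0 x : c.1 x -> d.1 x -> cos (k x) = 1 /\ sin (k x) = 0.
  move=> cx dx; have [x0 xc _] := cP x cx; have [_ xd _] := dP x dx.
  apply/(polarD_eq (d.2 x : R) _ (norm2_gt0 x0)); rewrite -xd.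
  by rewrite [RHS]xc; congr polar; rewrite /k; ring.
have [cy1 sy0] := sin0 y cy dy; have [cz1 sz0] := sin0 z cz dz.
have : k y - k z = 0.
  have k1 : `|k y - k z| < 1 by near: z.
  have pi1 := @pihalf_ge1 R; move: k1; rewrite ltr_norml => k1.
  apply: sin_inj; rewrite ?in_itv /=; [lra|lra|].
  by rewrite sinB sy0 sz0 trigo.sin0; ring.
by move/eqP; rewrite subr_eq0 => /eqP h; symmetry; exact: h.
Unshelve. all: by end_near. Qed.

End Angles.

Section AngleLifting.
Context {R : realType}.

Lemma I01_clamped (s : R) : I01 (clamp s). Proof. exact: I01_clamp. Qed.

Lemma clamp_continuous : continuous (@clamp R).
Proof.
by apply: (@continuous_clamp _ _ (fun s : R => s)); exact: continuous_ident.
Qed.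

(** Path lifting for the argument. A flat section is controlled only on [[0,1]], whence [clamp];
    that it measures the angle is a truth value locally constant in [s], carried over from
    [s = 0]. *)
Lemma angle_lift (f : R -> R * R) (a0 : R) : continuous f ->
  (forall s, I01 s -> f s <> 0) -> f 0 = polar (norm2 (f 0)) a0 ->
  exists a : R -> R, [/\ continuous a, a 0 = a0,
    forall s, I01 s -> f s = polar (norm2 (f s)) (a s) &
    (holonomy angle_charts f : R) = a 1 - a 0].
Proof.
move=> cf f0 fa; have fO : path_in [set v : R * R | v <> 0] f by [].
have [h hC] := path_section angle_flat fO.
have {}hC : forall p, I01 p -> exists c, [/\ angle_charts c, c.1 (f p) &
    \forall q \near p, I01 q -> (h q : R) = (c.2 (f q) : R) + ((h p : R) - (c.2 (f p) : R))].
  move=> p pI; have [c Cc cp] := angle_chart_exists (f0 p pI); exists c; split=> //.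
  apply: filterS (hC p c pI Cc cp) => q hq /hq e.
  have {}e : (h q : R) - (c.2 (f q) : R) = (h p : R) - (c.2 (f p) : R) by exact: e.
  by rewrite -e addrC subrK.
pose d : R := a0 - (h 0 : R).
exists (fun s => (h (clamp s) : R) + d); split.
- move=> s; have [c [Cc cp hc]] := hC _ (I01_clamped s).
  have [_ /(_ _ cp)[_ _ cc]] := Cc.
  have cfc : {for s, continuous (fun s' => (c.2 (f (clamp s')) : R))}.
    apply: (@continuous_comp _ _ _ (f \o clamp) (c.2 : R * R -> R)) => //.
    by apply: continuous_comp; [exact: clamp_continuous|exact: cf].
  have e : \forall q \near s, (c.2 (f (clamp q)) : R) +
      ((h (clamp s) : R) - (c.2 (f (clamp s)) : R)) + d = (h (clamp q) : R) + d.
    have hc' : \forall q \near s, I01 (clamp q) -> (h (clamp q) : R) =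
        (c.2 (f (clamp q)) : R) + ((h (clamp s) : R) - (c.2 (f (clamp s)) : R)).
      exact: (@clamp_continuous s _ hc).
    by near=> q; rewrite (near hc' q) //; exact: I01_clamped.
  apply: cvg_trans (near_eq_cvg e) _.
  rewrite (_ : (h (clamp s) : R) + d = (c.2 (f (clamp s)) : R) +
    ((h (clamp s) : R) - (c.2 (f (clamp s)) : R)) + d); last by ring.
  by apply: cvgD; [apply: cvgD; [exact: cfc|exact: cvg_cst]|exact: cvg_cst].
- by rewrite clampE ?I01_0 //; rewrite /d; ring.
- move=> s sI; rewrite clampE //.
  pose b s := `[< f s = polar (norm2 (f s)) ((h s : R) + d) >].
  suff : b s by move/asboolP.
  suff -> : b s = b 0 by apply/asboolP; rewrite fa norm2_polar ?sqrtr_ge0 //; congr polar; rewrite /d; ring.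
  symmetry; apply: locally_constant_interval; first by case/andP: sI.
  move=> p ps; have pI : I01 p by rewrite /I01; move: sI ps; rewrite /I01; lra.
  have [c [[oc cP] cp hc]] := hC p pI.
  have ncp : \forall q \near p, c.1 (f q).
    by apply: (cf p c.1); apply: open_nbhs_nbhs; split.
  apply: filterS2 hc ncp => q hq cq qs.
  have qI : I01 q by rewrite /I01; move: sI qs; rewrite /I01; lra.
  have bE x : c.1 (f x) -> (h x : R) = (c.2 (f x) : R) + ((h p : R) - (c.2 (f p) : R)) ->
     b x = `[< cos ((h p : R) - (c.2 (f p) : R) + d) = 1 /\ sin ((h p : R) - (c.2 (f p) : R) + d) = 0 >].
    move=> cx hx; have [x0 xp _] := cP _ cx.
    apply: asbool_equiv_eq; rewrite hx -addrA {1}xp.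
    have xE := polarD_eq (c.2 (f x) : R) ((h p : R) - (c.2 (f p) : R) + d) (norm2_gt0 x0).
    by split=> [e|/xE ->//]; apply/xE; rewrite -e.
  by rewrite !bE //; [ring|exact: hq].
- rewrite !clampE ?I01_0 ?I01_1 //.
  rewrite (holonomyE angle_flat fO (h := h)).
    by transitivity (- (h 0 : R) + (h 1 : R)); [by []|ring].
  apply: flat_sectionP; [exact: angle_flat|exact: cf|move=> p pI].
  have [c [Cc cp hc]] := hC p pI; exists c; split=> //.
  apply: filterS hc => q hq /hq e.
  suff : (h q : R) - (c.2 (f q) : R) = (h p : R) - (c.2 (f p) : R) by [].
  by rewrite e; ring.
Unshelve. all: by end_near. Qed.

End AngleLifting.

(** * Tubular neighborhoods and meridians *)

Lemma continuous_within_compose (X Y Z : topologicalType) (A : set Y)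
    (u : X -> Y) (f : Y -> Z) : {within A, continuous f} -> continuous u ->
  (forall x, A (u x)) -> continuous (fun x => f (u x)).
Proof.
move=> /subspace_continuousP cf cu uA x V /(cf _ (uA x)) nV.
by have := cu x _ nV; rewrite /nbhs /=; apply: filterS => y /=; apply; exact: uA.
Qed.

Section Tubular.
Context {R : realType} {X : topologicalType} {K : set X}.
Context (phi : (R * R) * (R * R) -> X).
Hypothesis tub : tubular_nbhd K phi.
Let P := ((R * R) * (R * R))%type.
Let S : set P := circle `*` setT.

Definition punctured_tube : set X := phi @` (circle `*` [set v | v <> 0]).

Definition tube_inv (x : X) : P := xget (0, 0) [set z | S z /\ phi z = x].

Lemma tube_invK z : S z -> tube_inv (phi z) = z.
Proof.
have [_ inj _ _] := tub; move=> Sz; rewrite /tube_inv.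
case: xgetP => [w _ [Sw /inj wz]|/(_ z) []]; last by [].
by apply: wz; rewrite inE.
Qed.

Lemma tube_inv_continuous x : (phi @` S) x -> {for x, continuous tube_inv}.
Proof.
have [_ _ op _] := tub; move=> [z Sz <-] V; rewrite tube_invK // => /nbhs_interior nV.
have : open_nbhs (phi z) (phi @` (S `&` interior V)).
  split; first by apply: op; exact: open_interior.
  by exists z => //; split=> //; exact: nbhs_singleton.
move/open_nbhs_nbhs; apply: filterS => _ [w [Sw Vw] <-] /=.
by rewrite tube_invK //; exact: interior_subset.
Qed.

Lemma continuous_tube_inv (Y : topologicalType) (u : Y -> X) : continuous u ->
  (forall y, (phi @` S) (u y)) -> continuous (fun y => tube_inv (u y)).
Proof.
move=> cu uS y; apply: (@continuous_comp _ _ _ u tube_inv); first exact: cu.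
exact: tube_inv_continuous.
Qed.

(** The universal covering of the punctured tube by [R^3], with coordinates the longitudinal angle,
    the meridional angle and the logarithm of the radius. In it straight-line homotopies are
    available. *)
Definition tube (z : (R * R) * R) : X :=
  phi (polar 1 z.1.1, polar (expR z.2) z.1.2).

Lemma circle_polar (a : R) : circle (polar 1 a).
Proof. by rewrite /circle /= !mul1r cos2Dsin2. Qed.

Lemma continuous_tube : continuous tube.
Proof.
have [cphi _ _ _] := tub.
have ce : continuous (fun z : (R * R) * R => expR z.2).
  by apply: continuous_compose (@continuous_expR R); cont.
have cu : continuous (fun z : (R * R) * R => (polar 1 z.1.1, polar (expR z.2) z.1.2) : P).
  by apply: continuous_pair; apply: continuous_polar => //; cont.
apply: (continuous_within_compose cphi cu) => w; split=> //=.
exact: circle_polar.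
Qed.

Lemma tube_in z : punctured_tube (tube z).
Proof.
exists (polar 1 z.1.1, polar (expR z.2) z.1.2) => //; split=> /=.
  exact: circle_polar.
by apply: polar_neq0; exact: expR_gt0.
Qed.

Lemma punctured_tube_notK : punctured_tube `<=` ~` K.
Proof.
have [_ inj _ phiK] := tub; move=> _ [z [z1 z2] <-]; rewrite -phiK => -[w [w1 w2] wz].
have zw : w = z by apply: inj wz; rewrite inE.
by apply: z2; rewrite -zw.
Qed.

Lemma path_in_tube (f : R -> (R * R) * R) : continuous f -> path_in (~` K) (tube \o f).
Proof.
move=> cf; split; first exact: (continuous_compose cf continuous_tube).
by move=> s _; apply: punctured_tube_notK; exact: tube_in.
Qed.

Lemma tube_inv_tube z :
  tube_inv (tube z) = (polar 1 z.1.1, polar (expR z.2) z.1.2).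
Proof. by rewrite tube_invK //; split=> //; exact: circle_polar. Qed.

(** Total change of the longitudinal angle; [clamp] discards the values of [w] outside [[0,1]],
    which may leave the tube. *)
Definition longitude (w : R -> X) : R :=
  holonomy angle_charts (fun s => (tube_inv (w (clamp s))).1).

Lemma tube_lift (w : R -> X) (z0 : (R * R) * R) : continuous w ->
  (forall s, I01 s -> punctured_tube (w s)) -> tube z0 = w 0 ->
  exists z : R -> (R * R) * R, [/\ continuous z, z 0 = z0,
    forall s, I01 s -> tube (z s) = w s &
    longitude w = (z 1).1.1 - (z 0).1.1].
Proof.
move=> cw wP z0E; pose w' s := w (clamp s).
have cw' : continuous w' by exact: (continuous_compose (@clamp_continuous R) cw).
have w'P s : punctured_tube (w' s) by exact/wP/I01_clamped.
have w'E s : exists u v, [/\ circle u, v <> 0, tube_inv (w' s) = (u, v) & phi (u, v) = w' s].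
  have [[u v] [/= cu v0] <-] := w'P s; exists u, v; split=> //.
  by rewrite tube_invK //; split.
have ci : continuous (fun s => tube_inv (w' s)).
  by apply: continuous_tube_inv => // s; have [z [z1 z2] <-] := w'P s; exists z.
pose u s := (tube_inv (w' s)).1; pose v s := (tube_inv (w' s)).2.
have cu : continuous u by exact: continuous_fstf.
have cv : continuous v by exact: continuous_sndf.
have u1 s : norm2 (u s) = 1.
  have [u' [v' [cu' _ e _]]] := w'E s; rewrite /u e /=.
  by move: cu'; rewrite /circle /norm2 /= => ->; rewrite sqrtr1.
have v0 s : v s <> 0 by have [u' [v' [_ ? e _]]] := w'E s; rewrite /v e.
have u0 s : u s <> 0.
  by move=> e; have := u1 s; rewrite e /norm2 /= expr0n /= addr0 sqrtr0 => /eqP;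
    rewrite eq_sym oner_eq0.
have e0 : tube_inv (w' 0) = (polar 1 z0.1.1, polar (expR z0.2) z0.1.2).
  by rewrite /w' clampE ?I01_0 // -z0E tube_inv_tube.
have [||a [ca a0 ua la]] := @angle_lift _ u z0.1.1 cu.
- by move=> s _; exact: u0.
- by rewrite u1 /u e0.
have [||b [cb b0 vb _]] := @angle_lift _ v z0.1.2 cv.
- by move=> s _; exact: v0.
- by rewrite {2}/v e0 norm2_polar ?expR_ge0 // /v e0.
pose r s := ln (norm2 (v s)).
have cr : continuous r.
  move=> s; apply: continuous_comp.
    exact: (continuous_compose cv (@continuous_norm2 R)).
  by apply: continuous_ln; exact: norm2_gt0.
exists (fun s => ((a s, b s), r s)); split.
- by apply: continuous_pair => //; exact: continuous_pair.
- by rewrite a0 b0 /r /v e0 norm2_polar ?expR_ge0 //= expRK [RHS]surjective_pairing [z0.1 in RHS]surjective_pairing.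
- move=> s sI; rewrite /tube /= /r lnK ?posrE ?norm2_gt0 //.
  have := ua s sI; rewrite u1 => <-; rewrite -(vb s sI).
  rewrite -[u s]/(_.1) -[v s]/(_.2) -surjective_pairing.
  have [u' [v' [_ _ -> ->]]] := w'E s.
  by rewrite /w' clampE.
- exact: la.
Qed.

(** In the relation between the four sides of the square, the vertical sides are the same path and
    cancel, and the bottom is constant; so the top has no holonomy. *)
Lemma free_null_longitude (w : R -> X) (H : R * R -> X) : continuous H ->
  continuous w -> (forall s t, I01 s -> I01 t -> (phi @` S) (H (s, t))) ->
  (forall s, I01 s -> H (s, 1) = w s) -> (forall s, I01 s -> H (s, 0) = H (0, 0)) ->
  (forall t, I01 t -> H (0, t) = H (1, t)) -> longitude w = 0.
Proof.
move=> cH cw HS Hw H0 Hs.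
pose V (p : R * R) := (tube_inv (H (clamp p.1, clamp p.2))).1.
have cc : continuous (fun p : R * R => H (clamp p.1, clamp p.2)).
  by apply: (continuous_compose _ cH); apply: continuous_pair;
    apply: (continuous_compose _ (@clamp_continuous R)); cont.
have VS p : (phi @` S) (H (clamp p.1, clamp p.2)) by apply: HS; exact: I01_clamped.
have cV : continuous V by apply: continuous_fstf; exact: continuous_tube_inv.
have V0 p : V p <> 0.
  rewrite /V; have [[u v] [/= cu _] <-] := VS p; rewrite tube_invK; last by split.
  move=> /= u0; move: cu; rewrite /circle /= u0 /= expr0n /= addr0 => /eqP.
  by rewrite eq_sym oner_eq0.
have cl (t : R) : continuous (fun s => V (s, t)).
  by apply: (continuous_compose _ cV); cont.
have cr (t : R) : continuous (fun s => V (t, s)).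
  by apply: (continuous_compose _ cV); cont.
have c0 := @clampE R 0 (@I01_0 R); have c1 := @clampE R 1 (@I01_1 R).
pose hol (f : R -> R * R) : R := holonomy angle_charts f.
have sq : hol (fun s => V (s, 0)) + hol (fun t => V (1, t)) =
    hol (fun t => V (0, t)) + hol (fun s => V (s, 1)).
  exact: (holonomy_square (@angle_flat R) cV (fun s t _ _ => V0 (s, t))).
have h0 : hol (fun s => V (s, 0)) = 0.
  apply: (@holonomy_const _ _ _ _ _ (@angle_flat R) _ (V (0, 0))); [exact: cl|exact: V0|].
  by move=> s sI; rewrite /V /= c0 clampE // H0.
have h1 : (fun t => V (1, t)) = (fun t => V (0, t)).
  by apply/funext => t; rewrite /V /= c0 c1 Hs //; exact: I01_clamped.
have -> : longitude w = hol (fun s => V (s, 1)).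
  apply: (eq_holonomy (@angle_flat R)).
  - split=> [|s sI]; last first.
      by have := V0 (s, 1); rewrite /V /= c1 Hw //; exact: I01_clamped.
    have -> : (fun s => (tube_inv (w (clamp s))).1) = (fun s => V (s, 1)); last exact: cl.
    by apply/funext => s; rewrite -Hw ?I01_clamped // /V /= c1.
  - by split=> // s _; exact: V0.
  - by move=> s sI; rewrite -Hw ?I01_clamped // /V /= c1.
by move: sq; rewrite h0 h1; lra.
Qed.

Lemma tube_surj (x : X) : punctured_tube x -> exists z, tube z = x.
Proof.
move=> [[u v] [/= cu v0] <-].
have u0 : u <> 0.
  by move=> e; move: cu; rewrite /circle /= e /= expr0n /= addr0 => /eqP; rewrite eq_sym oner_eq0.
have [c [_ cP] cv] := angle_chart_exists v0; have [d [_ dP] du] := angle_chart_exists u0.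
exists (((d.2 u : R), (c.2 v : R)), ln (norm2 v)).
rewrite /tube /= lnK ?posrE ?norm2_gt0 //; congr (phi (_, _)).
  have [_ e _] := dP u du; rewrite [RHS]e; congr polar.
  by move: cu; rewrite /circle /norm2 /= => ->; rewrite sqrtr1.
by symmetry; have [] := cP v cv.
Qed.

Definition tube_shift (k : int) (z : (R * R) * R) : (R * R) * R :=
  ((z.1.1, z.1.2 + pi *+ 2 *~ k), z.2).

Lemma tube_shiftE k z : tube (tube_shift k z) = tube z.
Proof. by rewrite /tube /= polarD2pi. Qed.

(** Both ends of the lift lie over one point, so they have the same radius; zero longitude leaves
    only a multiple of [2 pi] in the meridional angle. *)
Lemma tube_loop_lift (w : R -> X) z0 : continuous w -> w 0 = w 1 ->
  (forall s, I01 s -> punctured_tube (w s)) -> longitude w = 0 -> tube z0 = w 0 ->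
  exists (k : int) (z : R -> (R * R) * R), [/\ continuous z, z 0 = z0, z 1 = tube_shift k z0 &
    forall s, I01 s -> tube (z s) = w s].
Proof.
move=> cw w01 wP w0 z0E; have [z [cz z0' zw zl]] := tube_lift cw wP z0E.
have e : tube (z 1) = tube z0 by rewrite zw ?I01_1 // z0E.
have := congr1 tube_inv e; rewrite !tube_inv_tube => -[_ _ ec es].
have {ec es} : polar (expR (z 1).2) (z 1).1.2 = polar (expR z0.2) z0.1.2.
  by rewrite /polar ec es.
move=> e2; have := congr1 (@norm2 R) e2; rewrite !norm2_polar ?expR_ge0 // => /expR_inj er.
move: e2; rewrite er => /(polar_inj2pi (expR_gt0 _))[k ek]; exists k, z; split=> //.
rewrite /tube_shift -ek -er; rewrite w0 z0' in zl.
by rewrite [LHS]surjective_pairing [(z 1).1]surjective_pairing; congr ((_, _), _); lra.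
Qed.

(** Polar coordinates on the disk bounded by [c] give a free contraction of [c] inside the solid
    torus. *)
Lemma meridian_longitude c : meridian_loop phi c -> longitude c = 0.
Proof.
move=> [[cc c01 _ _] _ [D [cD _ DS Dc]]].
pose u (p : R * R) : R * R := (clamp p.2 * cos (2 * pi * p.1), clamp p.2 * sin (2 * pi * p.1)).
have cu : continuous u.
  have c2 : continuous (fun p : R * R => clamp p.2).
    by apply: (continuous_compose _ (@clamp_continuous R)); cont.
  by rewrite /u; cont.
have uD p : disk (u p).
  rewrite /disk /u /= !exprMn -mulrDr cos2Dsin2 mulr1.
  by have /andP[h0 h1] := I01_clamp p.2; rewrite expr_le1.
apply: (free_null_longitude (H := fun p => D (u p)) _ cc).
- exact: (continuous_within_compose cD cu uD).
- move=> s t _ _; have : (D @` disk) (D (u (s, t))) by exists (u (s, t)).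
  by move=> /DS[z [z1 _] <-]; exists z.
- by move=> s sI; rewrite /u /= clampE ?I01_1 // !mul1r Dc.
- by move=> s sI; rewrite /u /= clampE ?I01_0 // !mul0r.
- move=> t tI; congr D; rewrite /u /= mulr0 mulr1 cos0 sin0.
  by rewrite mulr_natl cos2pi sin2pi.
Qed.

Lemma meridian_punctured c s : meridian_loop phi c -> I01 s -> punctured_tube (c s).
Proof.
move=> [[_ _ _ cS] _ _] /cS[[u v] [/= cu cv] <-]; exists (u, v) => //; split=> //= v0.
by move: cv; rewrite /circle v0 /= expr0n /= addr0 => /eqP; rewrite eq_sym oner_eq0.
Qed.

(** If [k] were 0, the lift would be a closed path of the covering, and shrinking it linearly would
    contract [c] in the boundary torus, contrary to essentiality. *)
Lemma meridian_lift c z0 : meridian_loop phi c -> tube z0 = c 0 ->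
  exists2 k : int, k <> 0 & exists z : R -> (R * R) * R, [/\ continuous z, z 0 = z0,
    z 1 = tube_shift k z0 & forall s, I01 s -> tube (z s) = c s].
Proof.
move=> mc z0E; have [[cc c01 _ cS] cN _] := mc.
have [k [z [cz z00 z1 zc]]] := @tube_loop_lift c z0 cc c01
  (fun s => @meridian_punctured c s mc) (meridian_longitude mc) z0E.
exists k; last by exists z.
move=> k0; apply: cN.
have z01 : z 1 = z 0.
  by rewrite z1 z00 k0 /tube_shift mulr0z addr0 -surjective_pairing -surjective_pairing.
(* The radius is set to 1, so that the contraction stays on the boundary torus; at time 0 this
   changes nothing because [c] lies there. *)
pose H (p : R * R) := phi (polar 1 ((1 - p.2) * (z p.1).1.1 + p.2 * (z 0).1.1),
                           polar 1 ((1 - p.2) * (z p.1).1.2 + p.2 * (z 0).1.2)).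
have [cphi inj _ _] := tub.
have SS a b : S (polar 1 a, polar 1 b) by split=> //=; exact: circle_polar.
exists H; split.
- apply: (continuous_within_compose cphi); last by move=> p; exact: SS.
  have cz1 : continuous (fun p : R * R => z p.1) by apply: (continuous_compose _ cz); cont.
  by apply: continuous_pair; apply: continuous_polar; cont.
- move=> s sI; rewrite /H /= subr0 !mul1r !mul0r !addr0 -zc // /tube.
  have [w [w1 w2] wE] := cS s sI.
  have := tube_inv_tube (z s); rewrite zc // -wE tube_invK; last by split.
  move=> e; have : norm2 w.2 = expR (z s).2 by rewrite e /= norm2_polar ?expR_ge0.
  by move: w2; rewrite /circle /norm2 /= => ->; rewrite sqrtr1 => ->.
- by move=> s sI; rewrite /H /= subrr !mul0r !mul1r !add0r.
- by move=> t tI; rewrite /H /= z01.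
- move=> s t _ _; exists (polar 1 ((1 - t) * (z s).1.1 + t * (z 0).1.1),
                          polar 1 ((1 - t) * (z s).1.2 + t * (z 0).1.2)) => //.
  by split=> /=; exact: circle_polar.
Qed.

Section Potential.
Context {G : groupType} {C : set (set X * (X -> G))}.
Hypothesis KC : flat_structure (~` K) C.
Local Open Scope group_scope.

Definition tube_ray (z : (R * R) * R) (s : R) : (R * R) * R :=
  ((s * z.1.1, s * z.1.2), s * z.2)%R.

(** The flat structure has a global primitive on the simply connected covering: the holonomy along
    rays from the origin. *)
Definition tube_potential (z : (R * R) * R) : G := holonomy C (tube \o tube_ray z).

Lemma continuous_tube_ray z : continuous (tube_ray z).
Proof. by rewrite /tube_ray; cont. Qed.

Lemma eq_holonomy_tube (z z' : R -> (R * R) * R) : continuous z -> continuous z' ->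
  z 0%R = z' 0%R -> z 1%R = z' 1%R ->
  holonomy C (tube \o z) = holonomy C (tube \o z').
Proof.
move=> cz cz' e0 e1.
pose h (p : R * R) : (R * R) * R :=
  ((((1 - p.2) * (z p.1).1.1 + p.2 * (z' p.1).1.1,
     (1 - p.2) * (z p.1).1.2 + p.2 * (z' p.1).1.2)),
    (1 - p.2) * (z p.1).2 + p.2 * (z' p.1).2)%R.
have ch : continuous h.
  have c1 : continuous (fun p : R * R => z p.1) by apply: (continuous_compose _ cz); cont.
  have c2 : continuous (fun p : R * R => z' p.1) by apply: (continuous_compose _ cz'); cont.
  by rewrite /h; cont.
have eta (y : (R * R) * R) : y = ((y.1.1, y.1.2), y.2) by rewrite -!surjective_pairing.
apply: (homotopic_holonomy KC (H := tube \o h)).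
- exact: (continuous_compose ch continuous_tube).
- by move=> s t _ _; apply: punctured_tube_notK; exact: tube_in.
- by move=> s _; rewrite /h /= subr0 !mul1r !mul0r !addr0 -eta.
- by move=> s _; rewrite /h /= subrr !mul1r !mul0r !add0r -eta.
- move=> t _; rewrite /h /= -e0 -e1; split; congr tube; rewrite [RHS]eta;
    by congr ((_, _), _); ring.
- exact: path_in_tube.
- exact: path_in_tube.
Qed.

Lemma holonomy_tube (z : R -> (R * R) * R) : continuous z ->
  holonomy C (tube \o z) = (tube_potential (z 0%R))^-1 * tube_potential (z 1%R).
Proof.
move=> cz; have cr := continuous_tube_ray.
have eta (y : (R * R) * R) : y = ((y.1.1, y.1.2), y.2) by rewrite -!surjective_pairing.
have r1 y : tube_ray y 1%R = y by rewrite /tube_ray !mul1r -eta.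
have r0 y : tube_ray y 0%R = ((0, 0), 0)%R by rewrite /tube_ray !mul0r.
apply: (mulgI (tube_potential (z 0%R))); rewrite mulVKg.
rewrite -(holonomy_cat KC) /=; last by rewrite r1.
- have -> : path_cat (tube \o tube_ray (z 0%R)) (tube \o z) =
            tube \o path_cat (tube_ray (z 0%R)) z.
    by apply/funext => s; rewrite /path_cat /=; case: ifP.
  apply: eq_holonomy_tube => //.
  + by apply: continuous_cat => //; rewrite r1.
  + by rewrite /path_cat invr_ge0 ler0n mulr0 !r0.
  + rewrite /path_cat ifF; last by apply/negbTE; rewrite -ltNge; lra.
    by rewrite r1; congr z; ring.
- exact: path_in_tube.
- exact: path_in_tube.
Qed.

(** Holonomy of the loop under the origin of the covering that winds [k] times around [K]. *)
Definition monodromy (k : int) : G := tube_potential (tube_shift k ((0, 0), 0)%R).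

Lemma tube_potential_shift k z :
  tube_potential (tube_shift k z) = monodromy k * tube_potential z.
Proof.
have e : tube \o tube_ray z = tube \o (fun s => tube_shift k (tube_ray z s)).
  by apply/funext => s /=; rewrite tube_shiftE.
rewrite {2}/tube_potential e holonomy_tube; last first.
  by rewrite /tube_shift /tube_ray /=; cont.
rewrite mulgA /monodromy /tube_ray !mul0r mulgV mul1g.
by rewrite !mul1r -!surjective_pairing.
Qed.

Lemma monodromyD k l : monodromy (k + l) = monodromy k * monodromy l.
Proof.
rewrite -tube_potential_shift /monodromy; congr tube_potential.
by rewrite /tube_shift /=; congr ((_, _), _); rewrite mulrzDr; ring.
Qed.

Lemma monodromy0 : monodromy 0 = 1.
Proof. by apply: (mulgI (monodromy 0)); rewrite -monodromyD mulg1. Qed.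

Lemma monodromyN k : monodromy (- k) = (monodromy k)^-1.
Proof. by apply: (mulgI (monodromy k)); rewrite -monodromyD subrr monodromy0 mulgV. Qed.

Lemma monodromyMn k (n : nat) : monodromy (k *+ n) = monodromy k ^+ n.
Proof. by elim: n => [|n ih]; rewrite ?monodromy0 // mulrS monodromyD ih expgS. Qed.

Lemma holonomy_tube_loop (w : R -> X) (z : R -> (R * R) * R) k : path_in (~` K) w -> continuous z ->
  z 1%R = tube_shift k (z 0%R) -> (forall s, I01 s -> tube (z s) = w s) ->
  holonomy C w = (tube_potential (z 0%R))^-1 * monodromy k * tube_potential (z 0%R).
Proof.
move=> wK cz z1 zw; rewrite -mulgA -tube_potential_shift -z1 -holonomy_tube //.
by apply: (eq_holonomy KC) => // [|s sI]; [exact: path_in_tube|rewrite /= zw].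
Qed.

End Potential.

End Tubular.

(** * Meridian loops as powers of a small loop around the knot *)

Section TubularPower.
Context {R : realType} {X : topologicalType} {K : set X}.
Context (phi : (R * R) * (R * R) -> X).
Hypothesis tub : tubular_nbhd K phi.

Lemma additive_intE (f : int -> int) k : {morph f : x y / x + y} -> f k = k * f 1.
Proof.
move=> fD; have f0 : f 0 = 0 by have := fD 0 0; rewrite addr0; lia.
have fn (n : nat) : f n%:Z = n%:Z * f 1.
  by elim: n => [|n ih]; [rewrite f0 mul0r|rewrite -addn1 PoszD fD ih mulrDl mul1r].
have fN x : f (- x) = - f x by have := fD x (- x); rewrite subrr f0; lia.
by case: (intP k) => [|n|n]; rewrite ?f0 ?mul0r // ?fN fn // mulNr.
Qed.

(** Both [c] and [g] have zero longitude, so their lifts end at meridional shifts by [kc] and [kg].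
    The integer holonomy of [g] is a multiple of [kg], which forces [kg] to be 1 or -1; hence [c]
    is, up to the transport along [lam], a nonzero power of [g]. *)
Lemma tubular_power (c g lam : R -> X) (G : groupType) (C : set (set X * (X -> G)))
    (Cz : set (set X * (X -> Algebra.to_multiplicative int))) :
  flat_structure (~` K) C -> flat_structure (~` K) Cz ->
  meridian_loop phi c ->
  continuous lam -> (forall s, I01 s -> punctured_tube phi (lam s)) -> lam 0 = c 0 ->
  continuous g -> g 0 = g 1 -> (forall s, I01 s -> punctured_tube phi (g s)) ->
  longitude phi g = 0 -> lam 1 = g 0 -> `|holonomy Cz g : int| = 1 ->
  exists (b : bool) (n : nat), (holonomy C c = holonomy C lam *
    (if b then (holonomy C g)^-1 else holonomy C g) ^+ n.+1 * (holonomy C lam)^-1)%g.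
Proof.
move=> KC KCz mc cl lP l0 cg g01 gP gl l1 gz.
have inK (w : R -> X) : continuous w ->
    (forall s, I01 s -> punctured_tube phi (w s)) -> path_in (~` K) w.
  by move=> cw wP; split=> // s /wP; exact: (punctured_tube_notK tub).
have cP s : I01 s -> punctured_tube phi (c s) by exact: meridian_punctured.
have cc : continuous c by case: mc => [[]].
have [z0 z0E] : exists z, tube phi z = c 0 by apply: tube_surj; apply: cP; exact: I01_0.
have [kc kc0 [zc [czc zc0 zc1 zcw]]] := meridian_lift tub mc z0E.
have [|zl [czl zl0 zlw _]] := tube_lift tub cl lP (z0 := z0); first by rewrite l0.
have [|kg [zg [czg zg0 zg1 zgw]]] := tube_loop_lift tub cg g01 gP gl (z0 := zl 1).
  by rewrite zlw ?I01_1.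
have hol_loop (H : groupType) (D : set (set X * (X -> H))) (w : R -> X)
    (z : R -> (R * R) * R) k : flat_structure (~` K) D -> continuous w ->
    (forall s, I01 s -> punctured_tube phi (w s)) -> continuous z ->
    z 1 = tube_shift k (z 0) -> (forall s, I01 s -> tube phi (z s) = w s) ->
    holonomy D w = ((@monodromy _ _ phi _ D k) ^ (@tube_potential _ _ phi _ D (z 0%R)))%g.
  move=> KD cw wP cz z1 zw; rewrite conjgE mulgA.
  exact: (holonomy_tube_loop tub KD (inK _ cw wP) cz).
have kg1 : kg = 1 \/ kg = - 1.
  have hz : holonomy Cz g = @monodromy _ _ phi _ Cz kg.
    have e := hol_loop _ Cz g zg kg KCz cg gP czg.
    rewrite zg0 in e; rewrite (e zg1 zgw) conjgE.
    set m := monodromy _ _; set F := tube_potential _ _.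
    have comm : (m * F = F * m)%g by exact: (@addrC int (m : int) (F : int)).
    by rewrite comm mulKg.
  pose m k : int := @monodromy _ _ phi _ Cz k.
  have mD : {morph m : k l / k + l} by move=> k l; exact: (monodromyD tub KCz).
  have := gz; rewrite hz -[monodromy _ _]/(m kg) (additive_intE kg mD) -abszE => -[].
  by rewrite abszM => /eqP; rewrite muln_eq1 => /andP[/eqP h _]; lia.
have holc := hol_loop _ C c zc kc KC cc cP czc; rewrite zc0 in holc.
have {}holc := holc zc1 zcw.
have holg := hol_loop _ C g zg kg KC cg gP czg; rewrite zg0 in holg.
have {}holg := holg zg1 zgw.
have holl : holonomy C lam =
    ((@tube_potential _ _ phi _ C z0)^-1 * @tube_potential _ _ phi _ C (zl 1%R))%g.
  rewrite -zl0 -(holonomy_tube tub KC czl); apply: (eq_holonomy KC).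
  - exact: inK.
  - exact: path_in_tube.
  - by move=> s sI; rewrite /= zlw.
pose m := @monodromy _ _ phi _ C.
have [b [n kb]] : exists (b : bool) (n : nat),
    ((if b then (m kg)^-1 else m kg) ^+ n.+1)%g = m kc.
  have [n nE] : exists n : nat, kc = n.+1%:Z \/ kc = - n.+1%:Z.
    by exists (`|kc|%N).-1; lia.
  have [b bE] : exists b : bool, kc = (if b then - kg else kg) *+ n.+1.
    case: kg1 nE => -> [] ->; [exists false|exists true|exists true|exists false];
      by rewrite ?opprK ?mulNrn natz.
  exists b, n; rewrite bE /m (monodromyMn tub KC); congr (_ ^+ _)%g.
  by case: (b) => //; rewrite (monodromyN tub KC).
exists b, n; rewrite holc holl holg -/m.
set F0 := tube_potential _ z0; set F1 := tube_potential _ (zl 1).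
have -> : (if b then (m kg ^ F1)^-1 else m kg ^ F1)%g =
          ((if b then (m kg)^-1 else m kg) ^ F1)%g by case: (b); rewrite ?conjVg.
by rewrite -conjXg kb !conjgE invgM invgK !mulgA !mulgK.
Qed.

End TubularPower.

(** * Arcs with both ends on the knot *)

Section ArcEnds.
Context {R : realType} {X : topologicalType} {K : set X}.

(* [E (., v)] is a small meridian loop around the end [lam 1] of the arc [lam],
   based at [lam (1 - v)]. *)
Record arc_end (lam : R -> X) (E : R * R -> X) : Prop := ArcEnd {
  arc_end_continuous : continuous E;
  arc_endK : K (lam 1);
  arc_end0 : forall s, I01 s -> E (s, 0) = lam 1;
  arc_end_loop : forall v, 0 < v < 1 ->
    E (0, v) = lam (1 - v) /\ E (1, v) = lam (1 - v);
  arc_end_notK : forall s v, I01 s -> 0 < v < 1 -> ~ K (E (s, v)) }.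

Lemma tube_lemma (E : R * R -> X) (U : set X) : continuous E -> open U ->
  (forall s, I01 s -> U (E (s, 0))) ->
  exists2 e : R, 0 < e & forall s v, I01 s -> `|v| < e -> U (E (s, v)).
Proof.
move=> cE oU EU.
pose P a b := exists2 e : R, 0 < e & forall s v, a <= s <= b -> `|v| < e -> U (E (s, v)).
suff : P 0 1 by [].
apply: interval_induction => // [x y z _ _ _ _ [e e0 he] [e' e'0 he']|x xI].
  exists (Num.min e e') => [|s v sxz]; first by rewrite lt_min e0.
  rewrite lt_min => /andP[ve ve'].
  by have [sy|ys] := leP s y; [apply: he|apply: he'] => //; lra.
have nU : nbhs (x, 0 : R) (E @^-1` U).
  by apply: (cE (x, 0) U); apply: open_nbhs_nbhs; split=> //; exact: EU.
have [e e0 he] := nbhs_pair_rect nU.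
exists e => // a b _ _ _ xa bx; exists e => // s v sab; rewrite ltr_norml => ve.
by apply: he => /=; lra.
Qed.

Context (phi : (R * R) * (R * R) -> X).
Hypothesis tub : tubular_nbhd K phi.

Lemma tube_open : open (phi @` (circle `*` setT)).
Proof. by have [_ _ op _] := tub; have := op _ openT; rewrite setIT. Qed.

Lemma knot_in_tube : K `<=` phi @` (circle `*` setT).
Proof. by have [_ _ _ <-] := tub; move=> _ [z [z1 _] <-]; exists z. Qed.

Lemma tube_notK_punctured x :
  (phi @` (circle `*` setT)) x -> ~ K x -> punctured_tube phi x.
Proof.
have [_ _ _ KE] := tub; move=> [[u v] [/= cu _] <-] nK; exists (u, v) => //.
by split=> //= v0; apply: nK; rewrite -KE; exists (u, v).
Qed.

(** For small [v] the tube lemma puts the loops [E (., v')], [0 <= v' <= v], into the tube, and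
    letting [v'] tend to 0 contracts [E (., v)] to a point of [K]. The contraction meets [K], which
    the longitude tolerates: it is defined on the whole tube. So [tubular_power] applies to this
    loop. *)
Lemma arc_end_power (lam : R -> X) (E : R * R -> X) (c : R -> X) (a : R)
    (G : groupType) (C : set (set X * (X -> G)))
    (Cz : set (set X * (X -> Algebra.to_multiplicative int))) (A : G) :
  flat_structure (~` K) C -> flat_structure (~` K) Cz ->
  (forall v, 0 < v < 1 -> holonomy C (fun s => E (s, v)) = A) ->
  (forall v, 0 < v < 1 -> `|holonomy Cz (fun s => E (s, v)) : int| = 1) ->
  continuous lam -> arc_end lam E -> a < 1 ->
  (forall u, a <= u < 1 -> punctured_tube phi (lam u)) ->
  meridian_loop phi c -> c 0 = lam a ->
  exists2 e : R, 0 < e & forall v, 0 < v < e -> v < 1 -> a < 1 - v ->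
    exists (b : bool) (n : nat), (holonomy C c =
      holonomy C (fun s => lam ((1 - s) * a + s * (1 - v))%R) *
      (if b then A^-1 else A) ^+ n.+1 *
      (holonomy C (fun s => lam ((1 - s) * a + s * (1 - v))%R))^-1)%g.
Proof.
move=> KC KCz hA hZ cl [cE E1K E0 Eloop EnK] a1 lamP mc ca.
have [|e e0 he] := tube_lemma cE tube_open.
  by move=> s sI; rewrite E0 //; exact: knot_in_tube.
exists e => // v /andP[v0 ve] v1 av.
have v01 : 0 < v < 1 by rewrite v0.
rewrite -(hA v v01).
apply: (tubular_power tub KC KCz mc (g := fun s => E (s, v))).
- by apply: (continuous_compose _ cl); cont.
- by move=> s sI; apply: lamP; move: sI; rewrite /I01; nra.
- by rewrite subr0 mul1r mul0r addr0.
- by apply: (continuous_compose _ cE); cont.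
- by have [-> ->] := Eloop v v01.
- move=> s sI; apply: tube_notK_punctured; last exact: EnK.
  by apply: he => //; rewrite ger0_norm // ltW.
- apply: (free_null_longitude tub (H := fun p => E (p.1, v * p.2))).
  + by apply: (continuous_compose _ cE); cont.
  + by apply: (continuous_compose _ cE); cont.
  + move=> s t sI tI; apply: he => //=; rewrite ger0_norm; first by move: tI; rewrite /I01; nra.
    by move: tI; rewrite /I01; nra.
  + by move=> s sI; rewrite /= mulr1.
  + by move=> s sI; rewrite /= mulr0 !E0 ?I01_0.
  + move=> t /andP[t0 t1] /=; have [->|tn0] := eqVneq t 0.
      by rewrite mulr0 !E0 ?I01_0 ?I01_1.
    have t0' : 0 < t by rewrite lt_neqAle eq_sym tn0.
    by have [|-> ->] := Eloop (v * t); [nra|].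
- have [-> _] := Eloop v v01; congr lam; ring.
- exact: hZ.
Qed.

End ArcEnds.
Arguments arc_end {R X} K lam E.

Lemma subsegment_bounds (R : realFieldType) (v p q : R) :
  p <= q -> q < 1 - v -> - (1 - v) < p ->
  [/\ v < 1, - (1 - v) <= q <= 1 - v, - (1 - v) <= p <= 1 - v,
      - (1 - v) <= v - 1 <= 1 - v & - (1 - v) <= 1 - v <= 1 - v].
Proof. by move=> pq qv pv; split; lra. Qed.

Lemma convex_bounds (R : realFieldType) (w p q s : R) :
  - w <= p <= w -> - w <= q <= w -> 0 <= s <= 1 -> - w <= (1 - s) * p + s * q <= w.
Proof. by move=> pw qw s01; nra. Qed.

(** * Holonomy of a long meridian pair *)

Section LongArcs.
Context {R : realType} {X : topologicalType} {K : set X}.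

Lemma components_meet (S A B : set X) x :
  components S A -> components S B -> A x -> B x -> A = B.
Proof.
move=> [a _ <-] [b _ <-] ax bx.
by rewrite (same_connected_component ax) (same_connected_component bx).
Qed.

Lemma components_cover (S : set X) x : S x -> exists2 A, components S A & A x.
Proof.
move=> Sx; exists (connected_component S x); first by exists x.
exact: connected_component_refl.
Qed.

Lemma path_in_catl (O : set X) (f g : R -> X) : continuous f ->
  path_in O (path_cat f g) -> path_in O f.
Proof.
move=> cf [_ h]; split=> // s /andP[s0 s1].
have := h (2^-1 * s); rewrite /path_cat ifT; last by lra.
by rewrite mulrA mulfV // mul1r; apply; apply/andP; split; lra.
Qed.

Lemma path_in_catr (O : set X) (f g : R -> X) : continuous g -> f 1 = g 0 ->
  path_in O (path_cat f g) -> path_in O g.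
Proof.
move=> cg fg [_ h]; split=> // s /andP[s0 s1].
have := h (2^-1 * s + 2^-1); rewrite /path_cat.
have -> : 2 * (2^-1 * s + 2^-1) - 1 = s by field.
case: ifP => hs; last by apply; apply/andP; split; lra.
have -> : s = 0 by lra.
by rewrite mulr0 add0r mulfV // fg; apply; apply/andP; split; lra.
Qed.

Lemma exists_smaller (p q r s : R) : 0 < p -> 0 < q -> 0 < r -> 0 < s ->
  exists v, [/\ 0 < v, v < p, v < q, v < r & v < s].
Proof.
move=> p0 q0 r0 s0; pose m := Num.min (Num.min p q) (Num.min r s).
have m0 : 0 < m by rewrite !lt_min p0 q0 r0 s0.
have [mp mq mr ms] : [/\ m <= p, m <= q, m <= r & m <= s].
  by rewrite /m !ge_min !lexx !orbT.
by exists (m / 2); split; lra.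
Qed.

(** [lam] runs from a point of [K] at -1 to a point of [K] at 1, and [th] recovers the parameter.
    [E'] is attached to the reversed arc, so that both ends have the same form. *)
Record long_arc (h : X -> X) (tau : set X) (lam : R -> X) (th : X -> R)
    (E E' : R * R -> X) : Prop := LongArc {
  long_arc_continuous : continuous lam;
  long_arc_coord : continuous th;
  long_arcK : forall s, -1 <= s <= 1 -> th (lam s) = s;
  long_arc_fixed : fixed_set h = tau `|` lam @` [set s | -1 <= s <= 1];
  long_arc_tau : forall s, -1 < s < 1 -> ~ tau (lam s);
  long_arc_notK : forall s, -1 < s < 1 -> ~ K (lam s);
  long_arc_right : arc_end K lam E;
  long_arc_left : arc_end K (fun s => lam (- s)) E' }.

Context {G : groupType} {C : set (set X * (X -> G))}.
Context {Cz : set (set X * (X -> Algebra.to_multiplicative int))}.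
Hypothesis KC : flat_structure (~` K) C.
Hypothesis KCz : flat_structure (~` K) Cz.

Lemma arc_holonomy (lam : R -> X) (r : R) : 0 < r -> continuous lam ->
  (forall s, -r <= s <= r -> ~ K (lam s)) ->
  exists L : R -> G, forall u : R -> R, continuous u ->
    (forall s, I01 s -> - r <= u s <= r) ->
    holonomy C (lam \o u) = ((L (u 0))^-1 * L (u 1%R))%g.
Proof.
move=> r0 cl lK; have rU : r != 0 by rewrite gt_eqF.
pose f s := lam (r * (2 * s - 1)).
have fO : path_in (~` K) f.
  split; first by apply: (continuous_compose _ cl); cont.
  by move=> s sI; apply: lK; move: sI; rewrite /I01; nra.
have [h hC] := path_section KC fO.
exists (fun u => h (2^-1 * (r^-1 * u + 1))) => u cu uI.
have -> : lam \o u = f \o (fun s => 2^-1 * (r^-1 * u s + 1)).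
  by apply/funext => s; rewrite /f /=; congr lam; field.
apply: (holonomy_sub KC fO hC); first by cont.
move=> s /uI /andP[u1 u2]; rewrite /I01.
have : -1 <= r^-1 * u s <= 1.
  by rewrite ler_pdivlMl // ler_pdivrMl // mulrN1 mulr1 u1 u2.
by lra.
Qed.

(* A meridian loop of an arbitrary tubular neighborhood is only known to wind a
   nonzero number of times around [K], whence the exponents [k.+1] and [l.+1]; the
   integer-valued structure [Cz] shows that the loops of [E] and [E'] wind once. *)
Theorem long_arc_holonomy (h : X -> X) (tau : set X) (lam : R -> X)
    (th : X -> R) (E E' : R * R -> X) (A B D : G) (b : ~` K) (x y : pi1 R b) :
  long_arc h tau lam th E E' ->
  (forall v, 0 < v < 1 -> holonomy C (fun s => E (s, v)) = A) ->
  (forall v, 0 < v < 1 -> holonomy C (fun s => E' (s, v)) = B) ->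
  (forall v, 0 < v < 1 -> `|holonomy Cz (fun s => E (s, v)) : int| = 1) ->
  (forall v, 0 < v < 1 -> `|holonomy Cz (fun s => E' (s, v)) : int| = 1) ->
  (forall u v, 0 < u < 1 -> 0 < v < 1 ->
    holonomy C (fun s => lam ((1 - s) * (1 - u) + s * (v - 1))) = D) ->
  long_meridian_pair h tau x y ->
  exists g i j k l, let P := (g * (if i then A^-1 else A) ^+ k.+1 * g^-1)%g in
    let Q := (g * D * (if j then B^-1 else B) ^+ l.+1 * (g * D)^-1)%g in
    (pi1_holonomy (C := C) x = P /\ pi1_holonomy (C := C) y = Q) \/
    (pi1_holonomy (C := C) x = Q /\ pi1_holonomy (C := C) y = P).
Proof.
move=> [cl cth lK fixE ltau lnK endr endl] hA hB hZ hZ' hD.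
move=> [phi [gam [tub [cg gi gext gbd] comps gtau]]].
move=> [a [del [c1 [c2 [a01 [cd d0 d1] [m1 c1g] [m2 c2g] [[lx xE lxE] [ly yE lyE]]]]]]].
have extK z : exterior phi z -> ~ K z.
  have [_ _ _ <-] := tub; move=> nz [[u v] [/= cu v0] e]; apply: nz.
  by exists (u, v) => //; split=> //=; rewrite v0 /open_disk /= expr0n /= addr0 ltr01.
have bdP z : exterior_boundary phi z -> punctured_tube phi z.
  move=> [[u v] [/= cu cv] <-]; exists (u, v) => //; split=> //= v0.
  by move: cv; rewrite /circle v0 /= expr0n /= addr0 => /eqP; rewrite eq_sym oner_eq0.
have compg : components (fixed_set h `&` exterior phi) (gam @` `[0, 1]%classic).
  by rewrite comps; right.
have compt : components (fixed_set h `&` exterior phi) (tau `&` exterior phi).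
  by rewrite comps; left.
have Iitv (s : R) : I01 s -> `[0, 1]%classic s by move=> sI /=; rewrite in_itv.
have gfix s : I01 s -> (fixed_set h `&` exterior phi) (gam s).
  move=> sI; have [z _ zE] := compg; apply: (@connected_component_sub _ _ z).
  by rewrite zE; exists s => //; exact: Iitv.
have gnt s : I01 s -> ~ tau (gam s).
  move=> sI ts; apply: gtau; apply: (components_meet compg compt (x := gam s)).
    by exists s => //; exact: Iitv.
  by split=> //; exact: gext.
(* The given arc [gam] lies on [lam], and [sg] is its position there. Being continuous and
   injective, [sg] is monotone: [gam] is a reparametrized segment of [lam]. *)
pose sg := th \o gam.
have csg : continuous sg by exact: continuous_compose.
have sgE s : I01 s -> -1 < sg s < 1 /\ lam (sg s) = gam s.
  move=> sI; have [] := gfix s sI; rewrite fixE => -[/(gnt s sI) //|[u u11 ue] _].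
  have uE : sg s = u by rewrite /sg /= -ue lK.
  rewrite uE; split=> //; have nKu : ~ K (lam u) by rewrite ue; apply/extK/gext.
  move: u11 => /= /andP[]; rewrite le_eqVlt => /orP[/eqP u1|u1].
    by move=> _; case: nKu; rewrite -u1; exact: (arc_endK endl).
  rewrite le_eqVlt => /orP[/eqP u2|u2]; last by rewrite u1.
  by case: nKu; rewrite u2; exact: (arc_endK endr).
(* Beyond the range of [gam], the arc [lam] stays in the tube: a point of it in the exterior would
   belong to one of the two components, yet it is neither on [tau] nor on [gam]. *)
have tail u : -1 < u < 1 -> (forall s, I01 s -> u <> sg s) -> punctured_tube phi (lam u).
  move=> u11 us; apply: (tube_notK_punctured tub); last exact: lnK.
  have [eu|] := pselect (exterior phi (lam u)); last first.
    by move=> /contrapT[z [z1 _] <-]; exists z.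
  have : (fixed_set h `&` exterior phi) (lam u).
    by split=> //; rewrite fixE; right; exists u => //=; lra.
  move=> /components_cover[S]; rewrite comps => -[->|->] /=.
    by move=> [/(ltau _ u11)].
  move=> [s sI e]; have sI' : I01 s by move: sI => /=; rewrite in_itv.
  case: (us s sI'); have [_ e'] := sgE s sI'.
  by rewrite -[u]lK; [rewrite -e /sg|lra].
have I0 := @I01_0 R; have I1 := @I01_1 R.
have sgi : {in `[0, 1] &, injective sg}.
  move=> s t; rewrite !in_itv /= => sI tI st; apply: gi; rewrite ?in_itv //=.
  by have [_ <-] := sgE s sI; have [_ <-] := sgE t tI; rewrite st.
have csgw : {within `[0, 1], continuous sg} by exact: continuous_subspaceT.
have sgmin s : I01 s -> (sg 0 <= sg 1 -> sg 0 <= sg s <= sg 1) /\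
                        (sg 1 <= sg 0 -> sg 1 <= sg s <= sg 0).
  move=> /andP[s0 s1]; split=> le01.
    have mono := segment_continuous_inj_le le01 csgw sgi.
    by rewrite !mono ?in_itv /= ?lexx ?ler01 ?s0 ?s1.
  have mono := segment_continuous_inj_ge le01 csgw sgi.
  by rewrite !mono ?in_itv /= ?lexx ?ler01 ?s0 ?s1.
pose g1 s := gam (a * (1 - s)); pose g2 s := gam (a + (1 - a) * s).
have cg1 : continuous g1 by apply: (continuous_compose _ cg); cont.
have cg2 : continuous g2 by apply: (continuous_compose _ cg); cont.
have g10 : del 1 = g1 0 by rewrite d1 /g1 subr0 mulr1.
have g20 : del 1 = g2 0 by rewrite d1 /g2 mulr0 addr0.
(* The pieces of the lasso avoid [K] because their concatenation agrees on [[0,1]] with a loop of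
   the complement. *)
have lasso_hol (l : loop R b) (g c : R -> X) : continuous g -> del 1 = g 0 ->
    continuous c -> c 0 = c 1 -> c 0 = g 1 ->
    (forall s, I01 s -> set_val (l s) = lasso del g c s) ->
    path_in (~` K) del /\ pi1_holonomy (C := C) (loop_class l) =
    (holonomy C del * holonomy C g * holonomy C c * (holonomy C del * holonomy C g)^-1)%g.
  move=> cg' dg cc c01 c0 lE.
  have crev (f : R -> X) : continuous f -> continuous (path_rev f).
    by move=> cf; apply: (continuous_compose _ cf); cont.
  have ccat : continuous (path_cat del g) by exact: continuous_cat.
  have cat0 : path_cat del g 1 = g 1.
    by rewrite /path_cat ifF; [congr g; ring|apply/negbTE; rewrite -ltNge; lra].
  have cr := crev _ ccat.
  have r0 : path_rev (path_cat del g) 0 = g 1 by rewrite /path_rev subr0.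
  have ccr : continuous (path_cat c (path_rev (path_cat del g))).
    by apply: continuous_cat => //; rewrite -c01 c0 r0.
  have c2' : path_cat c (path_rev (path_cat del g)) 0 = c 0.
    by rewrite /path_cat invr_ge0 ler0n mulr0.
  have cla : continuous (lasso del g c).
    by apply: continuous_cat => //; rewrite cat0 c2' c0.
  have pl : path_in (~` K) (lasso del g c).
    by split=> // s sI; rewrite -lE //; exact: set_valP.
  have p1 := path_in_catl ccat pl.
  have p2 : path_in (~` K) (path_cat c (path_rev (path_cat del g))).
    by apply: path_in_catr pl => //; rewrite cat0 c2' c0.
  have pc := path_in_catl cc p2.
  have pd := path_in_catl cd p1.
  have pg := path_in_catr cg' dg p1.
  split=> //; rewrite (pi1_holonomy_class KC).
  rewrite (eq_holonomy KC (path_in_loop l) pl lE).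
  rewrite (holonomy_cat KC p1 p2) ?cat0 ?c2' ?c0 //.
  rewrite (holonomy_cat KC pc (path_in_rev p1)) ?r0 -?c01 ?c0 //.
  by rewrite (holonomy_rev KC p1) (holonomy_cat KC pd pg) // !mulgA.
have a01' := andP a01.
have [cc1 c101 _ _] : [/\ continuous c1, c1 0 = c1 1, True & True] by case: m1 => [[]].
have [cc2 c201 _ _] : [/\ continuous c2, c2 0 = c2 1, True & True] by case: m2 => [[]].
have c1g' : c1 0 = g1 1 by rewrite c1g /g1 subrr mulr0.
have c2g' : c2 0 = g2 1 by rewrite c2g /g2 mulr1 addrC subrK.
have [_ hx] := lasso_hol lx g1 c1 cg1 g10 cc1 c101 c1g' lxE.
have [_ hy] := lasso_hol ly g2 c2 cg2 g20 cc2 c201 c2g' lyE.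
(* [cR] and [cL] are the meridian loops at the ends of [gam] nearer to [lam 1] and [lam (-1)]. Each
   is pushed outwards along [lam] to the standard loop at distance [v] from the knot; [t = 1 - v] is
   the common reference point. *)
have ends cR cL sR sL : meridian_loop phi cR -> meridian_loop phi cL ->
    cR 0 = lam sR -> cL 0 = lam sL -> -1 < sL -> sL <= sR -> sR < 1 ->
    (forall s, I01 s -> sL <= sg s <= sR) ->
    exterior_boundary phi (lam sR) -> exterior_boundary phi (lam sL) ->
    exists (L : R -> G) t i j k l, [/\
      forall u : R -> R, continuous u -> (forall s, I01 s -> sL <= u s <= sR) ->
        holonomy C (lam \o u) = ((L (u 0))^-1 * L (u 1%R))%g,
      holonomy C cR = ((L sR)^-1 * L t * (if i then A^-1 else A) ^+ k.+1 * ((L sR)^-1 * L t)^-1)%g &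
      holonomy C cL = ((L sL)^-1 * L t * D * (if j then B^-1 else B) ^+ l.+1 * ((L sL)^-1 * L t * D)^-1)%g].
  move=> mR mL cRE cLE sL0 sLR sR1 sgI bR bL.
  have [|e e0 he] := arc_end_power tub KC KCz hA hZ cl endr sR1 _ mR cRE.
    move=> u /andP[]; rewrite le_eqVlt => /orP[/eqP <- _|u0 u1]; first exact: bdP.
    apply: tail; first by lra.
    by move=> s /sgI h1 uE; move: u0; rewrite ltNge => /negP; apply; lra.
  have [||||e' e'0 he'] := arc_end_power tub KC KCz hB hZ' _ endl (a := - sL) _ _ mL.
  - by apply: (continuous_compose _ cl); cont.
  - by lra.
  - move=> u /andP[]; rewrite le_eqVlt => /orP[/eqP <- _|u0 u1]; first by rewrite opprK; exact: bdP.
    apply: tail; first by lra.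
    by move=> s /sgI h1 uE; move: u0; rewrite ltNge => /negP; apply; lra.
  - by rewrite cLE opprK.
  have [v [v0 ve ve' vR vL]] : exists v, [/\ 0 < v, v < e, v < e', sR < 1 - v & -(1 - v) < sL].
    have p0 : 0 < 1 - sR by rewrite subr_gt0.
    have q0 : 0 < 1 + sL by rewrite -ltrBlDl sub0r.
    have [v [? ? ? h1 h2]] := exists_smaller e0 e'0 p0 q0.
    by exists v; split => //; [rewrite ltrBrDl -ltrBrDr|rewrite opprB ltrBlDl].
  have [v1 sRI sLI vI vI'] := subsegment_bounds sLR vR vL.
  have v01 : 0 < v < 1 by rewrite v0.
  have r0 : 0 < 1 - v by rewrite subr_gt0.
  have [|L hL] := arc_holonomy r0 cl.
    by move=> s ?; apply: lnK; lra.
  have [i [k hR]] := he v (introT andP (conj v0 ve)) v1 vR.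
  have [|j [l hl]] := he' v (introT andP (conj v0 ve')) v1; first by lra.
  have lin (p q : R) : - (1 - v) <= p <= 1 - v -> - (1 - v) <= q <= 1 - v ->
      holonomy C (fun s => lam ((1 - s) * p + s * q)) = ((L p)^-1 * L q)%g.
    move=> pI qI; rewrite (hL (fun s => (1 - s) * p + s * q)).
    - by rewrite subr0 subrr !mul1r !mul0r addr0 add0r.
    - by cont.
    - by move=> s; rewrite /I01 => sI; exact: convex_bounds.
  exists L, (1 - v), i, j, k, l; split.
  - by move=> u cu uI; apply: hL => // s /uI; lra.
  - by rewrite hR lin //.
  - rewrite hl.
    have -> : (fun s => lam (- ((1 - s) * - sL + s * (1 - v)))) =
              (fun s => lam ((1 - s) * sL + s * (v - 1))).
      by apply/funext => s; congr lam; ring.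
    rewrite -(hD v v v01 v01) !lin //.
    by rewrite mulgA mulgK.
have b0 : exterior_boundary phi (lam (sg 0)).
  by have [_ ->] := sgE 0 I0; apply/gbd => //; left.
have b1 : exterior_boundary phi (lam (sg 1)).
  by have [_ ->] := sgE 1 I1; apply/gbd => //; right.
have [/andP[s00 s01] l0] := sgE 0 I0; have [/andP[s10 s11] l1] := sgE 1 I1.
have c10 : c1 0 = lam (sg 0) by rewrite l0.
have c20 : c2 0 = lam (sg 1) by rewrite l1.
have u1I s : I01 s -> I01 (a * (1 - s)) by rewrite /I01; nra.
have u2I s : I01 s -> I01 (a + (1 - a) * s) by rewrite /I01; nra.
have cu1 : continuous (fun s : R => sg (a * (1 - s))) by apply: (continuous_compose _ csg); cont.
have cu2 : continuous (fun s : R => sg (a + (1 - a) * s)) by apply: (continuous_compose _ csg); cont.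
have path_eq (u : R -> R) : continuous u -> (forall s, I01 s -> I01 (u s)) ->
    holonomy C (gam \o u) = holonomy C (lam \o (fun s => sg (u s))).
  move=> cu uI; apply: (eq_holonomy KC).
  - split; first exact: (continuous_compose cu cg).
    by move=> s /uI /gext /extK.
  - split; first by apply: (continuous_compose _ cl); exact: (continuous_compose cu csg).
    by move=> s /uI /sgE[] ? _; exact: lnK.
  - by move=> s /uI /sgE[_ /= ->].
have a0E : a * (1 - 0) = a by ring.
have a1E : a * (1 - 1) = 0 by ring.
have b0E : a + (1 - a) * 0 = a by ring.
have b1E : a + (1 - a) * 1 = 1 by ring.
have cu1' : continuous (fun s : R => a * (1 - s)) by cont.
have cu2' : continuous (fun s : R => a + (1 - a) * s) by cont.
rewrite xE yE.
(* [gam] may follow [lam] in either direction; this decides which of [x] and [y] comes from the end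
   of [E]. *)
have [le01|/ltW le10] := leP (sg 0) (sg 1).
  have [L [t [i [j [k [l [hL hR hl]]]]]]] := ends c2 c1 (sg 1) (sg 0) m2 m1 c20 c10 s00 le01 s11
     (fun s sI => (sgmin s sI).1 le01) b1 b0.
  have hg1 : holonomy C g1 = ((L (sg a))^-1 * L (sg 0))%g.
    rewrite (path_eq _ cu1' u1I) hL ?a0E ?a1E // => s /u1I sI.
    exact: (sgmin _ sI).1.
  have hg2 : holonomy C g2 = ((L (sg a))^-1 * L (sg 1%R))%g.
    rewrite (path_eq _ cu2' u2I) hL ?b0E ?b1E // => s /u2I sI.
    exact: (sgmin _ sI).1.
  exists (holonomy C del * (L (sg a))^-1 * L t)%g, i, j, k, l; right.
  rewrite hx hy hg1 hg2 hR hl !invgM !invgK.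
  by split; rewrite !mulgA ?mulgK ?mulgVK.
have [L [t [i [j [k [l [hL hR hl]]]]]]] := ends c1 c2 (sg 0) (sg 1) m1 m2 c10 c20 s10 le10 s01
     (fun s sI => (sgmin s sI).2 le10) b0 b1.
have hg1 : holonomy C g1 = ((L (sg a))^-1 * L (sg 0))%g.
  rewrite (path_eq _ cu1' u1I) hL ?a0E ?a1E // => s /u1I sI.
  exact: (sgmin _ sI).2.
have hg2 : holonomy C g2 = ((L (sg a))^-1 * L (sg 1%R))%g.
  rewrite (path_eq _ cu2' u2I) hL ?b0E ?b1E // => s /u2I sI.
  exact: (sgmin _ sI).2.
exists (holonomy C del * (L (sg a))^-1 * L t)%g, i, j, k, l; left.
rewrite hx hy hg1 hg2 hR hl !invgM !invgK.
by split; rewrite !mulgA ?mulgK ?mulgVK.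
Qed.

End LongArcs.

(** * The quotient of the slab *)

Section TwoBridgeSpace.
Context {R : realType} (r : rat).
Local Open Scope quotient_scope.
Local Notation slab := (@slab R).
Local Notation S3 := (@two_bridge_sphere R r).
Implicit Types (x y d : R * R) (k : int * int) (t : R).

Fact height_subproof t : clamp t \in [set` `[0 : R, 1]].
Proof. by rewrite inE /= in_itv; exact: I01_clamp. Qed.

(** Clamping makes every real number a height, so that paths can be given by formulas on all of
    [R]. *)
Definition height t : @unit_interval R := SigSub (height_subproof t).

Lemma level_height x t : level (x, height t) = clamp t.
Proof. by []. Qed.

Lemma continuous_height : continuous height.
Proof.
by apply: continuous_comp_initial; exact: (@clamp_continuous R).
Qed.

Lemma continuous_level : continuous (@level R).
Proof.
have c2 : continuous (fun p : slab => p.2) by exact: continuous_second.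
by apply: (continuous_compose c2); exact: continuous_set_val.
Qed.

Lemma I01_level (p : slab) : I01 (level p).
Proof. by have := set_valP p.2; rewrite /level /= in_itv. Qed.

Definition place x t : S3 := pr r (x, height t).

Lemma continuous_place (X : topologicalType) (u : X -> R * R) (v : X -> R) :
  continuous u -> continuous v -> continuous (fun z => place (u z) (v z)).
Proof.
move=> cu cv; apply: (continuous_compose _ (@continuous_pr R r)).
by apply: continuous_pair => //; exact: (continuous_compose cv continuous_height).
Qed.

Lemma slabP (p : slab) : p = (p.1, height (level p)).
Proof.
case: p => x t; congr pair; apply: val_inj => /=.
by rewrite clampE //; exact: (I01_level (x, t)).
Qed.

Lemma placeP (z : S3) : exists x t, I01 t /\ z = place x t.
Proof.
have e : pr r (repr z) = z by exact: reprK.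
exists (repr z).1, (level (repr z)); split; first exact: I01_level.
by rewrite -{1}e /place -slabP.
Qed.

Lemma quotient_lift_pr (T : Type) (g : slab -> T) p :
  (forall p q, glued r p q -> g p = g q) -> g (repr (pr r p)) = g p.
Proof.
move=> gP; apply/esym/gP; rewrite -(pr_eqP r); symmetry; exact: reprK.
Qed.

Lemma continuous_quotient_lift (Z : topologicalType) (g : slab -> Z) : continuous g ->
  (forall p q, glued r p q -> g p = g q) -> continuous (fun z : S3 => g (repr z)).
Proof.
move=> cg gP; apply/quotient_continuous.
rewrite (_ : _ \o _ = g); first exact: cg.
by apply/funext => p /=; exact: quotient_lift_pr.
Qed.

Lemma open_quotient_lift (U : set slab) : open U ->
  (forall p q, glued r p q -> U p = U q) -> open [set z : S3 | U (repr z)].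
Proof.
move=> oU UP; rewrite /open /= /quotient_open (_ : _ @^-1` _ = U) //.
by apply/seteqP; split=> p /=; rewrite quotient_lift_pr.
Qed.

Definition double k : R * R := lattice k + lattice k.

Lemma doubleE k : double k = (2 * k.1%:~R, 2 * k.2%:~R).
Proof. by rewrite /double /lattice; congr pair; rewrite /=; ring. Qed.

Lemma same_orbitP x y :
  same_orbit x y <-> exists k, y = x + double k \/ y = double k - x.
Proof.
split=> [|[k [->|->]]].
- elim=> [|{}y k _ [l [->|->]]].
  + by exists (0, 0); left; rewrite doubleE /= mulr0 addr0.
  + exists (k.1 - l.1, k.2 - l.2); right; rewrite -[lattice k + _]/(double k) !doubleE /=.
    by congr pair; rewrite /= intrB; ring.
  + exists (k.1 - l.1, k.2 - l.2); left; rewrite -[lattice k + _]/(double k) !doubleE /=.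
    by congr pair; rewrite /= intrB; ring.
- have h0 := same_orbit_rotation (0, 0) (same_orbit_refl x).
  have := same_orbit_rotation k h0.
  have -> : lattice (0, 0) + lattice (0, 0) = 0 :> R * R.
    by rewrite /lattice /=; congr pair; rewrite /= addr0.
  by rewrite sub0r opprK addrC.
- exact: same_orbit_rotation (same_orbit_refl x).
Qed.

(* Height 1 is collapsed along the vector [(denq r, numq r)], on which [transverse]
   vanishes. *)
Definition transverse x : R := (denq r)%:~R * x.2 - (numq r)%:~R * x.1.

Lemma transverseD x y : transverse (x + y) = transverse x + transverse y.
Proof. by rewrite /transverse /=; ring. Qed.

Lemma transverseN x : transverse (- x) = - transverse x.
Proof. by rewrite /transverse /=; ring. Qed.

Definition transverse_int k : int := denq r * k.2 - numq r * k.1.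

Lemma transverse_lattice k : transverse (lattice k) = (transverse_int k)%:~R.
Proof. by rewrite /transverse /transverse_int /lattice /= intrB !intrM. Qed.

Lemma transverse_double k : transverse (double k) = 2 * (transverse_int k)%:~R.
Proof. by rewrite /double transverseD transverse_lattice; ring. Qed.

Lemma slope_line_transverse d : slope_line (Some r) d -> transverse d = 0.
Proof. by move=> [c _ <-]; rewrite /transverse /lattice /=; ring. Qed.

Lemma transverse_slope_line d : transverse d = 0 -> slope_line (Some r) d.
Proof.
rewrite /transverse => /eqP; rewrite subr_eq0 => /eqP e.
have p0 : (denq r)%:~R != 0 :> R by rewrite intr_eq0 denq_neq0.
exists (d.1 / (denq r)%:~R) => //; rewrite /lattice /= [RHS]surjective_pairing.
by congr pair; [field|apply: (mulfI p0); rewrite e; field].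
Qed.

Lemma slope_line_vertical d : slope_line None d <-> d.1 = 0.
Proof.
split=> [[c _ <-]|d1]; first by rewrite /lattice /= mulr0.
exists d.2 => //; rewrite /lattice /= [RHS]surjective_pairing d1.
by congr pair; ring.
Qed.

Lemma collapsed_mid t d : 0 < t < 1 -> collapsed r t d -> d = 0.
Proof. by move=> /andP[t0 t1] [//|[e _]|[e _]]; [rewrite e ltxx in t0|rewrite e ltxx in t1]. Qed.

Lemma glued_mid x y t : 0 < t < 1 ->
  glued r (x, height t) (y, height t) <-> same_orbit x y.
Proof.
move=> t01; have tI : I01 t by rewrite /I01; lra.
split=> [/asboolP[_ [d]]|xy]; rewrite /= ?level_height ?clampE //.
  by move=> /(collapsed_mid t01) ->; rewrite addr0.
by apply/asboolP; split=> //; exists 0; [constructor 1|rewrite addr0].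
Qed.

Lemma denq_numq_bezout : exists k, transverse_int k = 1.
Proof.
have : coprimez (numq r) (denq r) by rewrite coprimezE coprime_num_den.
rewrite /coprimez => /eqP e; have [u [v uv]] := Bezoutz (numq r) (denq r).
exists (- u, v); rewrite /transverse_int /= -e -uv; ring.
Qed.

(** Height 1 collapses to the line of values of [transverse], on which [H] acts by [u -> u + 2 j]
    and [u -> 2 j - u]; a Bezout relation realizes every [j] by a lattice point. *)
Lemma glued_top x y : (exists j : int, transverse y = transverse x + 2 * j%:~R \/
    transverse y = 2 * j%:~R - transverse x) <->
  glued r (x, height 1) (y, height 1).
Proof.
have l1 : level (x, height 1) = 1 by rewrite level_height clampE ?I01_1.
split=> [[j xy]|/asboolP[_ [d]]]; rewrite /= ?l1.
  have [k0 k01] := denq_numq_bezout; pose k := (j * k0.1, j * k0.2).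
  have kj : transverse_int k = j.
    rewrite -[RHS]mulr1 -k01 /k /transverse_int /=; ring.
  apply/asboolP; split=> //; rewrite /= l1; case: xy => xy.
    exists (y - double k - x).
      constructor 3; split=> //; apply: transverse_slope_line.
      by rewrite !transverseD !transverseN transverse_double kj xy; ring.
    by apply/same_orbitP; exists k; left; rewrite [x + _]addrC !subrK.
  exists (double k - y - x).
    constructor 3; split=> //; apply: transverse_slope_line.
    by rewrite 2!transverseD transverse_double !transverseN kj xy; ring.
  apply/same_orbitP; exists k; right.
  by rewrite [x + _]addrC subrK opprB addrCA subrr addr0.
move=> cd /same_orbitP[k [->|->]]; exists (transverse_int k).
  left; rewrite transverseD transverse_double transverseD.
  by case: cd => [->|[/eqP]|[_ /slope_line_transverse ->]]; rewrite ?oner_eq0 // ?addr0 // /transverse /=; ring.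
right; rewrite transverseD transverse_double transverseN transverseD.
by case: cd => [->|[/eqP]|[_ /slope_line_transverse ->]]; rewrite ?oner_eq0 // ?addr0 // /transverse /=; ring.
Qed.

Lemma glued_bottom x y : x.1 = y.1 -> glued r (x, height 0) (y, height 0).
Proof.
move=> xy; apply/asboolP; split=> //=; rewrite level_height clampE ?I01_0 //.
exists (y - x); last by rewrite addrCA subrr addr0; exact: same_orbit_refl.
by constructor 2; split=> //; apply/slope_line_vertical; rewrite /= xy subrr.
Qed.

Lemma glued_orbit x y t : same_orbit x y -> glued r (x, height t) (y, height t).
Proof.
by move=> xy; apply/asboolP; split=> //; exists 0; [constructor 1|rewrite addr0].
Qed.

Lemma glued_level (p q : slab) : glued r p q -> level p = level q.
Proof. by move=> /asboolP[e _]; rewrite /level e. Qed.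

Lemma glued_vertical (p q : slab) : glued r p q -> level p < 1 ->
  exists k : int, q.1.1 = p.1.1 + 2 * k%:~R \/ q.1.1 = 2 * k%:~R - p.1.1.
Proof.
move=> /asboolP[_ [d cd /same_orbitP[k qE]]] p1; exists k.1.
have d0 : d.1 = 0.
  by case: cd => [->//|[_ /slope_line_vertical ->//]|[e _]]; rewrite e ltxx in p1.
by case: qE => ->; [left|right]; rewrite doubleE /= d0; ring.
Qed.

Lemma glued_transverse (p q : slab) : glued r p q -> 0 < level p ->
  exists k : int, transverse q.1 = transverse p.1 + 2 * k%:~R \/
                  transverse q.1 = 2 * k%:~R - transverse p.1.
Proof.
move=> /asboolP[_ [d cd /same_orbitP[k qE]]] p1; exists (transverse_int k).
have d0 : transverse d = 0.
  case: cd => [->|[e _]|[_ /slope_line_transverse ->//]].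
    by rewrite /transverse /=; ring.
  by rewrite e ltxx in p1.
case: qE => ->; [left|right].
  by rewrite transverseD transverse_double transverseD d0; ring.
by rewrite transverseD transverse_double transverseN transverseD d0; ring.
Qed.

End TwoBridgeSpace.

(** * Flat structures on the complement of a 2-bridge knot *)

Section Descent.
Context {R : realType} (r : rat) {G : groupType}.
Local Open Scope quotient_scope.
Local Notation slab := (@slab R).
Local Notation S3 := (@two_bridge_sphere R r).
Local Notation K := (two_bridge_knot R r).
Implicit Types (c : set slab * (slab -> G)).

Definition descend (C : set (set slab * (slab -> G))) : set (set S3 * (S3 -> G)) :=
  [set ([set z : S3 | c.1 (repr z)], fun z : S3 => c.2 (repr z)) | c in C].

Definition glue_invariant c : Prop :=
  forall p q, glued r p q -> c.1 p -> c.1 q /\ c.2 q = c.2 p.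

Lemma glued_repr (p : slab) : glued r p (repr (pr r p)).
Proof. by rewrite -(pr_eqP r); symmetry; exact: reprK. Qed.

(** The locus where two charts are defined and keep a given ratio is open and invariant under
    gluing, so it descends to an open set of the quotient. *)
Lemma descend_flat (C : set (set slab * (slab -> G))) :
  (forall c, C c -> open c.1 /\ glue_invariant c) ->
  (forall p, ~ K (pr r p) -> exists2 c, C c & c.1 p) ->
  (forall c d p, C c -> C d -> c.1 p -> d.1 p ->
    \forall q \near p, (c.2 q * (d.2 q)^-1 = c.2 p * (d.2 p)^-1)%g) ->
  flat_structure (~` K) (descend C).
Proof.
move=> Cinv Ccov Ccomp; split.
- move=> _ [c Cc <-] /=; have [oc ic] := Cinv c Cc.
  apply: open_quotient_lift => // p q pq; apply/propext; split=> [/(ic p q pq)[]//|cq].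
  by have [] := ic q p; first by rewrite -(pr_eqP r); symmetry; apply/(pr_eqP r).
- move=> z Kz; have [|c Cc cz] := Ccov (repr z).
    by move=> Kz'; apply: Kz; rewrite -[z]reprK.
  by exists ([set z : S3 | c.1 (repr z)], fun z : S3 => c.2 (repr z)) => //; exists c.
- move=> _ _ z [c Cc <-] [d Cd <-] /= cz dz.
  have [oc ic] := Cinv c Cc; have [od id] := Cinv d Cd.
  pose k p : G := (c.2 p * (d.2 p)^-1)%g.
  pose W := [set p | [/\ c.1 p, d.1 p & k p = k (repr z)]].
  have oW : open W.
    rewrite openE => p [cp dp kp]; rewrite /interior.
    have nc : nbhs p c.1 by apply: open_nbhs_nbhs; split.
    have nd : nbhs p d.1 by apply: open_nbhs_nbhs; split.
    by apply: filterS3 nc nd (Ccomp c d p Cc Cd cp dp) => q cq dq kq; split=> //; rewrite -kp.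
  have WP p q : glued r p q -> W p = W q.
    have imp p' q' : glued r p' q' -> W p' -> W q'.
      move=> pq [cp dp kp]; have [cq ce] := ic _ _ pq cp; have [dq de] := id _ _ pq dp.
      by split=> //; rewrite -kp /k ce de.
    move=> pq; apply/propext; split; first exact: imp.
    by apply: imp; rewrite -(pr_eqP r); symmetry; apply/(pr_eqP r).
  have : open_nbhs z [set z : S3 | W (repr z)] by split; [exact: open_quotient_lift|].
  by move/open_nbhs_nbhs; apply: filterS => y [].
Qed.

Lemma descend_holonomy (C : set (set slab * (slab -> G))) (f : R -> slab) (h : R -> G) :
  (forall c, C c -> open c.1 /\ glue_invariant c) ->
  flat_structure (~` K) (descend C) -> continuous f ->
  (forall s, I01 s -> ~ K (pr r (f s))) ->
  (forall s, I01 s -> exists c, [/\ C c, c.1 (f s) &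
    \forall q \near s, I01 q -> (h q * (c.2 (f q))^-1 = h s * (c.2 (f s))^-1)%g]) ->
  holonomy (descend C) (pr r \o f) = ((h 0)^-1 * h 1%R)%g.
Proof.
move=> Cinv KC cf fK hC.
have cpf : continuous (pr r \o f) by exact: (continuous_compose cf (@continuous_pr R r)).
apply: (holonomyE KC); first by split.
apply: (flat_sectionP KC cpf) => s sI; have [c [Cc cs hc]] := hC s sI.
have [oc ic] := Cinv c Cc.
have rE p : c.1 p -> c.1 (repr (pr r p)) /\ c.2 (repr (pr r p)) = c.2 p.
  by move=> cp; exact: (ic _ _ (glued_repr p) cp).
exists ([set z : S3 | c.1 (repr z)], fun z : S3 => c.2 (repr z)); split=> /=.
- by exists c.
- by have [] := rE _ cs.
- have nc : \forall q \near s, c.1 (f q) by apply: (cf s c.1); apply: open_nbhs_nbhs; split.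
  apply: filterS2 hc nc => q hq cq /hq.
  by have [_ ->] := rE _ cq; have [_ ->] := rE _ cs.
Qed.

End Descent.
Arguments descend {R} r {G} C.

Section ConwayCharts.
Context {R : realType} (r : rat) {G : groupType} (a b : G) (F : R * R -> G).
Local Notation slab := (@slab R).
Local Notation K := (two_bridge_knot R r).
Local Notation transverse := (@transverse R r).
Implicit Types (x y : R * R) (p q : slab).

(** Continuous encoding of the arithmetic of walls: [spi] vanishes exactly at the integers, where
    [cpi] is 1 or -1 according to parity. Under [t -> 2 k - t], [spi] changes sign and [cpi] is
    unchanged. *)
Definition spi (t : R) : R := sin (pi * t).
Definition cpi (t : R) : R := cos (pi * t).

Lemma continuous_spi (X : topologicalType) (u : X -> R) :
  continuous u -> continuous (fun z => spi (u z)).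
Proof. by move=> cu; rewrite /spi; cont. Qed.

Lemma continuous_cpi (X : topologicalType) (u : X -> R) :
  continuous u -> continuous (fun z => cpi (u z)).
Proof. by move=> cu; rewrite /cpi; cont. Qed.

Lemma pi2z (k : int) : pi * (2 * k%:~R) = pi *+ 2 *~ k :> R.
Proof. by rewrite mulrA mulr_natr mulrzr. Qed.

Lemma spiD2 t (k : int) : spi (t + 2 * k%:~R) = spi t.
Proof. by rewrite /spi mulrDr pi2z sinD2piz. Qed.

Lemma cpiD2 t (k : int) : cpi (t + 2 * k%:~R) = cpi t.
Proof. by rewrite /cpi mulrDr pi2z cosD2piz. Qed.

Lemma spiN t : spi (- t) = - spi t. Proof. by rewrite /spi mulrN sinN. Qed.
Lemma cpiN t : cpi (- t) = cpi t. Proof. by rewrite /cpi mulrN cosN. Qed.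

Lemma spiB2 t (k : int) : spi (2 * k%:~R - t) = - spi t.
Proof. by rewrite addrC spiD2 spiN. Qed.

Lemma cpiB2 t (k : int) : cpi (2 * k%:~R - t) = cpi t.
Proof. by rewrite addrC cpiD2 cpiN. Qed.

Lemma spiD1 t : spi (t + 1) = - spi t.
Proof. by rewrite /spi mulrDr mulr1 sinDpi. Qed.

Lemma cpiD1 t : cpi (t + 1) = - cpi t.
Proof. by rewrite /cpi mulrDr mulr1 cosDpi. Qed.

Lemma spi_gt0 t : 0 < t < 1 -> 0 < spi t.
Proof.
by move=> /andP[t0 t1]; apply: sin_gt0_pi; rewrite mulr_gt0 ?pi_gt0 //= gtr_pMr ?pi_gt0.
Qed.

Lemma cpi_sqr t : cpi t ^+ 2 = 1 - spi t ^+ 2.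
Proof. by rewrite /cpi cos2sin2. Qed.

Lemma spi_int (k : int) : spi k%:~R = 0.
Proof.
suff : spi (k%:~R) = - spi k%:~R by lra.
by rewrite -(spiB2 k%:~R k); congr spi; ring.
Qed.

Lemma spi_eq0 t : spi t = 0 -> exists k : int, t = k%:~R.
Proof.
move=> st; have : cos (pi * t *+ 2) = 1.
  by rewrite cos_mulr2n cos2sin2 -[sin _]/(spi t) st expr0n /= subr0 mulr2n; lra.
move=> /cos_eq1[k]; rewrite -mulrnAr => e; exists k.
have p0 : pi != 0 :> R by rewrite gt_eqF ?pi_gt0.
have : pi * (t *+ 2) = pi * (k%:~R *+ 2) by rewrite e -mulrzr; ring.
by move=> /(mulfI p0); rewrite !mulr2n; lra.
Qed.

(** Both factors change sign under a pi-rotation about a lattice point, so the product descends to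
    the Conway sphere. *)
Definition side x : R := spi x.1 * spi x.2.
Definition even_jump x : G := if 0 <= side x then a else 1%g.
Definition odd_jump x : G := if side x <= 0 then b else 1%g.

(* The walls [x.1 in 2Z] and [x.1 in 2Z+1], at heights below 1, contribute the
   factors [a] and [b]. They are oriented so as to be invariant under the
   pi-rotations: from the side [side < 0] to the side [side > 0] for the even
   walls, and conversely for the odd walls. *)
Definition cell_chart : set slab * (slab -> G) :=
  ([set p | spi p.1.1 != 0 /\ level p < 1], fun=> 1%g).
Definition even_chart : set slab * (slab -> G) :=
  ([set p | [/\ cpi p.1.1 != -1, spi p.1.2 != 0 & 0 < level p < 1]],
   fun p => even_jump p.1).
Definition odd_chart : set slab * (slab -> G) :=
  ([set p | [/\ cpi p.1.1 != 1, spi p.1.2 != 0 & 0 < level p < 1]],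
   fun p => odd_jump p.1).
(** At height 1, where the lines of slope [r] are collapsed, this is the only chart; [F] changes
    along such lines, whereas the constant 1 is invariant. Charts may be discontinuous, so the jump
    at height 1 is harmless. *)
Definition top_chart : set slab * (slab -> G) :=
  ([set p | spi (transverse p.1) != 0 /\ 0 < level p],
   fun p => if level p < 1 then F p.1 else 1%g).

Definition conway_charts : set (set slab * (slab -> G)) :=
  [set c | [\/ c = cell_chart, c = even_chart, c = odd_chart | c = top_chart]].

Hypothesis F_orbit : forall x y,
  spi (transverse x) != 0 -> same_orbit x y -> F x = F y.
Hypothesis F_cell : forall x, spi x.1 != 0 -> spi (transverse x) != 0 ->
  \forall y \near x, F y = F x.
Hypothesis F_even : forall x, cpi x.1 != -1 -> spi x.2 != 0 -> spi (transverse x) != 0 ->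
  \forall y \near x, (F y * (even_jump y)^-1 = F x * (even_jump x)^-1)%g.
Hypothesis F_odd : forall x, cpi x.1 != 1 -> spi x.2 != 0 -> spi (transverse x) != 0 ->
  \forall y \near x, (F y * (odd_jump y)^-1 = F x * (odd_jump x)^-1)%g.

Lemma orbit_side x y : same_orbit x y ->
  [/\ side y = side x, cpi y.1 = cpi x.1, (spi y.1 == 0) = (spi x.1 == 0) &
      (spi y.2 == 0) = (spi x.2 == 0)].
Proof.
move=> /same_orbitP[k [->|->]]; rewrite doubleE /side /=.
  by rewrite !spiD2 !cpiD2.
by rewrite !spiB2 !cpiB2 mulrNN !oppr_eq0.
Qed.

Lemma continuous_fst1 : continuous (fun p : slab => p.1.1 : R).
Proof. by apply: continuous_fstf; exact: continuous_first. Qed.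

Lemma continuous_fst2 : continuous (fun p : slab => p.1.2 : R).
Proof. by apply: continuous_sndf; exact: continuous_first. Qed.

Lemma open_neq_fun (X : topologicalType) (u : X -> R) (t : R) : continuous u ->
  open [set z | u z != t].
Proof.
move=> cu; rewrite (_ : [set z | _] = u @^-1` [set y | y != t]) //.
by apply: open_comp; [move=> z _; exact: cu|exact: open_neq].
Qed.

Lemma open_less (X : topologicalType) (u v : X -> R) : continuous u -> continuous v ->
  open [set z | u z < v z].
Proof.
move=> cu cv.
rewrite (_ : [set z | _] = (fun z => v z - u z) @^-1` [set y | 0 < y]); last first.
  by apply/seteqP; split=> z /=; rewrite subr_gt0.
apply: open_comp; last exact: open_gt.
by move=> z _; have : continuous (fun z => v z - u z) by cont; apply.
Qed.

Lemma continuous_transverse : continuous (fun p : slab => transverse p.1).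
Proof.
rewrite /transverse; have c1 := continuous_fst1; have c2 := continuous_fst2.
by cont.
Qed.

Lemma conway_inv c : conway_charts c -> open c.1 /\ glue_invariant r c.
Proof.
have cl : continuous (@level R) by exact: continuous_level.
have c1 := continuous_fst1; have c2 := continuous_fst2.
have ol1 : open [set p : slab | level p < 1].
  by apply: open_less => //; exact: continuous_const.
have ol0 : open [set p : slab | 0 < level p].
  by apply: open_less => //; exact: continuous_const.
have orb (p q : slab) : glued r p q -> 0 < level p < 1 ->
    same_orbit p.1 q.1 /\ level q = level p.
  move=> pq p01; have lq := glued_level pq; split=> //.
  move: pq; rewrite (slabP p) (slabP q) -lq => pq.
  by move: pq; rewrite (glued_mid r p.1 q.1 p01).
case=> ->; split.
- apply: openI => //; apply: open_neq_fun; exact: continuous_spi.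
- move=> p q pq [/= sp lp]; rewrite -(glued_level pq); split=> //; split=> //.
  have [k [->|->]] := glued_vertical pq lp; first by rewrite spiD2.
  by rewrite spiB2 oppr_eq0.
- have -> : even_chart.1 = [set p : slab | cpi p.1.1 != -1] `&` [set p | spi p.1.2 != 0]
     `&` ([set p | 0 < level p] `&` [set p | level p < 1]).
    apply/seteqP; split=> p /=; first by move=> [? ? /andP[? ?]].
    by move=> [[? ?] [? ?]]; split=> //; apply/andP.
  by repeat apply: openI => //; apply: open_neq_fun; [exact: continuous_cpi|exact: continuous_spi].
- move=> p q pq [/= cp sp lp]; have [xy ->] := orb p q pq lp.
  have [s1 s2 s3 s4] := orbit_side xy; rewrite s2 s4; split=> //.
  by rewrite /even_jump s1.
- have -> : odd_chart.1 = [set p : slab | cpi p.1.1 != 1] `&` [set p | spi p.1.2 != 0]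
     `&` ([set p | 0 < level p] `&` [set p | level p < 1]).
    apply/seteqP; split=> p /=; first by move=> [? ? /andP[? ?]].
    by move=> [[? ?] [? ?]]; split=> //; apply/andP.
  by repeat apply: openI => //; apply: open_neq_fun; [exact: continuous_cpi|exact: continuous_spi].
- move=> p q pq [/= cp sp lp]; have [xy ->] := orb p q pq lp.
  have [s1 s2 s3 s4] := orbit_side xy; rewrite s2 s4; split=> //.
  by rewrite /odd_jump s1.
- apply: openI => //; apply: open_neq_fun; apply: continuous_spi.
  exact: continuous_transverse.
- move=> p q pq [/= sp lp]; rewrite -(glued_level pq); split.
    split=> //; have [k [->|->]] := glued_transverse pq lp; first by rewrite spiD2.
    by rewrite spiB2 oppr_eq0.
  case: ifP => // l1; symmetry; apply: F_orbit => //.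
  by have [] := orb p q pq; first by rewrite lp.
Qed.

Lemma side_locally x : side x != 0 ->
  \forall y \near x, (0 <= side y) = (0 <= side x) /\ (side y <= 0) = (side x <= 0).
Proof.
have cs : continuous side.
  have h1 : continuous (fun x : R * R => spi x.1) by apply: continuous_spi; cont.
  have h2 : continuous (fun x : R * R => spi x.2) by apply: continuous_spi; cont.
  by rewrite /side; cont.
rewrite neq_lt => /orP[s0|s0].
  have : \forall y \near x, side y < 0 by exact: (cs x _ (lt_nbhsl s0)).
  by apply: filterS => y sy; rewrite !leNgt s0 sy /= !ltNge !ltW.
have : \forall y \near x, 0 < side y by exact: (cs x _ (lt_nbhsr s0)).
by apply: filterS => y sy; rewrite !leNgt s0 sy /= !ltNge !ltW.
Qed.

Lemma conway_compat c d p : conway_charts c -> conway_charts d -> c.1 p -> d.1 p ->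
  \forall q \near p, (c.2 q * (d.2 q)^-1 = c.2 p * (d.2 p)^-1)%g.
Proof.
have cl : continuous (@level R) by exact: continuous_level.
have c1 : continuous (fun p : slab => p.1) by exact: continuous_first.
have near1 (P : R * R -> Prop) : (\forall y \near p.1, P y) -> \forall q \near p, P q.1.
  by move=> nP; exact: (c1 p _ nP).
have flip (u v : slab -> G) :
    (\forall q \near p, (u q * (v q)^-1 = u p * (v p)^-1)%g) ->
    \forall q \near p, (v q * (u q)^-1 = v p * (u p)^-1)%g.
  by apply: filterS => q e; apply: invg_inj; rewrite !invgF.
have self (u : slab -> G) : \forall q \near p, (u q * (u q)^-1 = u p * (u p)^-1)%g.
  by apply: filterE => q; rewrite !mulgV.
have cpn1 : spi p.1.1 = 0 -> cpi p.1.1 != -1 -> cpi p.1.1 != 1 -> False.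
  move=> s0 n1 n2; have := cpi_sqr p.1.1; rewrite s0 expr0n /= subr0 => /eqP.
  by rewrite sqrf_eq1 (negbTE n1) (negbTE n2).
have jump : spi p.1.1 != 0 -> spi p.1.2 != 0 ->
    \forall q \near p, even_jump q.1 = even_jump p.1 /\ odd_jump q.1 = odd_jump p.1.
  move=> h1 h2.
  apply: (near1 (fun y => even_jump y = even_jump p.1 /\ odd_jump y = odd_jump p.1)).
  have sn0 : side p.1 != 0 by rewrite mulf_neq0.
  by apply: filterS (side_locally sn0) => y [e1 e2]; rewrite /even_jump /odd_jump e1 e2.
have below : level p < 1 -> \forall q \near p, level q < 1.
  by move=> l1; exact: (cl p _ (lt_nbhsl l1)).
have ce : cell_chart.1 p -> even_chart.1 p ->
    \forall q \near p, (cell_chart.2 q * (even_chart.2 q)^-1 = cell_chart.2 p * (even_chart.2 p)^-1)%g.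
  move=> /= [s1 _] [_ s2 _]; apply: filterS (jump s1 s2) => q [e _] /=; by rewrite e.
have co : cell_chart.1 p -> odd_chart.1 p ->
    \forall q \near p, (cell_chart.2 q * (odd_chart.2 q)^-1 = cell_chart.2 p * (odd_chart.2 p)^-1)%g.
  move=> /= [s1 _] [_ s2 _]; apply: filterS (jump s1 s2) => q [_ e] /=; by rewrite e.
have eo : even_chart.1 p -> odd_chart.1 p ->
    \forall q \near p, (even_chart.2 q * (odd_chart.2 q)^-1 = even_chart.2 p * (odd_chart.2 p)^-1)%g.
  move=> /= [n1 s2 _] [n2 _ _].
  have s1 : spi p.1.1 != 0 by apply/eqP => s0; exact: (cpn1 s0 n1 n2).
  by apply: filterS (jump s1 s2) => q [e e'] /=; rewrite e e'.
have tc : top_chart.1 p -> cell_chart.1 p ->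
    \forall q \near p, (top_chart.2 q * (cell_chart.2 q)^-1 = top_chart.2 p * (cell_chart.2 p)^-1)%g.
  move=> /= [s0 _] [s1 l1]; apply: filterS2 (below l1) (near1 _ (F_cell s1 s0)) => q lq e /=.
  by rewrite lq l1 e.
have te : top_chart.1 p -> even_chart.1 p ->
    \forall q \near p, (top_chart.2 q * (even_chart.2 q)^-1 = top_chart.2 p * (even_chart.2 p)^-1)%g.
  move=> /= [s0 _] [n1 s2 /andP[_ l1]].
  by apply: filterS2 (below l1) (near1 _ (F_even n1 s2 s0)) => q lq e /=; rewrite lq l1 e.
have to_ : top_chart.1 p -> odd_chart.1 p ->
    \forall q \near p, (top_chart.2 q * (odd_chart.2 q)^-1 = top_chart.2 p * (odd_chart.2 p)^-1)%g.
  move=> /= [s0 _] [n1 s2 /andP[_ l1]].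
  by apply: filterS2 (below l1) (near1 _ (F_odd n1 s2 s0)) => q lq e /=; rewrite lq l1 e.
case=> -> [] -> hc hd; by [apply: self|apply: ce|apply: co|apply: eo|apply: tc|apply: te|
  apply: to_|apply: flip; apply: ce|apply: flip; apply: co|apply: flip; apply: eo|
  apply: flip; apply: tc|apply: flip; apply: te|apply: flip; apply: to_].
Qed.

(** A point missed by all charts is glued to a lattice point: at height 1 an integer value of
    [transverse] is attained on the lattice by a Bezout relation, at height 0 every wall contains
    lattice points, and in between only the lattice itself is missed. *)
Lemma conway_cover p : ~ K (pr r p) -> exists2 c, conway_charts c & c.1 p.
Proof.
move=> nK.
have lat (k : int * int) q : glued r p q -> q.1 = lattice k -> False.
  move=> pq qk; apply: nK; have -> : pr r p = pr r q by apply/pr_eqP.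
  by exists q => //; exists k.
have [/andP[l0 l1]] : I01 (level p) by exact: I01_level.
move: l1; rewrite le_eqVlt => /orP[/eqP l1|l1].
  have [su|/negP] := boolP (spi (transverse p.1) == 0); last first.
    move=> su; exists top_chart; first by constructor 4.
    by split; [apply/negP|rewrite /= l1 ltr01].
  have [j uj] := spi_eq0 (eqP su).
  have [k0 k01] := denq_numq_bezout r; pose k := (j * k0.1, j * k0.2).
  have kj : transverse_int r k = j by rewrite -[RHS]mulr1 -k01 /k /transverse_int /=; ring.
  exfalso; apply: (lat k (lattice k, height 1)) => //; rewrite (slabP p) l1.
  by apply/glued_top; exists 0; left; rewrite transverse_lattice kj uj mulr0 addr0.
have [s1|s1] := boolP (spi p.1.1 == 0); last first.
  by exists cell_chart; [constructor 1|].
have [k1 pk1] := spi_eq0 (eqP s1).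
move: l0; rewrite le_eqVlt => /orP[/eqP l0|l0].
  exfalso; apply: (lat (k1, 0) (lattice (k1, 0), height 0)) => //.
  by rewrite (slabP p) -l0; apply: glued_bottom; rewrite /lattice /= pk1.
have l01 : 0 < level p < 1 by rewrite l0.
have [s2|s2] := boolP (spi p.1.2 == 0).
  have [k2 pk2] := spi_eq0 (eqP s2).
  exfalso; apply: (lat (k1, k2) p); first by apply/pr_eqP.
  by rewrite /lattice /= -pk1 -pk2 -surjective_pairing.
have := cpi_sqr p.1.1; rewrite (eqP s1) expr0n /= subr0 => /eqP.
rewrite sqrf_eq1 => /orP[/eqP e|/eqP e].
  exists even_chart; first by constructor 2.
  by split=> //=; rewrite e; apply/eqP; lra.
exists odd_chart; first by constructor 3.
by split=> //=; rewrite e; apply/eqP; lra.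
Qed.

Lemma conway_flat : flat_structure (~` K) (descend r conway_charts).
Proof.
apply: descend_flat; [exact: conway_inv|exact: conway_cover|exact: conway_compat].
Qed.

End ConwayCharts.

Lemma int_parity (k : int) : exists j : int, k = 2 * j \/ k = 2 * j + 1.
Proof. by exists (k %/ 2)%Z; lia. Qed.

(** * The long upper arc and the loops at its ends *)

Section UpperArc.
Context {R : realType} (r : rat).
Local Open Scope quotient_scope.
Local Notation slab := (@slab R).
Local Notation S3 := (@two_bridge_sphere R r).
Local Notation K := (two_bridge_knot R r).
Local Notation transverse := (@transverse R r).
Local Notation place := (@place R r).
Implicit Types (x y : R * R).

Lemma eq_place x y t : glued r (x, height t) (y, height t) -> place x t = place y t.
Proof. by move=> h; apply/pr_eqP. Qed.

Lemma knot_place x t : I01 t -> K (place x t) ->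
  exists k : int * int, glued r (x, height t) (lattice k, height t).
Proof.
move=> tI [p [k pk] /esym/pr_eqP xp]; exists k.
have := glued_level xp; rewrite level_height clampE // => tE.
by move: xp; rewrite (slabP p) pk tE.
Qed.

Lemma knot_place_mid x t : 0 < t < 1 -> K (place x t) -> spi x.1 = 0 /\ spi x.2 = 0.
Proof.
move=> t01 Kx; have tI : I01 t by rewrite /I01; lra.
have [k] := knot_place tI Kx; rewrite glued_mid // => /orbit_side[_ _ e1 e2].
by move: e1 e2; rewrite /lattice /= !spi_int eqxx => /esym/eqP -> /esym/eqP ->.
Qed.

Lemma knot_place_top x : K (place x 1) -> spi (transverse x) = 0.
Proof.
move=> Kx; have [k /glued_top[j]] := knot_place (@I01_1 R) Kx.
rewrite transverse_lattice => -[e|e].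
  by rewrite -(spiD2 _ j) -e spi_int.
by apply: oppr_inj; rewrite oppr0 -(spiB2 _ j) -e spi_int.
Qed.

Lemma tunnel_place x t : I01 t -> upper_tunnel R r (place x t) -> t = 0.
Proof.
move=> tI [p p0 /pr_eqP /glued_level]; rewrite level_height clampE // => <-.
exact: p0.
Qed.

(** The arc rises over the midpoint [(1, 1/2)] of an odd wall from height 0 to height 1 and descends
    over [(0, 1/2)]. Translation by [(0, 1)] followed by a rotation fixes these points, and at
    height 0 a wall shrinks to a point of the knot. *)
Definition upper_arc (s : R) : S3 :=
  if s <= 0 then place (1, 2^-1) (1 + s) else place (0, 2^-1) (1 - s).

(** Compatible with the gluing because [cpi] is even and 2-periodic and the first factor vanishes at
    height 1; on [upper_arc s] it equals [s]. *)
Definition upper_coord (z : S3) : R :=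
  (fun p : slab => (1 - level p) * cpi p.1.1) (repr z).

(** At height [v = p.2] the path joins [(0, 1/2)] to [(0, -1/2)], identified by the rotation about
    the origin, and passes to the right of that lattice point. Its width is proportional to [v], so
    that at height 0 it falls onto one wall and becomes constant; [4 s (1 - s) <= 1] keeps it within
    one cell. *)
Definition upper_right_end (p : R * R) : S3 :=
  place (4 * p.2 * p.1 * (1 - p.1), 2^-1 - p.1) p.2.

Definition upper_left_end (p : R * R) : S3 :=
  place (1 + 4 * p.2 * p.1 * (1 - p.1), 2^-1 - p.1) p.2.

Lemma continuous_upper_coord : continuous upper_coord.
Proof.
apply: (continuous_quotient_lift (g := fun p : slab => (1 - level p) * cpi p.1.1)).
  have c1 := @continuous_level R; have c2 : continuous (fun p : slab => cpi p.1.1).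
    by apply: continuous_cpi; exact: continuous_fst1.
  by cont.
move=> p q pq; rewrite -(glued_level pq).
have [l1|] := ltP (level p) 1.
  by have [k [->|->]] := glued_vertical pq l1; rewrite ?cpiD2 ?cpiB2.
have /andP[_ l1] := I01_level p => l1'.
have -> : level p = 1 by lra.
by rewrite subrr !mul0r.
Qed.

Lemma upper_coord_place x t : I01 t -> upper_coord (place x t) = (1 - t) * cpi x.1.
Proof.
move=> tI; rewrite /upper_coord.
rewrite (@quotient_lift_pr _ r _ (fun p : slab => (1 - level p) * cpi p.1.1)).
  by rewrite level_height clampE.
move=> p q pq; rewrite -(glued_level pq).
have [l1|] := ltP (level p) 1.
  by have [k [->|->]] := glued_vertical pq l1; rewrite ?cpiD2 ?cpiB2.
have /andP[_ l1] := I01_level p => l1'.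
have -> : level p = 1 by lra.
by rewrite subrr !mul0r.
Qed.

Lemma spi0 : spi 0 = 0 :> R. Proof. by rewrite -[0]/(0%:~R) spi_int. Qed.
Lemma cpi0 : cpi 0 = 1 :> R. Proof. by rewrite /cpi mulr0 cos0. Qed.
Lemma cpi1 : cpi 1 = -1 :> R. Proof. by rewrite /cpi mulr1 cospi. Qed.
Lemma spi_half_neq0 : spi 2^-1 != 0 :> R.
Proof. by rewrite gt_eqF // spi_gt0 //; lra. Qed.

Lemma I01_cases (s : R) : I01 s -> s = 0 \/ s = 1 \/ 0 < s < 1.
Proof.
move=> /andP[]; rewrite le_eqVlt => /orP[/eqP <-|s0]; first by left.
by rewrite le_eqVlt => /orP[/eqP ->|s1]; right; [left|right; rewrite s0].
Qed.

Lemma bump_range (v s : R) : 0 < v < 1 -> 0 < s < 1 -> 0 < 4 * v * s * (1 - s) < 1.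
Proof.
move=> /andP[v0 v1] /andP[s0 s1].
have q0 : 0 < s * (1 - s) by rewrite mulr_gt0 // subr_gt0.
have q1 : 4 * (s * (1 - s)) <= 1 by have := sqr_ge0 (2 * s - 1); rewrite expr2; lra.
have -> : 4 * v * s * (1 - s) = v * (4 * (s * (1 - s))) by ring.
by apply/andP; split; nra.
Qed.

Lemma spi_half_odd (k : int) : spi (2^-1 * (2 * k + 1)%:~R) != 0 :> R.
Proof.
have -> : 2^-1 * (2 * k + 1)%:~R = 2^-1 + k%:~R :> R.
  by rewrite intrD intrM; field.
apply/eqP => /spi_eq0[l]; rewrite -[RHS](subrK k%:~R) => /addIr.
rewrite -intrB => e; have : (2 * (l - k))%:~R = 1%:~R :> R.
  by rewrite intrM -e; field.
by move/intr_inj; lia.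
Qed.

Variables (h g : int).
Hypothesis denqE : denq r = 2 * h + 1.
Hypothesis numqE : numq r = 2 * g.

Lemma transverse_right : transverse (0, 2^-1) = 2^-1 * (2 * h + 1)%:~R.
Proof. by rewrite /transverse /= denqE mulr0 subr0 mulrC. Qed.

Lemma transverse_left : transverse (1, 2^-1) = transverse (0, 2^-1) + 2 * (- g)%:~R.
Proof. by rewrite /transverse /= numqE intrM mulrNz; ring. Qed.

(** As [numq r] is even, the two midpoints have values of [transverse] differing by an even
    integer. *)
Lemma upper_arc_middle : place (1, 2^-1) 1 = place (0, 2^-1) 1.
Proof.
apply/eq_place/glued_top; exists g; left; rewrite transverse_left mulrNz; ring.
Qed.

Lemma continuous_upper_arc : continuous upper_arc.
Proof.
rewrite /upper_arc; apply: (continuous_paste (c := fun s : R => s)).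
- exact: continuous_ident.
- by apply: continuous_place; cont.
- by apply: continuous_place; cont.
- by move=> s ->; rewrite addr0 subr0; exact: upper_arc_middle.
Qed.

Lemma upper_arc_pos s : 0 <= s -> upper_arc s = place (0, 2^-1) (1 - s).
Proof.
rewrite le_eqVlt /upper_arc => /orP[/eqP <-|s0]; last by rewrite leNgt s0.
by rewrite lexx addr0 subr0 upper_arc_middle.
Qed.

Lemma upper_arc_neg s : s <= 0 -> upper_arc s = place (1, 2^-1) (1 + s).
Proof. by rewrite /upper_arc => ->. Qed.

Lemma rotate_half (t : R) (k : int) :
  place (k%:~R, - 2^-1) t = place (k%:~R, 2^-1) t.
Proof.
apply/eq_place/glued_orbit/same_orbitP; exists (k, 0); right.
by rewrite doubleE /=; congr pair; rewrite /=; ring.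
Qed.

Lemma upper_arc_notK s : -1 < s < 1 -> ~ K (upper_arc s).
Proof.
have mid t (e : R) : 0 < t < 1 -> ~ K (place (e, 2^-1) t).
  by move=> t01 /(knot_place_mid t01)[_ /= h2]; have := spi_half_neq0; rewrite h2 eqxx.
move=> s11; have [s0|s0|s0] := ltgtP s 0.
- by rewrite upper_arc_neg ?ltW //; apply: mid; lra.
- by rewrite upper_arc_pos ?ltW //; apply: mid; lra.
- rewrite s0 upper_arc_pos // subr0 => /knot_place_top.
  by rewrite transverse_right => e; have := spi_half_odd h; rewrite e eqxx.
Qed.

Lemma upper_end_right : arc_end K upper_arc upper_right_end.
Proof.
split.
- by apply: continuous_place; cont.
- rewrite upper_arc_pos ?ler01 // subrr.
  have -> : place (0, 2^-1) 0 = place (0, 0) 0 by apply/eq_place/glued_bottom.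
  by exists ((0, 0), height 0) => //; exists (0, 0).
- move=> s sI; rewrite upper_arc_pos ?ler01 // subrr /upper_right_end /=.
  by apply/eq_place/glued_bottom; rewrite /= mulr0 !mul0r.
- move=> v v01; rewrite upper_arc_pos; last by lra.
  have -> : 1 - (1 - v) = v by ring.
  split; rewrite /upper_right_end /=.
    by rewrite mulr0 mul0r subr0.
  rewrite subrr mulr0 -(rotate_half v 0); congr place; congr pair; lra.
- move=> s v sI v01 /(knot_place_mid v01)[/= e1 e2].
  case: (I01_cases sI) => [sE|sE].
    by move: e2; rewrite sE subr0 => e; have := spi_half_neq0; rewrite e eqxx.
  case: sE => [sE|s01].
    move: e2; rewrite sE (_ : 2^-1 - 1 = - 2^-1); last by lra.
    by rewrite spiN => /eqP; rewrite oppr_eq0 (negbTE spi_half_neq0).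
  have : 0 < spi (4 * v * s * (1 - s)) by apply: spi_gt0; exact: bump_range.
  by rewrite e1 ltxx.
Qed.

Lemma upper_end_left : arc_end K (fun s => upper_arc (- s)) upper_left_end.
Proof.
split.
- by apply: continuous_place; cont.
- rewrite upper_arc_neg; last by rewrite oppr_le0 ler01.
  have -> : place (1, 2^-1) (1 + - 1) = place (1, 0) 0.
    by rewrite subrr; apply/eq_place/glued_bottom.
  by exists ((1, 0), height 0) => //; exists (1, 0).
- move=> s sI; rewrite upper_arc_neg; last by rewrite oppr_le0 ler01.
  rewrite subrr /upper_left_end /=.
  by apply/eq_place/glued_bottom; rewrite /= mulr0 !mul0r addr0.
- move=> v v01; rewrite upper_arc_neg; last by lra.
  have -> : 1 + - (1 - v) = v by ring.
  split; rewrite /upper_left_end /=.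
    by rewrite mulr0 mul0r addr0 subr0.
  rewrite subrr mulr0 addr0 -(rotate_half v 1); congr place; congr pair; lra.
- move=> s v sI v01 /(knot_place_mid v01)[/= e1 e2].
  case: (I01_cases sI) => [sE|sE].
    by move: e2; rewrite sE subr0 => e; have := spi_half_neq0; rewrite e eqxx.
  case: sE => [sE|s01].
    move: e2; rewrite sE (_ : 2^-1 - 1 = - 2^-1); last by lra.
    by rewrite spiN => /eqP; rewrite oppr_eq0 (negbTE spi_half_neq0).
  have : 0 < spi (4 * v * s * (1 - s)) by apply: spi_gt0; exact: bump_range.
  by move: e1; rewrite addrC spiD1 => /eqP; rewrite oppr_eq0 => /eqP ->; rewrite ltxx.
Qed.

Lemma upper_inversion_place x t :
  @upper_inversion R r (place x t) = place (x + (0, 1)) t.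
Proof. by rewrite /upper_inversion /place translation_pr. Qed.

Lemma fixed_upper_arc s : @upper_inversion R r (upper_arc s) = upper_arc s.
Proof.
rewrite /upper_arc; case: ifP => _; rewrite upper_inversion_place;
  apply/esym/eq_place/glued_orbit/same_orbitP.
- exists (1, 1); right; rewrite doubleE /=.
  by congr pair; rewrite /=; field.
- exists (0, 1); right; rewrite doubleE /=.
  by congr pair; rewrite /=; field.
Qed.

(** The vector [(0, 1)] is not even, so a fixed point of intermediate height is restored by a
    rotation: it has an integer abscissa and a half-integer ordinate, and modulo [H] only the two
    midpoints remain. At height 1 the same parity argument rests on [denq r] being odd. *)
Lemma fixed_place x t : I01 t -> @upper_inversion R r (place x t) = place x t ->
  t = 0 \/ exists2 s, -1 <= s <= 1 & upper_arc s = place x t.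
Proof.
rewrite upper_inversion_place => tI /pr_eqP xt; have /andP[t0 t1] := tI.
have [->|tn0] := eqVneq t 0; [by left|right].
have [te|tn1] := eqVneq t 1.
  exists 0; first by lra.
  rewrite upper_arc_pos // subr0 te; apply/eq_place/glued_top.
  move: xt; rewrite te => /glued_top[j]; rewrite transverseD.
  have -> : transverse (0, 1) = (2 * h + 1)%:~R by rewrite /transverse /= denqE; ring.
  rewrite transverse_right => -[e|e].
    have : (2 * h + 1 + 2 * j)%:~R = 0%:~R :> R by rewrite intrD (intrM R 2 j); lra.
    by move/intr_inj; lia.
  have {}e : transverse x = (j - h)%:~R - 2^-1.
    by move: e; rewrite (intrD R (2 * h) 1) (intrM R 2 h) (intrB R j h); lra.
  have [i [jE|jE]] := int_parity j.
    by exists i; right; rewrite e jE intrB !intrD !intrM; field.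
  by exists (i - h); left; rewrite e jE !intrB !intrD !intrM; field.
have t01 : 0 < t < 1 by rewrite !lt_neqAle eq_sym tn0 t0 tn1 t1.
move: xt; rewrite glued_mid // => /same_orbitP[k]; rewrite doubleE.
rewrite {1 3}[x]surjective_pairing => -[[_ e]|[e1 e2]].
  have : (1 + 2 * k.2)%:~R = 0%:~R :> R by rewrite intrD intrM; lra.
  by move/intr_inj; lia.
have x1E : x.1 = k.1%:~R by lra.
have x2E : x.2 = k.2%:~R - 2^-1 by lra.
have [e|e] : place (0, 2^-1) t = place x t \/ place (1, 2^-1) t = place x t.
- have orb (e : R) j l : (x = (e, 2^-1) + double (j, l) \/ x = double (j, l) - (e, 2^-1)) ->
      place (e, 2^-1) t = place x t.
    by move=> exj; apply/eq_place/glued_orbit/same_orbitP; exists (j, l).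
  have [j [jE|jE]] := int_parity k.1; have [l [lE|lE]] := int_parity k.2.
  + left; apply: (orb _ j l); right; rewrite doubleE [LHS]surjective_pairing x1E x2E jE lE.
    by congr pair; rewrite /= ?intrD ?intrM; field.
  + left; apply: (orb _ j l); left; rewrite doubleE [LHS]surjective_pairing x1E x2E jE lE.
    by congr pair; rewrite /= ?intrD ?intrM; field.
  + right; apply: (orb _ (j + 1) l); right; rewrite doubleE [LHS]surjective_pairing x1E x2E jE lE.
    by congr pair; rewrite /= ?intrD ?intrM; field.
  + right; apply: (orb _ j l); left; rewrite doubleE [LHS]surjective_pairing x1E x2E jE lE.
    by congr pair; rewrite /= ?intrD ?intrM; field.
- exists (1 - t); first by lra.
  by rewrite upper_arc_pos ?subr_ge0 // -e; congr place; ring.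
- exists (t - 1); first by lra.
  by rewrite upper_arc_neg ?subr_le0 // -e; congr place; ring.
Qed.

Theorem upper_long_arc : long_arc (K := K) (@upper_inversion R r)
  (upper_tunnel R r) upper_arc upper_coord upper_right_end upper_left_end.
Proof.
split.
- exact: continuous_upper_arc.
- exact: continuous_upper_coord.
- move=> s s11; have [s0|/ltW s0] := leP 0 s.
    rewrite upper_arc_pos // upper_coord_place /= ?cpi0 ?mulr1; first by ring.
    by rewrite /I01; lra.
  rewrite upper_arc_neg // upper_coord_place /= ?cpi1; first by ring.
  by rewrite /I01; lra.
- apply/seteqP; split=> [z|z [|[s _ <-]]].
  + have [x [t [tI ->]]] := placeP z; rewrite /fixed_set /= => /(fixed_place tI)[t0|].
      left; exists (x, height t) => //=.
      by rewrite level_height clampE // t0.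
    by move=> [s s11 e]; right; exists s.
  + exact: upper_tunnel_fixed.
  + exact: fixed_upper_arc.
- move=> s s11; have [s0|/ltW s0] := leP 0 s.
    by rewrite upper_arc_pos // => /tunnel_place; rewrite /I01 => h'; lra.
  by rewrite upper_arc_neg // => /tunnel_place; rewrite /I01 => h'; lra.
- exact: upper_arc_notK.
- exact: upper_end_right.
- exact: upper_end_left.
Qed.

Section Holonomies.
Context {G : groupType} (a b : G) (F : R * R -> G).
Local Notation charts := (descend r (conway_charts r a b F)).
Hypothesis KC : flat_structure (~` K) charts.
Hypothesis inv : forall c, conway_charts r a b F c -> open c.1 /\ glue_invariant r c.

Lemma continuous_slab_path (u : R -> R * R) (v : R -> R) :
  continuous u -> continuous v -> continuous (fun s => (u s, height (v s)) : slab).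
Proof.
move=> cu cv; apply: continuous_pair => //.
exact: (continuous_compose cv (@continuous_height R)).
Qed.

(** Points of an even wall count with the side [side >= 0]. The path leaves the wall on that side
    and returns from the other, so the factor [a] appears only at [s = 1]. *)
Lemma holonomy_right v : 0 < v < 1 ->
  holonomy charts (fun s => upper_right_end (s, v)) = a.
Proof.
move=> v01; have vI : I01 v by rewrite /I01; lra.
pose f (s : R) : slab := ((4 * v * s * (1 - s), 2^-1 - s), height v).
have cf : continuous f by apply: continuous_slab_path; cont.
have lf s : level (f s) = v by rewrite level_height clampE.
rewrite (_ : (fun s => _) = pr r \o f) //.
pose k (s : R) : G := if s < 1 then 1%g else a.
have q2 s : 0 < s < 1 -> 0 < spi (4 * v * s * (1 - s)).
  by move=> s01; apply: spi_gt0; exact: bump_range.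
rewrite (descend_holonomy (h := k) inv KC cf).
- by rewrite /k ltr01 ltxx invg1 mul1g.
- move=> s sI; apply: (arc_end_notK upper_end_right) => //.
move=> s sI; case: (I01_cases sI) => [->|[->|s01]].
- exists (even_chart a); split; first by constructor 2.
    split; rewrite ?lf //= ?subr0 ?mulr0 ?mul0r ?cpi0 ?spi_half_neq0 //.
    by apply/eqP; lra.
  near=> q => qI; have q1 : q < 2^-1 by near: q; apply: lt_nbhsl; lra.
  rewrite /k /= /even_jump ifT; last by lra.
  rewrite ltr01 !mul1g !subr0 mulr0 mul0r.
  have -> : 0 <= side (4 * v * q * (1 - q), 2^-1 - q).
    case: (I01_cases qI) => [->|[qE|q01]].
    - by rewrite mulr0 mul0r /side /= spi0 mul0r.
    - by lra.
    - rewrite /side /= mulr_ge0 // ltW ?q2 //.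
      by apply: spi_gt0; apply/andP; split; lra.
  by rewrite /side /= spi0 mul0r lexx.
- exists (even_chart a); split; first by constructor 2.
    split; rewrite ?lf //= ?subrr ?mulr0 ?cpi0; first by apply/eqP; lra.
    rewrite (_ : 2^-1 - 1 = - 2^-1); last by lra.
    by rewrite spiN oppr_eq0 spi_half_neq0.
  near=> q => qI; have q1 : 2^-1 < q by near: q; apply: lt_nbhsr; lra.
  rewrite /k /= /even_jump ltxx subrr mulr0 {2}/side /= spi0 mul0r lexx mulgV.
  have [e|[->|q01]] := I01_cases qI; first by move: q1; rewrite e ltNge invr_ge0 ler0n.
    by rewrite ltxx subrr mulr0 /side /= spi0 mul0r lexx mulgV.
  rewrite ifT; last by lra.
  have -> : (0 <= side (4 * v * q * (1 - q), 2^-1 - q)) = false.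
    apply/negbTE; rewrite -ltNge /side /= pmulr_rlt0 ?q2 //.
    rewrite -oppr_gt0 -spiN; apply: spi_gt0; apply/andP; split; lra.
  by rewrite invg1 mulg1.
- exists cell_chart; split; first by constructor 1.
    split; rewrite ?lf /=; last by lra.
    by rewrite gt_eqF ?q2.
  near=> q => qI; rewrite /k /=; have q1 : q < 1.
    by near: q; apply: lt_nbhsl; lra.
  by rewrite q1 ifT //; lra.
Unshelve. all: by end_near. Qed.

Lemma holonomy_left v : 0 < v < 1 ->
  holonomy charts (fun s => upper_left_end (s, v)) = b.
Proof.
move=> v01; have vI : I01 v by rewrite /I01; lra.
pose f (s : R) : slab := ((1 + 4 * v * s * (1 - s), 2^-1 - s), height v).
have cf : continuous f by apply: continuous_slab_path; cont.
have lf s : level (f s) = v by rewrite level_height clampE.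
rewrite (_ : (fun s => _) = pr r \o f) //.
pose k (s : R) : G := if s < 1 then 1%g else b.
have q2 s : 0 < s < 1 -> spi (1 + 4 * v * s * (1 - s)) < 0.
  by move=> s01; rewrite addrC spiD1 oppr_lt0; apply: spi_gt0; exact: bump_range.
have spi1 : spi 1 = 0 :> R by rewrite -[1]/(1%:~R) spi_int.
rewrite (descend_holonomy (h := k) inv KC cf).
- by rewrite /k ltr01 ltxx invg1 mul1g.
- move=> s sI; apply: (arc_end_notK upper_end_left) => //.
move=> s sI; case: (I01_cases sI) => [->|[->|s01]].
- exists (odd_chart b); split; first by constructor 3.
    split; rewrite ?lf //= ?subr0 ?mulr0 ?mul0r ?addr0 ?cpi1 ?spi_half_neq0 //.
    by apply/eqP; lra.
  near=> q => qI; have q1 : q < 2^-1 by near: q; apply: lt_nbhsl; lra.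
  rewrite /k /= /odd_jump ifT; last by lra.
  rewrite ltr01 !mul1g !subr0 mulr0 mul0r addr0.
  have -> : side (1 + 4 * v * q * (1 - q), 2^-1 - q) <= 0.
    case: (I01_cases qI) => [->|[qE|q01]].
    - by rewrite mulr0 mul0r addr0 /side /= spi1 mul0r.
    - by lra.
    - rewrite /side /= nmulr_rle0 ?q2 // ltW //.
      by apply: spi_gt0; apply/andP; split; lra.
  by rewrite /side /= spi1 mul0r lexx.
- exists (odd_chart b); split; first by constructor 3.
    split; rewrite ?lf //= ?subrr ?mulr0 ?addr0 ?cpi1; first by apply/eqP; lra.
    rewrite (_ : 2^-1 - 1 = - 2^-1); last by lra.
    by rewrite spiN oppr_eq0 spi_half_neq0.
  near=> q => qI; have q1 : 2^-1 < q by near: q; apply: lt_nbhsr; lra.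
  rewrite /k /= /odd_jump ltxx subrr mulr0 addr0 {2}/side /= spi1 mul0r lexx mulgV.
  have [e|[->|q01]] := I01_cases qI; first by move: q1; rewrite e ltNge invr_ge0 ler0n.
    by rewrite ltxx subrr mulr0 addr0 /side /= spi1 mul0r lexx mulgV.
  rewrite ifT; last by lra.
  have -> : (side (1 + 4 * v * q * (1 - q), 2^-1 - q) <= 0) = false.
    apply/negbTE; rewrite -ltNge /side /= nmulr_rgt0 ?q2 //.
    rewrite -oppr_gt0 -spiN; apply: spi_gt0; apply/andP; split; lra.
  by rewrite invg1 mulg1.
- exists cell_chart; split; first by constructor 1.
    split; rewrite ?lf /=; last by lra.
    by rewrite lt_eqF ?q2.
  near=> q => qI; rewrite /k /=; have q1 : q < 1.
    by near: q; apply: lt_nbhsl; lra.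
  by rewrite q1 ifT //; lra.
Unshelve. all: by end_near. Qed.

(** Away from height 0 the whole arc, including its passage at height 1, lies in the domain of
    [top_chart]; only the values of [F] at the two midpoints matter. *)
Lemma holonomy_arc u v : 0 < u < 1 -> 0 < v < 1 ->
  holonomy charts (fun s => upper_arc ((1 - s) * (1 - u) + s * (v - 1))) =
  ((F (0%R, 2^-1%R))^-1 * F (1%R, 2^-1%R))%g.
Proof.
move=> u01 v01.
pose c : set S3 * (S3 -> G) := ([set z | (top_chart r F).1 (repr z)], fun z => (top_chart r F).2 (repr z)).
have Tc : conway_charts r a b F (top_chart r F) by constructor 4.
have Cc : charts c by exists (top_chart r F).
have cP x t : 0 < t < 1 -> spi (transverse x) != 0 -> c.2 (place x t) = F x.
  move=> t01 sx; have [_ ic] := inv Tc.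
  have lt : level (x, height t) = t by rewrite level_height clampE // /I01; lra.
  have [] := ic _ _ (glued_repr r (x, height t)); first by split=> //=; rewrite ?lt; lra.
  by move=> _; rewrite /c /= /place => ->; rewrite lt ifT //; lra.
have sr : spi (transverse (0, 2^-1)) != 0 by rewrite transverse_right spi_half_odd.
have sl : spi (transverse (1, 2^-1)) != 0 by rewrite transverse_left spiD2.
have arcP s : -1 < s < 1 -> c.1 (upper_arc s).
  move=> s11; have [_ ic] := inv Tc.
  have pl x t : 0 < t <= 1 -> spi (transverse x) != 0 -> c.1 (place x t).
    move=> t01 sx; have lt : level (x, height t) = t by rewrite level_height clampE // /I01; lra.
    by have [] := ic _ _ (glued_repr r (x, height t)); first by split=> //=; rewrite ?lt; lra.
  have [s0|/ltW s0] := leP 0 s.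
    by rewrite upper_arc_pos //; apply: pl => //; lra.
  by rewrite upper_arc_neg //; apply: pl => //; lra.
have lin s : I01 s -> -1 < (1 - s) * (1 - u) + s * (v - 1) < 1.
  by rewrite /I01; nra.
rewrite (holonomy_one_chart KC _ Cc); first last.
- by move=> s /lin; exact: arcP.
- split; last by move=> s /lin; exact: upper_arc_notK.
  by apply: (continuous_compose _ continuous_upper_arc); cont.
congr (_^-1 * _)%g.
- rewrite subr0 mul1r mul0r addr0 upper_arc_pos; last by lra.
  by rewrite (_ : 1 - (1 - u) = u) ?cP //; ring.
- rewrite subrr mul0r mul1r add0r upper_arc_neg; last by lra.
  by rewrite (_ : 1 + (v - 1) = v) ?cP //; ring.
Qed.

End Holonomies.

End UpperArc.

(** * The labels of the strips *)

Section CellLabels.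
Context {G : groupType} (a b : G).
Implicit Types (i j k : int).

Fixpoint word (f : int -> G) (n : nat) : G :=
  if n is n'.+1 then (word f n' * f n'.+1%:Z)%g else 1%g.

Lemma eq_word f f' n : (forall i, 0 < i <= n%:Z -> f i = f' i) -> word f n = word f' n.
Proof.
elim: n => //= n ih e; rewrite ih ?e //; first by lia.
by move=> i i0; apply: e; lia.
Qed.

Lemma word_cat f n l : word f (n + l) = (word f n * word (fun i => f (n%:Z + i)) l)%g.
Proof.
elim: l => [|l ih]; first by rewrite addn0 mulg1.
by rewrite addnS /= ih mulgA; congr (_ * f _)%g; lia.
Qed.

(** Contribution of the wall [i] crossed from left to right at an ordinate between [k] and [k + 1]:
    the parity of [i] selects the generator, and that of [k] the sign, because walls are oriented by
    [side]. *)
Definition letter (i k : int) : G :=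
  let g := if (2 %| i)%Z then a else b in if (2 %| k)%Z then g else g^-1%g.

Lemma letter_parity i k i' k' : (2 %| i - i')%Z -> (2 %| k - k')%Z ->
  letter i k = letter i' k'.
Proof.
move=> hi hk; have -> : i = i' + (i - i') by lia. rewrite /letter.
have -> : (2 %| i' + (i - i'))%Z = (2 %| i')%Z by lia.
by have -> : (2 %| k)%Z = (2 %| k')%Z by lia.
Qed.

Lemma letter_inv i k i' k' : (2 %| i - i')%Z -> (2 %| k - k' + 1)%Z ->
  letter i k = (letter i' k')^-1%g.
Proof.
move=> hi hk; rewrite /letter; have -> : (2 %| i)%Z = (2 %| i')%Z by lia.
have -> : (2 %| k)%Z = ~~ (2 %| k')%Z by lia.
by case: (2 %| k')%Z => //=; rewrite invgK.
Qed.

Variables (p q : int) (k1 k2 : int).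
Hypothesis p_gt0 : 0 < p.
Hypothesis bezout : p * k2 - q * k1 = 1.

(* The strip [j < transverse x < j + 1] meets the wall [x.1 = i] at the height
   [(q i + j) / p], up to [1 / p]. *)
Definition crossing (j i : int) : G := letter i ((q * i + j) %/ p)%Z.

(** The relation of the knot: translation by [(2 p, 2 q)] preserves strip 0, so the [2 p] walls met
    in between must contribute trivially. *)
Hypothesis period : word (crossing 0) `|(p + p)%R|%N = 1%g.

Definition strip0 i : G := word (crossing 0) `|(i %% (p + p))%Z|%N.

Lemma divzMDr' k l : ((l * p + k) %/ p)%Z = l + (k %/ p)%Z.
Proof. by rewrite divzMDl ?gt_eqF. Qed.

Lemma crossing_period i l : crossing 0 (i + l * (p + p)) = crossing 0 i.
Proof.
apply: letter_parity; first by lia.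
have -> : q * (i + l * (p + p)) + 0 = (q * l * 2) * p + (q * i + 0) by ring.
by rewrite divzMDr'; lia.
Qed.

Lemma strip0_period i l : strip0 (i + l * (p + p)) = strip0 i.
Proof. by rewrite /strip0 addrC modzMDl. Qed.

Lemma strip0_step i : strip0 i = (strip0 (i - 1) * crossing 0 i)%g.
Proof.
have pp0 : p + p != 0 by lia.
have := divz_eq i (p + p); have := modz_ge0 i pp0; have := ltz_mod i pp0.
set l := (i %/ _)%Z; set e := (i %% _)%Z => e1 e0 iE.
have iE1 : i - 1 = e - 1 + l * (p + p) by lia.
rewrite iE1 (_ : i = e + l * (p + p)); last by lia.
rewrite crossing_period !strip0_period /strip0.
have [e0'|en0] := eqVneq e 0.
  rewrite e0' mod0z absz0 /= add0r.
  have -> : ((-1) %% (p + p))%Z = p + p - 1.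
    by apply/esym; rewrite -(modzMDl 1) modz_small ?mul1r //; lia.
  rewrite -(crossing_period 0 1) add0r mul1r -[LHS]period.
  have -> : `|(p + p)%R|%N = (`|(p + p - 1)%R|%N).+1 by lia.
  by rewrite /=; congr (_ * crossing 0 _)%g; lia.
rewrite !modz_small; [|lia..].
have -> : `|e|%N = (`|(e - 1)%R|%N).+1 by lia.
by rewrite /=; congr (_ * crossing 0 _)%g; lia.
Qed.

(** For even [j] the strip is the translate of strip 0 by the even vector [j (k1, k2)]. For odd [j]
    the rotation about the origin carries it to the even strip [-1 - j], and cell [i] to cell
    [-1 - i]. Invariance under [H] is thus built in. *)
Definition strip (j i : int) : G :=
  if (2 %| j)%Z then strip0 (i - j * k1) else strip0 (-1 - i - (-1 - j) * k1).

Lemma strip_rot j i : strip (-1 - j) (-1 - i) = strip j i.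
Proof.
rewrite /strip; have -> : (2 %| -1 - j)%Z = ~~ (2 %| j)%Z by lia.
by case: (2 %| j)%Z => /=; congr strip0; ring.
Qed.

Lemma strip_trans j i l1 l2 :
  strip (j + 2 * (p * l2 - q * l1)) (i + 2 * l1) = strip j i.
Proof.
(* First coordinate of [(2 l1, 2 l2)] in the basis [(k1, k2)], [(p, q)]; the second coefficient is
   even, so its contribution is a period of [strip0]. *)
have e : 2 * l1 = 2 * (p * l2 - q * l1) * k1 + (l1 * k2 - l2 * k1) * (p + p).
  have -> : 2 * l1 = 2 * l1 * (p * k2 - q * k1) by rewrite bezout mulr1.
  by ring.
rewrite /strip e; have -> : (2 %| j + 2 * (p * l2 - q * l1))%Z = (2 %| j)%Z by lia.
case: ifP => _.
  by rewrite -[RHS](strip0_period _ (l1 * k2 - l2 * k1)); congr strip0; ring.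
by rewrite -[RHS](strip0_period _ (- (l1 * k2 - l2 * k1))); congr strip0; ring.
Qed.

Lemma strip_step_even j i : (2 %| j)%Z -> strip j i = (strip j (i - 1) * crossing j i)%g.
Proof.
move=> j2; rewrite /strip j2 strip0_step; congr (_ * _)%g; first by congr strip0; ring.
apply: letter_parity; first by lia.
have -> : q * (i - j * k1) + 0 = (- (j * k2)) * p + (q * i + j).
  have -> : - (j * k2) * p + (q * i + j) = - (j * k2) * p + q * i + j * (p * k2 - q * k1).
    by rewrite bezout mulr1 addrA.
  by ring.
by rewrite divzMDr'; lia.
Qed.

Lemma divz_opp k : ((- 1 - k) %/ p)%Z = - 1 - (k %/ p)%Z.
Proof. by nia. Qed.

(** Odd strips follow from even ones by the rotation: it reverses the direction of travel and the
    parity of the integer part of the ordinate, and so inverts the letter. *)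
Lemma strip_step j i : strip j i = (strip j (i - 1) * crossing j i)%g.
Proof.
have [j2|j2] := boolP (2 %| j)%Z; first exact: strip_step_even.
have j2' : (2 %| -1 - j)%Z by lia.
rewrite -(strip_rot j i) -(strip_rot j (i - 1)).
have := strip_step_even (- i) j2'.
have -> : -1 - (i - 1) = - i by ring.
have -> : - i - 1 = -1 - i by ring.
move=> ->; rewrite -mulgA; have -> : crossing j i = (crossing (-1 - j) (- i))^-1%g.
  apply: letter_inv; first by lia.
  have -> : q * - i + (-1 - j) = -1 - (q * i + j) by ring.
  by rewrite divz_opp; lia.
by rewrite mulgV mulg1.
Qed.

Lemma strip_word j n : ((strip j 0)^-1 * strip j n%:Z = word (crossing j) n)%g.
Proof.
elim: n => [|n ih]; first by rewrite mulVg.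
rewrite (strip_step j n.+1%:Z) mulgA /=.
by rewrite (_ : n.+1%:Z - 1 = n%:Z) ?ih //; lia.
Qed.

End CellLabels.

(** * From the labels of the strips to a function on the plane *)

Section ConwayFunction.
Context {R : realType} (r : rat) {G : groupType} (a b : G).
Local Notation transverse := (@transverse R r).
Local Notation spi := (@spi R).
Local Notation cpi := (@cpi R).
Local Notation floor := Num.floor.
Implicit Types (x y : R * R) (t : R).

Lemma spi_neq_int t (k : int) : spi t != 0 -> t != k%:~R.
Proof. by apply: contra => /eqP ->; rewrite spi_int. Qed.

Lemma floor_strict t : spi t != 0 -> (floor t)%:~R < t < (floor t)%:~R + 1.
Proof.
move=> /(@spi_neq_int _ (floor t)) tn; have /andP[t1 t2] := floor_itv t.
by rewrite lt_neqAle eq_sym tn t1 -[1]/(1%:~R) -intrD.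
Qed.

Lemma floor_near (X : topologicalType) (u : X -> R) (z : X) : {for z, continuous u} ->
  spi (u z) != 0 -> \forall w \near z, floor (u w) = floor (u z).
Proof.
move=> cu /floor_strict/andP[h1 h2].
have n1 : \forall w \near z, (floor (u z))%:~R < u w by exact: (cu _ (lt_nbhsr h1)).
have n2 : \forall w \near z, u w < (floor (u z))%:~R + 1 by exact: (cu _ (lt_nbhsl h2)).
by apply: filterS2 n1 n2 => w w1 w2; apply: floor_def; rewrite intrD (ltW w1).
Qed.

Lemma floor_opp t : spi t != 0 -> floor (- t) = -1 - floor t.
Proof.
move=> /floor_strict/andP[h1 h2]; apply: floor_def; apply/andP; split.
  by rewrite intrB; lra.
by rewrite addrC addrA addrN add0r mulrNz ltrN2.
Qed.

Lemma floor_shift t (k : int) : floor (t + k%:~R) = floor t + k.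
Proof.
apply: floor_def; have := floor_itv t; rewrite !intrD => /andP[h1 h2].
by apply/andP; split; lra.
Qed.

Lemma spi_sign t : spi t != 0 -> (0 < spi t) = (2 %| floor t)%Z.
Proof.
move=> st; have /andP[h1 h2] := floor_strict st.
have [k [kE|kE]] := int_parity (floor t).
  have -> : (2 %| floor t)%Z by lia.
  rewrite -(spiD2 t (- k)); apply: spi_gt0; move: h1 h2; rewrite kE mulrNz intrM => h1 h2.
  by apply/andP; split; lra.
have -> : (2 %| floor t)%Z = false by lia.
apply/negbTE; rewrite -leNgt ltW // -oppr_gt0 -spiD1 -(spiD2 _ (- (k + 1))).
apply: spi_gt0; move: h1 h2; rewrite kE mulrNz !intrD !intrM => h1 h2.
by apply/andP; split; lra.
Qed.

Variables (k1 k2 : int).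
Hypothesis bezout : denq r * k2 - numq r * k1 = 1.
Local Notation crossing := (crossing a b (denq r) (numq r)).
Hypothesis period : word (crossing 0) `|(denq r + denq r)%R|%N = 1%g.
Local Notation strip := (strip a b (denq r) (numq r) k1).

(** A point of the wall [x.1 = i] is given to the cell on the side where the jump functions are
    nontrivial: the right one if [floor x.2] is even, the left one if it is odd. *)
Definition conway_fun x : G :=
  let i := floor x.1 in
  strip (floor (transverse x))
    (if (x.1 == i%:~R) && ~~ (2 %| floor x.2)%Z then i - 1 else i).

Lemma conway_fun_shift x (k : int * int) : conway_fun (x + double k) = conway_fun x.
Proof.
rewrite /conway_fun transverseD transverse_double doubleE /=.
have e2 (l : int) : 2 * l%:~R = (2 * l)%:~R :> R by rewrite intrM.
rewrite !e2 !floor_shift intrD (inj_eq (addIr _)).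
have -> : (2 %| floor x.2 + 2 * k.2)%Z = (2 %| floor x.2)%Z by lia.
by case: ifP => _; rewrite -[RHS](strip_trans a b (denq_gt0 r) bezout _ _ k.1 k.2);
  congr strip; rewrite /transverse_int; ring.
Qed.

Lemma wall_height x (i : int) : x.1 = i%:~R -> spi (transverse x) != 0 -> spi x.2 != 0.
Proof.
move=> xi; apply: contra => /eqP /spi_eq0[l xl].
by rewrite /transverse xi xl -!intrM -intrB spi_int.
Qed.

Lemma conway_fun_opp x : spi (transverse x) != 0 -> conway_fun (- x) = conway_fun x.
Proof.
move=> st; rewrite /conway_fun transverseN (floor_opp st) /=.
have [xi|xi] := eqVneq x.1 (floor x.1)%:~R.
  have s2 := wall_height xi st.
  have fo : floor (- x.1) = - floor x.1 by rewrite {1}xi -mulrNz intrKfloor.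
  rewrite (floor_opp s2) fo mulrNz -xi !eqxx /=.
  have -> : (2 %| -1 - floor x.2)%Z = ~~ (2 %| floor x.2)%Z by lia.
  by case: (2 %| floor x.2)%Z => /=; rewrite -[RHS](strip_rot a b (denq_gt0 r) bezout); congr strip; ring.
have s1 : spi x.1 != 0.
  by apply/eqP => /spi_eq0[l xl]; move: xi; rewrite xl intrKfloor eqxx.
rewrite (floor_opp s1); have -> : (- x.1 == (-1 - floor x.1)%:~R) = false.
  apply/negbTE; apply: contra s1 => /eqP e.
  by rewrite -[x.1]opprK e -mulrNz spi_int.
by rewrite /= (strip_rot a b (denq_gt0 r) bezout).
Qed.

Lemma conway_fun_orbit x y : spi (transverse x) != 0 -> same_orbit x y ->
  conway_fun x = conway_fun y.
Proof.
move=> st /same_orbitP[k [->|->]]; first by rewrite conway_fun_shift.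
by rewrite [double k - x]addrC conway_fun_shift conway_fun_opp.
Qed.

Lemma continuous_transverse2 : continuous transverse.
Proof. by rewrite /transverse; cont. Qed.

Lemma conway_fun_cell x : spi x.1 != 0 -> spi (transverse x) != 0 ->
  \forall y \near x, conway_fun y = conway_fun x.
Proof.
move=> s1 st.
have n1 : \forall y \near x, floor y.1 = floor x.1.
  have cf : {for x, continuous (fun y : R * R => y.1)} by exact: cvg_fst.
  exact: (floor_near cf s1).
have nt : \forall y \near x, floor (transverse y) = floor (transverse x).
  by apply: floor_near => //; exact: continuous_transverse2.
have n0 : \forall y \near x, spi y.1 != 0.
  have o : open [set y : R * R | spi y.1 != 0].
    by apply: open_neq_fun; apply: continuous_spi; exact: continuous_first.
  by have := open_nbhs_nbhs (conj o s1).
apply: filterS3 n1 nt n0 => y y1 yt y0; rewrite /conway_fun y1 yt.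
by rewrite -{1}y1 (negbTE (spi_neq_int _ y0)) (negbTE (spi_neq_int _ s1)).
Qed.

(** Inside a strip a wall meets no lattice point, so the integer part of the ordinate is constant
    along the crossing and can be computed by integer division. *)
Lemma crossing_height x (i : int) : x.1 = i%:~R -> spi (transverse x) != 0 ->
  ((numq r * i + floor (transverse x)) %/ denq r)%Z = floor x.2.
Proof.
move=> xi st; have /andP[t1 t2] := floor_strict st.
have /andP[h1 h2] := floor_strict (wall_height xi st).
have p0 : 0 < (denq r)%:~R :> R by rewrite ltr0z denq_gt0.
set j := floor (transverse x) in t1 t2 *; set l := floor x.2 in h1 h2 *.
have tE : transverse x = (denq r)%:~R * x.2 - (numq r)%:~R * i%:~R by rewrite /transverse xi.
have g1 : (denq r * l)%:~R < (numq r * i + j + 1)%:~R :> R.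
  by rewrite !intrD !intrM; have := ltr_pM2l p0 l%:~R x.2; rewrite h1; lra.
have g2 : (numq r * i + j)%:~R < (denq r * (l + 1))%:~R :> R.
  by rewrite !intrD !intrM intrD; have := ltr_pM2l p0 x.2 (l%:~R + 1); rewrite h2; lra.
move: g1 g2; rewrite !ltr_int; have := denq_gt0 r; nia.
Qed.

(** On both sides, and on the wall itself, dividing by the jump leaves the label of the cell where
    the jump is trivial. *)
Lemma conway_fun_wall (jump : R * R -> G) (g : G) x (i : int) :
  x.1 = i%:~R -> spi (transverse x) != 0 -> g = (if (2 %| i)%Z then a else b) ->
  (forall y, i%:~R - 1 < y.1 < i%:~R + 1 -> spi y.2 != 0 ->
     jump y = if (if (2 %| floor y.2)%Z then i%:~R <= y.1 else y.1 <= i%:~R) then g else 1%g) ->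
  \forall y \near x, (conway_fun y * (jump y)^-1 = conway_fun x * (jump x)^-1)%g.
Proof.
move=> xi st gE jumpE; have s2 := wall_height xi st.
have n2 : \forall y \near x, floor y.2 = floor x.2.
  have cs : {for x, continuous (fun y : R * R => y.2)} by exact: cvg_snd.
  exact: (floor_near cs s2).
have n0 : \forall y \near x, spi y.2 != 0.
  have o : open [set y : R * R | spi y.2 != 0].
    by apply: open_neq_fun; apply: continuous_spi; exact: continuous_second.
  by have := open_nbhs_nbhs (conj o s2).
have nt : \forall y \near x, floor (transverse y) = floor (transverse x).
  by apply: floor_near => //; exact: continuous_transverse2.
have cf : {for x, continuous (fun y : R * R => y.1)} by exact: cvg_fst.
have m1 : \forall y \near x, i%:~R - 1 < y.1.
  by apply: (cf _ (lt_nbhsr _)); rewrite xi; lra.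
have m2 : \forall y \near x, y.1 < i%:~R + 1.
  by apply: (cf _ (lt_nbhsl _)); rewrite xi; lra.
have cross := strip_step (denq_gt0 r) bezout period (floor (transverse x)) i.
rewrite /crossing crossing_height // /letter -gE in cross.
have val y : i%:~R - 1 < y.1 < i%:~R + 1 -> spi y.2 != 0 -> floor y.2 = floor x.2 ->
    floor (transverse y) = floor (transverse x) ->
    (conway_fun y * (jump y)^-1)%g =
    (if (2 %| floor x.2)%Z then strip (floor (transverse x)) (i - 1)
     else strip (floor (transverse x)) i).
  move=> /andP[y1 y2] y0 yf yt; rewrite jumpE ?y1 // /conway_fun yt yf.
  have [lt|gt|e] := ltgtP y.1 i%:~R.
  - have -> : floor y.1 = i - 1.
      by apply: floor_def; rewrite subrK lt andbT intrB ltW.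
    have -> : (y.1 == (i - 1)%:~R) = false by rewrite intrB gt_eqF.
    by move: cross; case: ifP => _ /= cross; rewrite ?invg1 ?mulg1 // cross mulgK.
  - have -> : floor y.1 = i by apply: floor_def; rewrite (ltW gt) intrD.
    rewrite gt_eqF //=.
    by move: cross; case: ifP => _ /= cross; rewrite ?invg1 ?mulg1 // cross mulgK.
  - rewrite e intrKfloor eqxx /=.
    by move: cross; case: ifP => _ /= ->; rewrite ?mulgK // invgK.
near=> y; rewrite !val //.
- by rewrite xi; apply/andP; split; lra.
- by apply/andP; split; [near: y|near: y].
- by near: y.
- by near: y.
- by near: y.
Unshelve. all: by end_near. Qed.

Lemma spi_small_ge0 t : -1 < t < 1 -> (0 <= spi t) = (0 <= t) /\ (spi t <= 0) = (t <= 0).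
Proof.
move=> /andP[t1 t2]; have [t0|t0|->] := ltgtP t 0; last by rewrite spi0 !lexx.
  have : 0 < spi (- t) by apply: spi_gt0; apply/andP; split; lra.
  by rewrite spiN oppr_gt0 => st; rewrite (ltW st) leNgt st.
have st : 0 < spi t by apply: spi_gt0; rewrite t0.
by rewrite (ltW st) leNgt st.
Qed.

Lemma side_sign (i : int) y : i%:~R - 1 < y.1 < i%:~R + 1 -> spi y.2 != 0 ->
  (if (2 %| i)%Z then 0 <= side y else side y <= 0) =
  (if (2 %| floor y.2)%Z then i%:~R <= y.1 else y.1 <= i%:~R).
Proof.
move=> /andP[y1 y2] s2; have [] := @spi_small_ge0 (y.1 - i%:~R).
  by apply/andP; split; lra.
rewrite subr_ge0 subr_le0 -(spi_sign s2) /side => <- <-.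
have [k [->|->]] := int_parity i.
  have -> : (2 %| 2 * k)%Z by lia.
  have -> : y.1 - (2 * k)%:~R = y.1 + 2 * (- k)%:~R by rewrite intrM mulrNz; ring.
  rewrite spiD2; have [s0|s0|s0] := ltgtP 0 (spi y.2).
  - by rewrite pmulr_lge0.
  - by rewrite nmulr_lge0.
  - by move: s2; rewrite -s0 eqxx.
have -> : (2 %| 2 * k + 1)%Z = false by lia.
have -> : y.1 - (2 * k + 1)%:~R = (y.1 + 1) + 2 * (- k - 1)%:~R.
  by rewrite intrD intrM intrB mulrNz; ring.
rewrite spiD2 spiD1 oppr_ge0 oppr_le0; have [s0|s0|s0] := ltgtP 0 (spi y.2).
- by rewrite pmulr_lle0.
- by rewrite nmulr_lle0.
- by move: s2; rewrite -s0 eqxx.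
Qed.

Lemma cpi_parity (i : int) : cpi i%:~R = if (2 %| i)%Z then 1 else -1.
Proof.
have [k [->|->]] := int_parity i.
  have -> : (2 %| 2 * k)%Z by lia.
  by rewrite intrM -[_ * _]add0r cpiD2 cpi0.
have -> : (2 %| 2 * k + 1)%Z = false by lia.
by rewrite intrD cpiD1 intrM -[_ * _]add0r cpiD2 cpi0.
Qed.

Lemma conway_fun_jump (jump : R * R -> G) x : spi x.1 != 0 -> spi x.2 != 0 ->
  spi (transverse x) != 0 ->
  (forall y, (0 <= side y) = (0 <= side x) -> (side y <= 0) = (side x <= 0) ->
     jump y = jump x) ->
  \forall y \near x, (conway_fun y * (jump y)^-1 = conway_fun x * (jump x)^-1)%g.
Proof.
move=> s1 s2 st jumpE; have sx : side x != 0 by rewrite mulf_neq0.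
by apply: filterS2 (conway_fun_cell s1 st) (side_locally sx) => y -> [e1 e2]; rewrite jumpE.
Qed.

Lemma conway_fun_even x : cpi x.1 != -1 -> spi x.2 != 0 -> spi (transverse x) != 0 ->
  \forall y \near x, (conway_fun y * (even_jump a y)^-1 = conway_fun x * (even_jump a x)^-1)%g.
Proof.
move=> c1 s2 st; have [s1|s1] := boolP (spi x.1 == 0); last first.
  by apply: conway_fun_jump => // y e _; rewrite /even_jump e.
have [i xi] := spi_eq0 (eqP s1); have i2 : (2 %| i)%Z.
  by move: c1; rewrite xi cpi_parity; case: ifP => //; rewrite eqxx.
apply: (conway_fun_wall xi st) => [|y yi y2]; first by rewrite i2.
by rewrite /even_jump -(side_sign yi y2) i2.
Qed.

Lemma conway_fun_odd x : cpi x.1 != 1 -> spi x.2 != 0 -> spi (transverse x) != 0 ->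
  \forall y \near x, (conway_fun y * (odd_jump b y)^-1 = conway_fun x * (odd_jump b x)^-1)%g.
Proof.
move=> c1 s2 st; have [s1|s1] := boolP (spi x.1 == 0); last first.
  by apply: conway_fun_jump => // y _ e; rewrite /odd_jump e.
have [i xi] := spi_eq0 (eqP s1); have i2 : (2 %| i)%Z = false.
  by move: c1; rewrite xi cpi_parity; case: ifP => //; rewrite eqxx.
apply: (conway_fun_wall xi st) => [|y yi y2]; first by rewrite i2.
by rewrite /odd_jump -(side_sign yi y2) i2.
Qed.

Definition knot_charts := descend r (conway_charts r a b conway_fun).

Lemma knot_charts_inv c : conway_charts r a b conway_fun c -> open c.1 /\ glue_invariant r c.
Proof. by apply: conway_inv; exact: conway_fun_orbit. Qed.

Lemma knot_charts_flat : flat_structure (~` two_bridge_knot R r) knot_charts.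
Proof.
apply: conway_flat.
- exact: conway_fun_orbit.
- exact: conway_fun_cell.
- exact: conway_fun_even.
- exact: conway_fun_odd.
Qed.

Variables (h g : int).
Hypothesis denqE : denq r = 2 * h + 1.
Hypothesis numqE : numq r = 2 * g.

(** An even translation takes [(1, 1/2)] to [(0, 1/2) + (denq r, numq r)], which lies in the same
    strip [h] as [(0, 1/2)]; the walls [1, ..., denq r] separate the two points. *)
Lemma conway_fun_base :
  ((conway_fun (0%R, 2^-1%R))^-1 * conway_fun (1%R, 2^-1%R) = word (crossing h) `|denq r|%N)%g.
Proof.
have p0 := denq_gt0 r.
have half (k : int) : floor (2^-1 + k%:~R : R) = k.
  by rewrite floor_shift (@floor_def _ _ 0) ?add0r //; apply/andP; split; lra.
have t0 : transverse (0, 2^-1) = 2^-1 + h%:~R.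
  by rewrite (transverse_right denqE) intrD intrM; field.
have f0 : floor (2^-1 : R) = 0 by have := half 0; rewrite addr0.
have -> : conway_fun (1, 2^-1) = conway_fun ((1, 2^-1) + double (h, g)).
  by rewrite conway_fun_shift.
have -> : (1, 2^-1) + double (h, g) = ((denq r)%:~R, 2^-1 + (numq r)%:~R) :> R * R.
  by rewrite doubleE denqE numqE; congr pair; rewrite /= ?intrD !intrM; ring.
have t1 : transverse ((denq r)%:~R, 2^-1 + (numq r)%:~R) = 2^-1 + h%:~R.
  by rewrite -t0 /transverse /=; ring.
rewrite /conway_fun t0 t1 /= !half f0 intrKfloor -[0]/(0%:~R) intrKfloor.
have -> : (2 %| numq r)%Z by rewrite numqE; lia.
rewrite dvdz0 /= !andbF -(strip_word (denq_gt0 r) bezout period) //.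
by congr (_ * strip _ _)%g; lia.
Qed.

End ConwayFunction.

(** * Words in the two meridians *)

Lemma divz_unique (x p k : int) : 0 < p -> p * k <= x -> x < p * (k + 1) -> (x %/ p)%Z = k.
Proof. by nia. Qed.

Lemma divz_bounds (x p : int) : 0 < p -> p * (x %/ p)%Z <= x < p * ((x %/ p)%Z + 1).
Proof. by nia. Qed.

Section Words.
Context {G : groupType} (a b : G).
Implicit Types (f : int -> G).
Local Notation letter := (letter a b).

Lemma word_periodic f (l n : nat) : (forall i, 0 < i -> f (l%:Z + i) = f i) ->
  word f (n * l) = (word f l ^+ n)%g.
Proof.
move=> fl; elim: n => [|n ih]; first by rewrite mul0n expg0.
rewrite mulSn word_cat expgS -ih; congr (_ * _)%g.
by apply: eq_word => i /andP[i0 _]; rewrite fl.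
Qed.

Lemma word_shift f n : (f 0 * word f n)%g = word (fun i => f (i - 1)) n.+1.
Proof.
rewrite -add1n word_cat /= mul1g; congr (f _ * _)%g.
by apply: eq_word => i _; congr f; lia.
Qed.

Lemma word_double f (u v : G) m :
  (forall i, 0 <= i < m%:Z -> f (2 * i + 1) = u /\ f (2 * i + 2) = v) ->
  word f (2 * m) = ((u * v) ^+ m)%g.
Proof.
elim: m => [|m ih] fuv; first by rewrite muln0 expg0.
rewrite mulnS addnC word_cat expgSr -ih => [|i im]; last by apply: fuv; lia.
have [|e1 e2] := fuv m%:Z; first by lia.
by rewrite /= mul1g -e1 -e2; congr (_ * (f _ * f _))%g; lia.
Qed.

Variables (m n : nat).
Hypotheses (m_gt0 : (0 < m)%N) (n_gt0 : (0 < n)%N).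
Let M := m%:Z.
Let N := n%:Z.

Lemma letterE (i k : int) (s t : bool) : (2 %| i)%Z = s -> (2 %| k)%Z = t ->
  letter i k = let g := if s then a else b in if t then g else g^-1%g.
Proof. by rewrite /letter => -> ->. Qed.

(** The quotient is constant on blocks of [2 m] walls, so signs alternate from block to block; [s]
    tells whether the word starts with [a] or with [b]. *)
Lemma word_blocks (s : bool) f :
  (forall i, 0 < i <= 4 * M * N -> f i = letter (if s then i + 1 else i) ((i - 1) %/ (2 * M))%Z) ->
  word f (4 * m * n) =
    ((if s then (a * b) ^+ m * (a^-1 * b^-1) ^+ m
      else (b * a) ^+ m * (b^-1 * a^-1) ^+ m) ^+ n)%g.
Proof.
move=> fE'; pose f' i := letter (if s then i + 1 else i) ((i - 1) %/ (2 * M))%Z.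
rewrite (@eq_word _ _ f') => [|i i0]; last by apply: fE'; lia.
have {fE'} fE i : 0 < i -> f' i = letter (if s then i + 1 else i) ((i - 1) %/ (2 * M))%Z by [].
have -> : (4 * m * n = n * (2 * m + 2 * m))%N by lia.
rewrite word_periodic => [|i i0]; last first.
  rewrite !fE; [|lia..].
  apply: letter_parity; first by case: (s); lia.
  rewrite (_ : (2 * m + 2 * m)%N%:Z + i - 1 = 2 * (2 * M) + (i - 1)); last by rewrite /M; lia.
  by rewrite divzMDl; lia.
congr (_ ^+ n)%g; rewrite word_cat.
have div0 (i : int) : 0 <= i < 2 * M -> (i %/ (2 * M))%Z = 0.
  by move=> im; apply: divz_unique; lia.
have div1 (i : int) : 0 <= i < 2 * M -> ((2 * M + i) %/ (2 * M))%Z = 1.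
  by move=> im; apply: divz_unique; lia.
clearbody f'; case: s f' fE => f' fE; congr (_ * _)%g; apply: word_double => i im; split; rewrite fE; try lia.
- by rewrite div0 ?(@letterE _ _ true true) //; lia.
- by rewrite div0 ?(@letterE _ _ false true) //; lia.
- rewrite (_ : _ - 1 = 2 * M + (2 * i)) ?div1 ?(@letterE _ _ true false) //; lia.
- rewrite (_ : _ - 1 = 2 * M + (2 * i + 1)) ?div1 ?(@letterE _ _ false false) //; lia.
- by rewrite div0 ?(@letterE _ _ false true) //; lia.
- by rewrite div0 ?(@letterE _ _ true true) //; lia.
- rewrite (_ : _ - 1 = 2 * M + (2 * i)) ?div1 ?(@letterE _ _ false false) //; lia.
- rewrite (_ : _ - 1 = 2 * M + (2 * i + 1)) ?div1 ?(@letterE _ _ true false) //; lia.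
Qed.

Lemma blocks_inv :
  ((((b * a) ^+ m * (b^-1 * a^-1) ^+ m) ^+ n)^-1 = ((a * b) ^+ m * (a^-1 * b^-1) ^+ m) ^+ n)%g.
Proof. by rewrite -expVgn invgM -!expVgn !invgM !invgK. Qed.

Local Notation crossing_plus := (crossing a b (4 * M * N + 1) (2 * N)).
Local Notation crossing_minus := (crossing a b (4 * M * N - 1) (2 * N)).

(** The slope is slightly below [1 / (2 M)], so each integer is reached one wall late, whence
    [i - 1]. The range exceeds [4 M N] by [M] in order to serve [base_plus] too. *)
Lemma div_plus (i : int) : 0 < i <= 4 * M * N + M ->
  ((2 * N * i) %/ (4 * M * N + 1))%Z = ((i - 1) %/ (2 * M))%Z.
Proof.
move=> /andP[i0 i1]; have /andP[k1 k2] := @divz_bounds (i - 1) (2 * M) ltac:(lia).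
set k := ((i - 1) %/ _)%Z in k1 k2 *.
have k0 : 0 <= k by nia.
have kn : k <= 2 * N by nia.
have h1 : N * (2 * M * k) <= N * (i - 1) by nia.
have h2 : N * i <= N * (2 * M * (k + 1)) by nia.
by apply: divz_unique; nia.
Qed.

(** The slope is slightly above [1 / (2 M)], but in this range the gain never amounts to a full
    step: blocks start exactly at multiples of [2 M]. *)
Lemma div_minus (i : int) : 0 <= i < 4 * M * N - 1 ->
  ((2 * N * i) %/ (4 * M * N - 1))%Z = (i %/ (2 * M))%Z.
Proof.
move=> /andP[i0 i1]; have /andP[k1 k2] := @divz_bounds i (2 * M) ltac:(lia).
set k := (i %/ _)%Z in k1 k2 *.
have k0 : 0 <= k by nia.
have kn : k < 2 * N by nia.
have h1 : N * (2 * M * k) <= N * i by nia.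
have [e|ne] := eqVneq (i + 1) (2 * M * (k + 1)).
  have kn1 : k + 1 < 2 * N by nia.
  by apply: divz_unique; nia.
have h2 : N * (i + 2) <= N * (2 * M * (k + 1)) by nia.
by apply: divz_unique; nia.
Qed.

(** The offset [2 M N - 1] is the index [h] of the strip containing the arc, for [denq r = 2 h + 1];
    it moves the block boundaries by half a block, whence [i + M]. *)
Lemma div_half_minus (i : int) : 0 <= i < 4 * M * N ->
  ((2 * N * i + (2 * M * N - 1)) %/ (4 * M * N - 1))%Z = ((i + M) %/ (2 * M))%Z.
Proof.
move=> /andP[i0 i1]; have /andP[k1 k2] := @divz_bounds (i + M) (2 * M) ltac:(lia).
set k := ((i + M) %/ _)%Z in k1 k2 *.
have k0 : 0 <= k by nia.
have kn : k <= 2 * N by nia.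
have h1 : N * (2 * M * k) <= N * (i + M) by nia.
have h2 : N * (i + M + 1) <= N * (2 * M * (k + 1)) by nia.
have [k00|kpos] := eqVneq k 0; first by rewrite k00 in k2 h1 h2 *; apply: divz_unique; nia.
have [kt|klt] := eqVneq k (2 * N); first by rewrite kt in k1 h1 h2 *; apply: divz_unique; nia.
by apply: divz_unique; nia.
Qed.

Let A := (4 * m * n)%N.

(** The half period [4 M N + 1] is odd and raises the quotient by the even number [2 N]: the second
    half repeats the first with [a] and [b] exchanged, and [blocks_inv] identifies the result with
    [w^-1]. *)
Lemma period_plus (w := (((b * a) ^+ m * (b^-1 * a^-1) ^+ m) ^+ n)%g) :
  word (crossing_plus 0) `|((4 * M * N + 1) + (4 * M * N + 1))%R|%N =
  (w * b * (w^-1 * a))%g.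
Proof.
have -> : `|((4 * M * N + 1) + (4 * M * N + 1))%R|%N = (A.+1 + A.+1)%N by rewrite /A; lia.
have p0 : 0 < 4 * M * N + 1 by lia.
have AE : A%:Z = 4 * M * N by rewrite /A; lia.
have shift (i : int) : ((2 * N * (A.+1%:Z + i) + 0) %/ (4 * M * N + 1))%Z = 2 * N + ((2 * N * i) %/ (4 * M * N + 1))%Z.
  rewrite -divzMDl; last by lia.
  by rewrite (_ : A.+1%:Z = 4 * M * N + 1); [congr divz; ring|lia].
have par (j k : int) : j = k -> (2 %| j)%Z = (2 %| k)%Z by move=> ->.
rewrite word_cat /= blocks_inv; congr (_ * _ * (_ * _))%g.
- apply: (word_blocks (s := false)) => i i0; rewrite /crossing addr0 div_plus //; lia.
- apply: (@letterE _ _ false true); first by rewrite /A; lia.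
  by rewrite addr0 (divz_unique (k := 2 * N)) //; lia.
- apply: (word_blocks (s := true)) => i i0; rewrite /crossing shift div_plus; last by lia.
  by apply: letter_parity; lia.
- apply: (@letterE _ _ true true); first by rewrite /A; lia.
  by rewrite shift (divz_unique (k := 2 * N)) //; lia.
Qed.

(** Conjugation by [a] shifts the word by one wall, aligning it with the blocks. Each half is then
    one letter short of complete blocks, which the factors [b] and [a] compensate. *)
Lemma period_minus (w := (((a * b) ^+ m * (a^-1 * b^-1) ^+ m) ^+ n)%g) :
  (a * word (crossing_minus 0) `|((4 * M * N - 1) + (4 * M * N - 1))%R|%N * a^-1 =
  w * b * (w^-1 * a))%g.
Proof.
have -> : `|((4 * M * N - 1) + (4 * M * N - 1))%R|%N = (A.-1 + A.-1)%N by rewrite /A; nia.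
have p0 : 0 < 4 * M * N - 1 by nia.
have A0 : (0 < A)%N by rewrite /A; nia.
have AE : A%:Z = 4 * M * N by rewrite /A; lia.
have A1E : A.-1%:Z = 4 * M * N - 1 by lia.
have shift (i : int) : ((2 * N * (A.-1%:Z + i) + 0) %/ (4 * M * N - 1))%Z = 2 * N + ((2 * N * i) %/ (4 * M * N - 1))%Z.
  rewrite -divzMDl; last by lia.
  by congr divz; rewrite A1E; ring.
have f0 : crossing_minus 0 0 = a by rewrite /crossing mulr0 add0r div0z.
have fp : crossing_minus 0 (A.-1 + A.-1)%N = a.
  apply: (@letterE _ _ true true); first by lia.
  rewrite PoszD A1E (_ : _ * _ + 0 = (4 * N) * (4 * M * N - 1)); last by ring.
  by rewrite mulzK; lia.
pose f i := crossing_minus 0 (i - 1).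
have -> : (a * word (crossing_minus 0) (A.-1 + A.-1) * a^-1 = word f (A.-1 + A.-1))%g.
  have := word_shift (crossing_minus 0) (A.-1 + A.-1); rewrite f0 => ->.
  rewrite /= (_ : (A.-1 + A.-1).+1%:Z - 1 = (A.-1 + A.-1)%N%:Z); last by rewrite intS addrC addKr.
  by rewrite fp mulgK.
have half (s : bool) f' : (forall i, 0 < i < 4 * M * N -> f' i = letter (if s then i + 1 else i) ((i - 1) %/ (2 * M))%Z) ->
    word f' A.-1 = ((if s then (a * b) ^+ m * (a^-1 * b^-1) ^+ m
      else (b * a) ^+ m * (b^-1 * a^-1) ^+ m) ^+ n * (if s then b else a))%g.
  move=> fE; pose f2 i := letter (if s then i + 1 else i) ((i - 1) %/ (2 * M))%Z.
  rewrite -(@word_blocks s f2) // -/A.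
  have -> : A = A.-1.+1 by rewrite prednK.
  have -> : word f' A.-1 = word f2 A.-1 by apply: eq_word => i i0; apply: fE; lia.
  rewrite /= -mulgA -[LHS]mulg1; congr (_ * _)%g; apply/esym.
  rewrite {1}/f2 (_ : _ - 1 = (2 * N - 1) * (2 * M) + (2 * M - 1)); last by lia.
  rewrite divzMDl; last by lia.
  rewrite (divz_unique (k := 0)); [|lia..].
  rewrite (@letterE _ _ (~~ s) false); [| by case: (s); lia | by lia].
  by case: s {f2 fE} => /=; rewrite mulVg.
rewrite word_cat (half true f) => [|i i0]; last first.
  by rewrite /f /crossing addr0 div_minus; [apply: letter_parity|]; lia.
rewrite (half false) => [|i i0]; last first.
  rewrite /f -addrA /crossing shift div_minus; last by lia.
  by apply: letter_parity; lia.
by rewrite /w -blocks_inv invgK.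
Qed.

Lemma base_plus : word (crossing_plus (2 * M * N)) `|(4 * M * N + 1)%R|%N =
  (word (fun i => letter i ((i - 1 + M) %/ (2 * M))%Z) A * b)%g.
Proof.
have -> : `|(4 * M * N + 1)%R|%N = A.+1 by rewrite /A; lia.
rewrite /=; congr (_ * _)%g.
  apply: eq_word => i i0; rewrite /crossing.
  have := @div_plus (i + M).
  rewrite (_ : 2 * N * (i + M) = 2 * N * i + 2 * M * N); last by ring.
  by move=> ->; [congr (letter _ (divz _ _)); ring|rewrite /A in i0; lia].
apply: (@letterE _ _ false true); first by rewrite /A; lia.
rewrite (divz_unique (k := 2 * N)) //; rewrite /A; nia.
Qed.

Lemma base_minus : (a * word (crossing_minus (2 * M * N - 1)) `|(4 * M * N - 1)%R|%N)%g =
  word (fun i => letter (i - 1) ((i - 1 + M) %/ (2 * M))%Z) A.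
Proof.
have A0 : (0 < A)%N by rewrite /A; nia.
have -> : `|(4 * M * N - 1)%R|%N = A.-1 by rewrite /A; nia.
have {1}<- : crossing_minus (2 * M * N - 1) 0 = a.
  apply: (@letterE _ _ true true) => //.
  by rewrite mulr0 add0r (divz_unique (k := 0)) //; nia.
rewrite word_shift prednK //; apply: eq_word => i i0.
by rewrite /crossing div_half_minus //; rewrite /A in i0; lia.
Qed.

End Words.

(** * The half-word as a conjugation *)

Section HalfWord.
Context {G : groupType} (Q c : G).
Local Open Scope group_scope.
Local Notation "z |^ x" := (conjg z x) (at level 39, left associativity).
Hypothesis c2 : forall z, z |^ c |^ c = z.
Local Notation letter := (letter (Q * c) (c * Q)).

(** Both generators become [spur (i - 1) * Q * spur i], so that consecutive letters of one sign
    telescope up to the central [c ^ 2]. *)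
Definition spur (i : int) : G := if (2 %| i)%Z then c else 1.

Lemma spurE (i j : int) : (2 %| i - j)%Z -> spur i = spur j.
Proof. by move=> ij; rewrite /spur; have -> : (2 %| i)%Z = (2 %| j)%Z by lia. Qed.

Lemma spurK (i : int) z : z |^ spur i |^ spur i = z.
Proof. by rewrite /spur; case: ifP => _; rewrite ?conjg1. Qed.

Lemma spur_next (i j : int) z : (2 %| i - j + 1)%Z -> z |^ spur i |^ spur j = z |^ c.
Proof.
move=> ij; rewrite /spur; have -> : (2 %| i)%Z = ~~ (2 %| j)%Z by lia.
by case: (2 %| j)%Z; rewrite /= conjg1.
Qed.

Lemma letter_spur (i k : int) : (2 %| k)%Z -> letter i k = spur (i - 1) * Q * spur i.
Proof.
move=> k2; rewrite /letter k2 /spur; have -> : (2 %| i - 1)%Z = ~~ (2 %| i)%Z by lia.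
by case: (2 %| i)%Z; rewrite /= ?mul1g ?mulg1.
Qed.

Lemma letter_spurV (i k : int) : ~~ (2 %| k)%Z -> letter i k = (spur (i - 1) * Q * spur i)^-1.
Proof. by move=> k2; rewrite -(@letter_spur i 0) // /letter (negbTE k2) dvdz0. Qed.

(** Stated for the action on an arbitrary [z] because the inner factors [spur i * spur i] act
    trivially by conjugation, although they need not be 1. *)
Lemma word_plus (s : int) f l : (forall i, 0 < i <= l%:Z -> exists2 k, (2 %| k)%Z & f i = letter (i + s) k) ->
  forall z, z |^ word f l = z |^ spur s |^ (Q ^+ l) |^ spur (s + l%:Z).
Proof.
elim: l => [|l ih] fE z; first by rewrite addr0 expg0 !conjg1 spurK.
rewrite /= conjgM ih => [|i i0]; last by apply: fE; lia.
have [|k k2 ->] := fE l.+1%:Z; first by lia.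
rewrite letter_spur // !conjgM (@spurE (l.+1%:Z + s - 1) (s + l%:Z)); last by lia.
by rewrite spurK expgSr conjgM (@spurE (l.+1%:Z + s) (s + l.+1%:Z)) //; lia.
Qed.

Lemma word_minus (s : int) f l : (forall i, 0 < i <= l%:Z -> exists2 k, ~~ (2 %| k)%Z & f i = letter (i + s) k) ->
  forall z, z |^ word f l = z |^ spur (s + 1) |^ (Q ^- l) |^ spur (s + 1 + l%:Z).
Proof.
have sV i z : z |^ (spur i)^-1 = z |^ spur i by rewrite -{1}(spurK i z) conjgK.
elim: l => [|l ih] fE z; first by rewrite addr0 expg0 invg1 !conjg1 spurK.
rewrite /= conjgM ih => [|i i0]; last by apply: fE; lia.
have [|k k2 ->] := fE l.+1%:Z; first by lia.
rewrite letter_spurV // !invgM !conjgM !sV.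
rewrite (@spurE (s + 1 + l%:Z) (l.+1%:Z + s)); last by lia.
rewrite spurK expgS invgM conjgM (@spurE (l.+1%:Z + s - 1) (s + 1 + l.+1%:Z)) //; lia.
Qed.

Variables (m n : nat).
Hypotheses (m_gt0 : (0 < m)%N).
Local Notation P := (Q ^+ m).

Lemma half_word (s : int) z :
  z |^ word (fun i => letter (i + s)%R ((i - 1 + m%:Z) %/ (2 * m%:Z))%Z) (4 * m * n) =
  z |^ (spur s * P^-1 * (P ^+ 2 * c * P ^- 2 * c^-1) ^+ n * P * spur s).
Proof.
set f := fun i : int => _.
have -> : (4 * m * n = n * (m + (2 * m + m)))%N by lia.
rewrite word_periodic => [|i i0]; last first.
  apply: letter_parity; first by lia.
  rewrite (_ : (_ - 1 + _ = 2 * (2 * m%:Z) + (i - 1 + m%:Z))%R); last by lia.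
  by rewrite divzMDl; lia.
have div (k i : int) : (k * (2 * m%:Z) <= i < (k + 1) * (2 * m%:Z))%R -> (i %/ (2 * m%:Z))%Z = k.
  by move=> im; apply: divz_unique; lia.
have cV y : y |^ c^-1 = y |^ c by rewrite -{1}(c2 y) conjgK.
have step y : y |^ word f (m + (2 * m + m)) = y |^ (spur s * P^-1 * (P ^+ 2 * c * P ^- 2 * c^-1) * P * spur s).
  rewrite word_cat conjgM word_cat conjgM (@word_plus s f m) => [|i i0]; last first.
    by exists 0; rewrite // /f (div 0) //; lia.
  rewrite (@word_minus (s + m%:Z)%R _ (2 * m)) => [|i i0]; last first.
    by exists 1%R; rewrite // /f (div 1%R) ?[(_ + i)%R]addrC ?addrA //; [congr letter; ring|lia].
  rewrite (@word_plus (s + m%:Z + (2 * m)%N%:Z)%R _ m) => [|i i0]; last first.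
    by exists 2; rewrite // /f (div 2) //; [congr letter; lia|lia].
  rewrite spur_next; last by lia.
  rewrite spur_next; last by lia.
  rewrite (@spurE (s + m%:Z + (2 * m)%N%:Z + m%:Z)%R s); last by lia.
  by rewrite !conjgM cV conjgKV mulnC expgnA.
elim: n z => [|k ih] z; first by rewrite !expg0 mulg1 mulgVK conjgM spurK conjg1.
rewrite [in LHS]expgSr [LHS]conjgM ih step [X in _ = z |^ (_ * X * _ * _)]expgSr.
by rewrite !conjgM spurK conjgK.
Qed.

End HalfWord.

(** * Representations along an arc *)

Record arc_representation {R : realType} {X : topologicalType} (K : set X) (h : X -> X)
    (tau : set X) {G : groupType} (A B D : G) (lam : R -> X) (th : X -> R)
    (E E' : R * R -> X) (C : set (set X * (X -> G)))
    (Cz : set (set X * (X -> Algebra.to_multiplicative int))) : Prop := ArcRepresentation {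
  arc_repr_arc : long_arc (K := K) h tau lam th E E';
  arc_repr_flat : flat_structure (~` K) C;
  arc_repr_flatz : flat_structure (~` K) Cz;
  arc_repr_right : forall v, 0 < v < 1 -> holonomy C (fun s => E (s, v)) = A;
  arc_repr_left : forall v, 0 < v < 1 -> holonomy C (fun s => E' (s, v)) = B;
  arc_repr_rightz : forall v, 0 < v < 1 -> `|holonomy Cz (fun s => E (s, v)) : int| = 1;
  arc_repr_leftz : forall v, 0 < v < 1 -> `|holonomy Cz (fun s => E' (s, v)) : int| = 1;
  arc_repr_mid : forall u v, 0 < u < 1 -> 0 < v < 1 ->
    holonomy C (fun s => lam ((1 - s) * (1 - u) + s * (v - 1))) = D }.

(** All nonzero exponents are included because the given meridian loops are determined only up to
    such powers. *)
Definition free_meridians {G : groupType} (A B D : G) : Prop :=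
  forall (i j : bool) (k l : nat), free_pair ((if i then A^-1 else A) ^+ k.+1)%g
    (D * (if j then B^-1 else B) ^+ l.+1 * D^-1)%g.

Lemma arc_representation_free {R : realType} {X : topologicalType} (K : set X) h tau
    {G : groupType} (A B D : G) (lam : R -> X) th E E' C Cz (b : ~` K) (x y : pi1 R b) :
  arc_representation K h tau A B D lam th E E' C Cz -> free_meridians A B D ->
  long_meridian_pair h tau x y -> free_pair x y.
Proof.
move=> [arc KC KCz hA hB hZ hZ' hD] ABD xy.
have [g [i [j [k [l]]]]] := long_arc_holonomy KC KCz arc hA hB hZ hZ' hD xy.
move=> h1; have /(free_pair_conj g) := ABD i j k l.
set u := (if i then _ else _); set w := (if j then _ else _) => f1.
have f2 : free_pair (g * u ^+ k.+1 * g^-1)%g (g * D * w ^+ l.+1 * (g * D)^-1)%g.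
  by move: f1; rewrite invgM !mulgA.
apply: (free_pair_morph (pi1_holonomyM KC (b := b))).
case: h1 => -[-> ->]; first exact: f2.
exact: free_pair_sym.
Qed.

(** * Transport of representations along a homeomorphism *)

Section Transport.
Context {R : realType} {X Y : topologicalType} (F : Y -> X) (F' : X -> Y).
Hypotheses (cF : continuous F) (cF' : continuous F').
Hypotheses (FK : cancel F F') (FK' : cancel F' F).

Lemma arc_representation_transport (K : set X) h tau {G : groupType} (A B D : G)
    (lam : R -> X) th E E' C Cz :
  arc_representation K h tau A B D lam th E E' C Cz ->
  arc_representation (F @^-1` K) (F' \o h \o F) (F @^-1` tau) A B D
    (F' \o lam) (th \o F) (F' \o E) (F' \o E')
    [set (F @^-1` c.1, c.2 \o F) | c in C] [set (F @^-1` c.1, c.2 \o F) | c in Cz].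
Proof.
move=> [[cl cth lK fixE ltau lnK er el] KC KCz hA hB hZ hZ' hD].
have pull (H : groupType) (c : set (set X * (X -> H))) (f : R -> X) :
    flat_structure (~` K) c -> continuous f -> (forall s, I01 s -> ~ K (f s)) ->
    holonomy [set (F @^-1` d.1, d.2 \o F) | d in c] (F' \o f) = holonomy c f.
  move=> Kc cf fO; rewrite (holonomy_pullback cF Kc).
    by congr holonomy; apply/funext => s /=; rewrite FK'.
  by split; [exact: (continuous_compose cf cF')|move=> s sI /=; rewrite FK'; exact: fO].
have ends (mu : R -> X) e : arc_end K mu e -> arc_end (F @^-1` K) (F' \o mu) (F' \o e).
  move=> [ce eK e0 eloop eO]; split.
  - exact: (continuous_compose ce cF').
  - by rewrite /= FK'.
  - by move=> s sI /=; rewrite e0.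
  - by move=> v v01 /=; have [-> ->] := eloop v v01.
  - by move=> s v sI v01; rewrite /= FK'; exact: eO.
have cend (mu : R -> X) e v : arc_end K mu e -> continuous (fun s => e (s, v)).
  by move=> [ce _ _ _ _]; apply: (continuous_compose _ ce); cont.
have nend (mu : R -> X) e v : arc_end K mu e -> 0 < v < 1 ->
    forall s, I01 s -> ~ K (e (s, v)).
  by move=> [_ _ _ _ eO] v01 s sI; exact: eO.
split.
- split.
  + exact: (continuous_compose cl cF').
  + exact: (continuous_compose cF cth).
  + by move=> s s11 /=; rewrite FK' lK.
  + apply/seteqP; split=> [z|z].
    * rewrite /fixed_set /= => hz; have : fixed_set h (F z) by rewrite /fixed_set /= -{2}hz FK'.
      rewrite fixE => -[tz|[s s11 e]]; [by left|right; exists s => //=].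
      by rewrite e FK.
    * have hF t : fixed_set h t -> fixed_set (F' \o h \o F) (F' t).
        by rewrite /fixed_set /= FK' => ->.
      rewrite -{2}(FK z); move=> zT; apply: hF; rewrite fixE.
      by case: zT => [|[s s11 <-]]; [left|right; exists s => //=; rewrite FK'].
  + by move=> s s11 /=; rewrite FK'; exact: ltau.
  + by move=> s s11 /=; rewrite FK'; exact: lnK.
  + exact: (ends lam E er).
  + exact: (ends (fun s => lam (- s)) E' el).
- exact: (flat_structure_pullback cF KC).
- exact: (flat_structure_pullback cF KCz).
- move=> v v01; rewrite -(hA v v01).
  exact: (pull G C (fun s => E (s, v)) KC (cend _ _ v er) (nend _ _ v er v01)).
- move=> v v01; rewrite -(hB v v01).
  exact: (pull G C (fun s => E' (s, v)) KC (cend _ _ v el) (nend _ _ v el v01)).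
- move=> v v01; rewrite -(hZ v v01); congr `|_ : int|.
  exact: (pull _ Cz (fun s => E (s, v)) KCz (cend _ _ v er) (nend _ _ v er v01)).
- move=> v v01; rewrite -(hZ' v v01); congr `|_ : int|.
  exact: (pull _ Cz (fun s => E' (s, v)) KCz (cend _ _ v el) (nend _ _ v el v01)).
- move=> u v u01 v01; rewrite -(hD u v u01 v01).
  apply: (pull G C (fun s => lam _) KC).
    by apply: (continuous_compose _ cl); cont.
  by move=> s; rewrite /I01 => sI; apply: lnK; nra.
Qed.

End Transport.

(** With [a] of exponent 1 and [b] of exponent -1 the charts give the structure counting turns
    around the knot; the relation holds since the two cancel. *)
Definition exponent (k : int) : Algebra.to_multiplicative int := k.

Section UpperRepresentation.
Context {R : realType} (r : rat) (h g k1 k2 : int).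
Hypothesis denqE : denq r = 2 * h + 1.
Hypothesis numqE : numq r = 2 * g.
Hypothesis bezout : denq r * k2 - numq r * k1 = 1.

Lemma upper_representation {G : groupType} (a b : G) :
  word (crossing a b (denq r) (numq r) 0) `|(denq r + denq r)%R|%N = 1%g ->
  word (crossing (exponent 1) (exponent (-1)) (denq r) (numq r) 0)
    `|(denq r + denq r)%R|%N = 1%g ->
  arc_representation (two_bridge_knot R r) (@upper_inversion R r) (@upper_tunnel R r)
    a b (word (crossing a b (denq r) (numq r) h) `|denq r|%N)
    (upper_arc r) (@upper_coord R r) (upper_right_end r) (upper_left_end r)
    (@knot_charts R r G a b k1)
    (@knot_charts R r _ (exponent 1) (exponent (-1)) k1).
Proof.
move=> per perz.
have KC := knot_charts_flat (R := R) bezout per.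
have KCz := knot_charts_flat (R := R) bezout perz.
have inv := knot_charts_inv (R := R) (a := a) (b := b) bezout.
have invz := knot_charts_inv (R := R) (a := exponent 1) (b := exponent (-1)) bezout.
split.
- exact: upper_long_arc denqE numqE.
- exact: KC.
- exact: KCz.
- by move=> v v01; exact: (holonomy_right numqE KC inv v01).
- by move=> v v01; exact: (holonomy_left KC inv v01).
- by move=> v v01; rewrite (holonomy_right numqE KCz invz v01) normr1.
- by move=> v v01; rewrite (holonomy_left KCz invz v01) normrN1.
- move=> u v u01 v01; rewrite (holonomy_arc denqE numqE KC inv u01 v01).
  exact: (conway_fun_base bezout per denqE numqE).
Qed.

End UpperRepresentation.

(* The two meridian generators are taken of the form [a = Q c], [b = c Q] with [c ^ 2]
   a central involution: then a block of [m] positive (or negative) letters is, up to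
   the center, [Q ^ m] (or [Q ^- m]) between two powers of [c], and the relation of
   the knot becomes [(Z ^- n Q) ^ 2 = c ^ 2] or [(Z ^ n Q) ^ 2 = c ^ 2]. *)
Section BlockRelations.
Context {G : groupType} (Q c e : G).
Local Open Scope group_scope.
Hypotheses (cc : c * c = e) (ee : e * e = 1) (eC : forall z, e * z = z * e).
Variables (m n : nat).
Hypotheses (m_gt0 : (0 < m)%N) (n_gt0 : (0 < n)%N).
Let a := Q * c.
Let b := c * Q.
Local Notation P := (Q ^+ m).
Local Notation Z := (P ^+ 2 * c * P ^- 2 * c^-1).

Lemma c_inv : c^-1 = c * e.
Proof. by apply: (mulgI c); rewrite mulgV mulgA cc ee. Qed.

Lemma conj_e z : z ^ e = z.
Proof. by rewrite conjgE -eC mulKg. Qed.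

Lemma inner_inv (u v : G) : (forall z, z ^ u = z ^ v) -> forall z, z ^ u^-1 = z ^ v^-1.
Proof. by move=> uv z; rewrite -{1}(conjgKV v z) -uv conjgK. Qed.

Lemma blocks_eval : ((a * b) ^+ m * (a^-1 * b^-1) ^+ m) ^+ n = Z ^+ n.
Proof.
congr (_ ^+ n).
have -> : a * b = Q ^+ 2 * e by rewrite /a /b mulgA -(mulgA Q c) cc -mulgA eC mulgA -expg2.
have -> : a^-1 * b^-1 = (Q ^- 2) ^ c^-1 * e.
  rewrite /a /b (invgM Q) (invgM c) conjgE invgK {1}c_inv.
  by rewrite -!mulgA; congr (c * _); rewrite eC !mulgA -(invgM Q Q).
have ce (z : G) : commute z e by rewrite /commute eC.
set X := (Q ^- 2) ^ c^-1.
rewrite (@expgMn _ (Q ^+ 2) e m (ce _)) (@expgMn _ X e m (ce _)).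
rewrite (commuteX m (ce (X ^+ m))) mulgA -(mulgA _ (e ^+ m) (e ^+ m)) -expgMn; last first.
  exact: commute_refl.
rewrite ee expg1n mulg1 -conjXg conjgE invgK expVgn [(Q ^+ 2) ^+ m]expgnAC.
by rewrite !mulgA.
Qed.

(** Here [c^-1 = c e] with [e] central, so conjugation by [c] reverses the commutator. This symmetry
    turns the relation of the knot into a condition on a square. *)
Lemma commutator_conj u : (u * c * u^-1 * c^-1) ^ c = (u * c * u^-1 * c^-1)^-1.
Proof.
rewrite conjgE mulgVK !invgM !invgK c_inv -!mulgA; congr (c * _).
by rewrite eC [e * u^-1]eC !mulgA.
Qed.

Lemma Z_conj : Z ^ c = Z^-1.
Proof. exact: commutator_conj. Qed.

Lemma Zn_c : Z ^+ n * c = c * Z ^- n.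
Proof.
have <- : (Z ^+ n) ^ c = Z ^- n by rewrite conjXg Z_conj expVgn.
by rewrite conjgE mulVKg.
Qed.

Lemma relation_minus : (Z ^- n * Q) ^+ 2 = e -> Z ^+ n * b * (Z ^- n * a) = 1.
Proof.
move=> h; have -> : Z ^+ n * b * (Z ^- n * a) = c * (Z ^- n * Q) ^+ 2 * c.
  by rewrite /a /b expg2 !mulgA Zn_c ?mulgA.
by rewrite h -eC -mulgA cc ee.
Qed.

Lemma relation_plus : (Z ^+ n * Q) ^+ 2 = e -> Z ^- n * b * (Z ^+ n * a) = 1.
Proof.
move=> h; rewrite /a /b.
have Zc : Z ^- n * c = c * Z ^+ n.
  by apply: (mulgI (Z ^+ n)); rewrite mulVKg mulgA Zn_c mulgVK.
have -> : Z ^- n * (c * Q) * (Z ^+ n * (Q * c)) = c * (Z ^+ n * Q) ^+ 2 * c.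
  by rewrite expg2 !mulgA Zc ?mulgA.
by rewrite h -eC -mulgA cc ee.
Qed.

(** Conjugating the two meridians by [g] and by [k] replaces [D] by [g D k^-1]; this is required
    only up to the center, that is, on conjugations. *)
Lemma free_meridians_conj (A B D A' B' D' g k : G) : free_meridians A B D ->
  A' = A ^ g^-1 -> B' = B ^ k^-1 -> (forall z, z ^ (D' * k)^-1 = z ^ (g * D)^-1) ->
  free_meridians A' B' D'.
Proof.
move=> fAB -> -> DD i j k1 l; have := free_pair_conj g (fAB i j k1 l).
set u := (if i then A^-1 else A); set w := (if j then B^-1 else B).
have -> : (if i then (A ^ g^-1)^-1 else A ^ g^-1) = u ^ g^-1.
  by rewrite /u; case: i {u}; rewrite ?conjVg.
have -> : (if j then (B ^ k^-1)^-1 else B ^ k^-1) = w ^ k^-1.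
  by rewrite /w; case: j {w}; rewrite ?conjVg.
have -> : D' * (w ^ k^-1) ^+ l.+1 * D'^-1 = (w ^+ l.+1) ^ (D' * k)^-1.
  by rewrite -conjXg !conjgE !invgK invgM !mulgA.
by rewrite DD -conjXg !conjgE !invgK invgM !mulgA.
Qed.

Lemma half_conj (s : int) z : let W :=
  word (fun i => letter a b (i + s)%R ((i - 1 + m%:Z) %/ (2 * m%:Z))%Z) (4 * m * n) in
  z ^ W^-1 = z ^ (spur c s * P^-1 * Z ^+ n * P * spur c s)^-1.
Proof.
apply: inner_inv => {}z; apply: half_word => // {}z.
by rewrite -conjgM cc conj_e.
Qed.

Local Notation M := (m%:Z).
Local Notation K := (n%:Z).

Lemma minus_period : (Z ^- n * Q) ^+ 2 = e ->
  word (crossing a b (4 * M * K - 1)%R (2 * K)%R 0)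
    `|((4 * M * K - 1) + (4 * M * K - 1))%R|%N = 1.
Proof.
move=> h; have := period_minus a b m_gt0 n_gt0; rewrite /= blocks_eval => aw.
rewrite relation_minus // in aw.
 by apply: (mulgI a); apply: (mulIg a^-1); rewrite aw mulg1 mulgV.
Qed.

Lemma plus_period : (Z ^+ n * Q) ^+ 2 = e ->
  word (crossing a b (4 * M * K + 1)%R (2 * K)%R 0)
    `|((4 * M * K + 1) + (4 * M * K + 1))%R|%N = 1.
Proof.
move=> h; have := period_plus a b m_gt0 n_gt0; rewrite /= => ->; rewrite blocks_inv blocks_eval.
have -> : ((b * a) ^+ m * (b^-1 * a^-1) ^+ m) ^+ n = Z ^- n.
  by rewrite -[LHS]invgK blocks_inv blocks_eval.
exact: relation_plus.
Qed.

(** [a = Q b Q^-1] allows [a] to be replaced by [b], and the [a^-1] in the conjugator supplies the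
    first letter missing from the half-word in [base_minus]. *)
Lemma minus_free : free_meridians b b (P^-1 * Q^-1 * Z ^+ n * P) ->
  free_meridians a b
    (word (crossing a b (4 * M * K - 1)%R (2 * K)%R (2 * M * K - 1)%R) `|(4 * M * K - 1)%R|%N).
Proof.
set D := word _ _ => fb; apply: (free_meridians_conj (g := a^-1 * Q) (k := 1) fb).
- have bQ : Q * b = a * Q by rewrite /a /b mulgA.
  rewrite (invgM a^-1) invgK conjgM [b ^ _]conjgE invgK mulgA bQ mulgK.
  by rewrite conjgE mulKg.
- by rewrite invg1 conjg1.
move=> z; pose W := word (fun i => letter a b (i + -1)%R ((i - 1 + M) %/ (2 * M))%Z) (4 * m * n).
have DE : D = a^-1 * W by rewrite -[W](base_minus a b m_gt0 n_gt0) mulKg.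
have VE : Q * (P^-1 * Q^-1 * Z ^+ n * P) = spur c (-1) * P^-1 * Z ^+ n * P * spur c (-1).
  have cPQ : Q * P^-1 = P^-1 * Q.
    exact: (commuteV (commuteX m (commute_refl Q))).
  by rewrite /spur /= mul1g mulg1 !mulgA cPQ mulgK.
rewrite mulg1 DE -mulgA VE !(invgM a^-1) !conjgM; congr (_ ^ _).
exact: (half_conj (-1)%R z).
Qed.

(** [b = c a c^-1] allows [b] to be replaced by [a]; the [b^-1] in [k] cancels the last letter of
    the half-word, and the [a^-1] in [g] cancels the factor [Q]. *)
Lemma plus_free : free_meridians a a (P^-1 * Q * Z ^+ n * P) ->
  free_meridians a b
    (word (crossing a b (4 * M * K + 1)%R (2 * K)%R (2 * M * K)%R) `|(4 * M * K + 1)%R|%N).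
Proof.
set D := word _ _ => fa; apply: (free_meridians_conj (g := a^-1) (k := b^-1 * c) fa).
- by rewrite invgK conjgE mulKg.
- have ca : c * a = b * c by rewrite /a /b mulgA.
  rewrite (invgM b^-1) invgK conjgM [a ^ _]conjgE invgK mulgA ca mulgK.
  by rewrite conjgE mulKg.
move=> z; pose W := word (fun i => letter a b (i + 0)%R ((i - 1 + M) %/ (2 * M))%Z) (4 * m * n).
have DE : D = W * b.
  rewrite /D base_plus //; congr (_ * _); apply: eq_word => i _.
  by rewrite addr0.
have VE : a^-1 * (P^-1 * Q * Z ^+ n * P) = c^-1 * (P^-1 * Z ^+ n * P).
  have cPQ : P^-1 * Q = Q * P^-1.
    by apply/esym; exact: (commuteV (commuteX m (commute_refl Q))).
  by rewrite cPQ /a invgM -!mulgA mulKg.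
have -> : D * (b^-1 * c) = W * c by rewrite DE mulgA mulgK.
rewrite VE (invgM W) conjgM (half_conj 0%R (z ^ c^-1)).
rewrite -conjgM -(invgM _ c) /spur /=; congr (z ^ _^-1).
have -> : c * P^-1 * Z ^+ n * P * c * c = c * (P^-1 * Z ^+ n * P) * (c * c).
  by rewrite !mulgA.
by move: (P^-1 * _ * P) => T; rewrite cc c_inv -eC mulgA eC.
Qed.

End BlockRelations.

(** * Ping-pong in GL(2) *)

Section GL2.
Context {R : realType}.

Record gl2 : Type := Gl2 {
  g11 : R; g12 : R; g21 : R; g22 : R;
  gl2_det : g11 * g22 - g12 * g21 != 0 }.

HB.instance Definition _ := gen_eqMixin gl2.
HB.instance Definition _ := gen_choiceMixin gl2.

Lemma gl2_eq (g h : gl2) :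
  [/\ g11 g = g11 h, g12 g = g12 h, g21 g = g21 h & g22 g = g22 h] -> g = h.
Proof.
case: g h => [a b c d p] [a' b' c' d' p'] /= [e1 e2 e3 e4]; subst.
by congr Gl2; exact: eq_irrelevance.
Qed.

Definition det2 (g : gl2) := g11 g * g22 g - g12 g * g21 g.
Definition tr2 (g : gl2) := g11 g + g22 g.

Lemma det2_neq0 g : det2 g != 0. Proof. exact: gl2_det. Qed.

Fact gl2_one_det : 1 * 1 - 0 * 0 != 0 :> R.
Proof. by rewrite mulr1 mulr0 subr0 oner_neq0. Qed.
Definition gl2_one := Gl2 gl2_one_det.

Fact gl2_mul_det (g h : gl2) :
  (g11 g * g11 h + g12 g * g21 h) * (g21 g * g12 h + g22 g * g22 h) -
  (g11 g * g12 h + g12 g * g22 h) * (g21 g * g11 h + g22 g * g21 h) != 0.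
Proof.
rewrite (_ : _ - _ = det2 g * det2 h); last by rewrite /det2; ring.
by rewrite mulf_neq0 ?det2_neq0.
Qed.
Definition gl2_mul g h := Gl2 (gl2_mul_det g h).

Fact gl2_inv_det (g : gl2) :
  g22 g / det2 g * (g11 g / det2 g) - - g12 g / det2 g * (- g21 g / det2 g) != 0.
Proof.
rewrite (_ : _ - _ = (det2 g)^-1); first by rewrite invr_eq0 det2_neq0.
by have := det2_neq0 g; rewrite /det2 => d0; field.
Qed.
Definition gl2_inv g := Gl2 (gl2_inv_det g).

Fact gl2_mulA : associative gl2_mul.
Proof. by move=> g h k; apply: gl2_eq; split=> /=; ring. Qed.
Fact gl2_mul1 : left_id gl2_one gl2_mul.
Proof. by move=> g; apply: gl2_eq; split=> /=; ring. Qed.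
Fact gl2_1mul : right_id gl2_one gl2_mul.
Proof. by move=> g; apply: gl2_eq; split=> /=; ring. Qed.
Fact gl2_mulV : left_inverse gl2_one gl2_inv gl2_mul.
Proof.
move=> g; have := det2_neq0 g; rewrite /det2 => d0.
by apply: gl2_eq; split=> /=; rewrite /det2; field.
Qed.
Fact gl2_Vmul : right_inverse gl2_one gl2_inv gl2_mul.
Proof.
move=> g; have := det2_neq0 g; rewrite /det2 => d0.
by apply: gl2_eq; split=> /=; rewrite /det2; field.
Qed.

HB.instance Definition _ := isGroup.Build gl2
  gl2_mulA gl2_mul1 gl2_1mul gl2_mulV gl2_Vmul.

Implicit Types (g h : gl2) (v : R * R).

Definition act2 g v : R * R := (g11 g * v.1 + g12 g * v.2, g21 g * v.1 + g22 g * v.2).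

Lemma act2_1 v : act2 1%g v = v.
Proof. by rewrite [RHS]surjective_pairing /act2 /=; congr pair; ring. Qed.

Lemma act2M g h v : act2 (g * h)%g v = act2 g (act2 h v).
Proof. by rewrite /act2 /=; congr pair; ring. Qed.

(** [cone false] surrounds the first axis and [cone true] the second, with aperture [1 / 4]. Both
    are stable under nonzero scalars, so they represent intervals of the projective line. *)
Definition cone (s : bool) : set (R * R) :=
  [set v | if s then 4 * `|v.1| < `|v.2| else 4 * `|v.2| < `|v.1|].

Lemma act2_neq0 g v : v != 0 -> act2 g v != 0.
Proof.
apply: contra => /eqP gv; rewrite -(act2_1 v) -(mulVg g) act2M gv.
by rewrite /act2 /= !mulr0 addr0.
Qed.

(** The matrix with diagonal entries [l], [1 / l] divides slopes by [l ^ 2 > 16], so slopes at most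
    4 become less than [1 / 4]. *)
Lemma cone_ping_pong g : g12 g = 0 -> g21 g = 0 -> det2 g = 1 -> 4 < `|g11 g| ->
  ping_pong act2 [set v | v != 0] cone g.
Proof.
move=> e12 e21; rewrite /det2 e12 mul0r subr0 => e1 l4.
have key (l m : R) p q : l * m = 1 -> 4 < `|l| -> (p, q) != 0 -> `|q| <= 4 * `|p| ->
    4 * `|m * q| < `|l * p|.
  move=> lm l4' pq0 qp; rewrite !normrM.
  have lm' : `|l| * `|m| = 1 by rewrite -normrM lm normr1.
  have p0 : 0 < `|p|.
    rewrite normr_gt0; apply: contra pq0 => /eqP p0; move: qp.
    by rewrite p0 normr0 mulr0 normr_le0 => /eqP ->.
  have m0 : 0 < `|m|.
    rewrite normr_gt0; apply/eqP => m0; move: lm; rewrite m0 mulr0 => /esym/eqP.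
    by rewrite oner_eq0.
  have m1 : 4 * `|m| < 1 by have := ltr_pM2r m0 4 `|l|; rewrite l4' lm'.
  have := ler_wpM2l (ltW m0) qp; have := ltr_pM2r p0 (4 * `|m|) 1; rewrite m1.
  by have := ltr_pM2r p0 4 `|l|; rewrite l4'; lra.
split.
- case; first by exists (0, 1); rewrite /cone /= normr0 normr1 mulr0 ltr01.
  by exists (1, 0); rewrite /cone /= normr0 normr1 mulr0 ltr01.
- by case=> v; rewrite /cone /=; apply: contraTneq => -> /=; rewrite normr0 mulr0 ltxx.
- apply/seteqP; split=> // v []; rewrite /cone /= => h1 h2.
  by have := normr_ge0 v.1; rewrite leNgt => /negP; apply; lra.
- case=> -[p q] /= pq0; rewrite /cone /= => /negP; rewrite -leNgt => qp.
    rewrite /act2 /= /det2 e12 e21 !mul0r subr0 e1 !divr1 oppr0 !mul0r add0r addr0.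
    apply: key => //; move: pq0; apply: contra => /eqP[-> ->].
    by apply/eqP.
  rewrite /act2 /= e12 e21 !mul0r add0r addr0.
  exact: key.
Qed.

Lemma conj_ping_pong g e (S : bool -> set (R * R)) : ping_pong act2 [set v | v != 0] S g ->
  ping_pong act2 [set v | v != 0] (fun s => [set v | S s (act2 e^-1%g v)]) (e * g * e^-1)%g.
Proof.
move=> [Sn SD S0 Sg]; split.
- move=> s; have [v Sv] := Sn s; exists (act2 e v) => /=.
  by rewrite -act2M mulVg act2_1.
- move=> s v /= /SD /= h; apply: contraNneq h => ->.
  by rewrite /act2 /= !mulr0 addr0.
- apply/seteqP; split=> // v [/= h1 h2].
  by suff : (S true `&` S false) (act2 e^-1%g v) by rewrite S0.
- move=> s v /= v0 Sv; have := Sg s _ (act2_neq0 e^-1%g v0) Sv.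
  rewrite -!act2M; congr (S s (act2 _ v)); case: s {Sv}.
    by rewrite !invgM !mulgA invgK mulVg mul1g.
  by rewrite !mulgA mulVg mul1g.
Qed.

(** By Cayley-Hamilton [e ^ 2 = - det e], so [e^-1] is [e] up to sign. *)
Lemma traceless_inv e : tr2 e = 0 -> det2 e ^+ 2 = 1 ->
  exists2 u, `|u| = 1 & forall v, act2 e^-1%g v = (u * (act2 e v).1, u * (act2 e v).2).
Proof.
move=> t0 d2; exists (- (det2 e)^-1).
  have := normrX 2 (det2 e); rewrite d2 normr1 => /esym/eqP.
  rewrite sqrf_eq1 => /orP[/eqP d1|/eqP d1]; rewrite normrN normfV d1 ?invr1 //.
  by have := normr_ge0 (det2 e); rewrite d1 ler0N1.
have e22 : g22 e = - g11 e by move: t0; rewrite /tr2; lra.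
by move=> v; rewrite /act2 /= e22; congr pair; ring.
Qed.

(** With [A] and [B] the absolute values of the diagonal and off-diagonal entries, the hypotheses
    give [2/3 <= B / A <= 5/4]. So the axes are sent to lines of slopes [B / A] and [A / B] up to
    sign, and a deviation of [1/4] in the argument keeps the image slope strictly between [1/4] and
    4 in absolute value. *)
Lemma cone_disjoint e : tr2 e = 0 -> det2 e ^+ 2 = 1 -> `|g12 e| = `|g21 e| ->
  2 <= g11 e ^+ 2 -> forall s t v, cone s v -> ~ cone t (act2 e^-1%g v).
Proof.
move=> t0 d2 bc a2 s t v sv; have [u u1 ->] := traceless_inv t0 d2.
rewrite /cone /= !normrM u1 !mul1r.
have e22 : g22 e = - g11 e by move: t0; rewrite /tr2; lra.
move: d2 bc a2; rewrite /det2 /act2 /= e22.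
move: (g11 e) (g12 e) (g21 e) => a b c.
case: v sv => p q /=; rewrite /cone /= => sv d2 bc a2.
pose A := `|a|; pose B := `|b|.
have A0 : 0 <= A by exact: normr_ge0.
have B0 : 0 <= B by exact: normr_ge0.
have A2 : A ^+ 2 = a ^+ 2 by rewrite /A real_normK ?num_real.
(* The product [b c] cannot be positive: [a ^ 2 + b c], minus the determinant, would be at least 2,
   whereas its square is 1. *)
have B2 : B ^+ 2 = - (b * c).
  have bc2 : (b * c) ^+ 2 = (B ^+ 2) ^+ 2.
    by rewrite exprMn -(real_normK (num_real b)) -(real_normK (num_real c)) -bc -expr2.
  have := bc2; rewrite -[RHS]sqrrN => /eqP; rewrite eqf_sqr opprK => /orP[|] /eqP e1; first by lra.
  have h2 : 2 <= a ^+ 2 + b * c by rewrite e1; have := sqr_ge0 B; lra.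
  have h4 : 2 * 2 <= (a ^+ 2 + b * c) ^+ 2 by rewrite expr2 ler_pM.
  have h5 : (a ^+ 2 + b * c) ^+ 2 = 1 by rewrite -d2; ring.
  by rewrite h5 in h4; lra.
have h1 : A ^+ 2 - 1 <= B ^+ 2 <= A ^+ 2 + 1.
  rewrite B2 A2; have : (a ^+ 2 + b * c) ^+ 2 = 1 by rewrite -d2; ring.
  move=> /eqP; rewrite sqrf_eq1 => /orP[|] /eqP e1; apply/andP; split; lra.
rewrite -A2 in a2.
have BA : 2 * A <= 3 * B by rewrite -ler_sqr ?nnegrE ?mulr_ge0 //; nra.
have AB : 4 * B <= 5 * A by rewrite -ler_sqr ?nnegrE ?mulr_ge0 //; nra.
have Ap : 0 < A by nra.
have n1 (x y : R) : `|x| <= `|x + y| + `|y| by rewrite -{1}(addrK y x); exact: ler_normB.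
have t1 : `|a * p + b * q| <= A * `|p| + B * `|q| by rewrite -!normrM ler_normD.
have t2 : `|c * p + - a * q| <= B * `|p| + A * `|q|.
  by rewrite /B bc -!normrM mulNr ler_normB.
have t3 : A * `|p| <= `|a * p + b * q| + B * `|q| by rewrite -!normrM n1.
have t4 : B * `|q| <= `|a * p + b * q| + A * `|p|.
  by rewrite -!normrM addrC [a * p + _]addrC addrC n1.
have t5 : B * `|p| <= `|c * p + - a * q| + A * `|q|.
  by rewrite /B bc -!normrM -[`|a * q|]normrN -mulNr n1.
have t6 : A * `|q| <= `|c * p + - a * q| + B * `|p|.
  by rewrite /B bc -!normrM -[`|a * q|]normrN -mulNr [c * p + _]addrC n1.
have p0 := normr_ge0 p; have q0 := normr_ge0 q.
have m1 : 2 * (A * `|p|) <= 3 * (B * `|p|) by rewrite !mulrA ler_wpM2r.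
have m2 : 2 * (A * `|q|) <= 3 * (B * `|q|) by rewrite !mulrA ler_wpM2r.
have m3 : 4 * (B * `|p|) <= 5 * (A * `|p|) by rewrite !mulrA ler_wpM2r.
have m4 : 4 * (B * `|q|) <= 5 * (A * `|q|) by rewrite !mulrA ler_wpM2r.
move: t1 t2 t3 t4 t5 t6; set X := `|a * p + _|; set Y := `|c * p + _| => t1 t2 t3 t4 t5 t6.
case: s sv => sv.
  have s1 : 4 * (A * `|p|) < A * `|q| by rewrite mulrCA ltr_pM2l.
  have s2 : 4 * (B * `|p|) <= B * `|q| by rewrite mulrCA ler_wpM2l // ltW.
  by case: t => h; have := h; rewrite ltNge => /negP; apply;
    move: t1 t2 t3 t4 t5 t6 m1 m2 m3 m4 s1 s2 h; clear; lra.
have s1 : 4 * (A * `|q|) < A * `|p| by rewrite mulrCA ltr_pM2l.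
have s2 : 4 * (B * `|q|) <= B * `|p| by rewrite mulrCA ler_wpM2l // ltW.
by case: t => h; have := h; rewrite ltNge => /negP; apply;
  move: t1 t2 t3 t4 t5 t6 m1 m2 m3 m4 s1 s2 h; clear; lra.
Qed.

Lemma diagonal_free g e : g12 g = 0 -> g21 g = 0 -> det2 g = 1 -> 4 < `|g11 g| ->
  tr2 e = 0 -> det2 e ^+ 2 = 1 -> `|g12 e| = `|g21 e| -> 2 <= g11 e ^+ 2 ->
  free_meridians g g e.
Proof.
move=> g0 g0' dg lg te de be ae i j k l.
have pg := cone_ping_pong g0 g0' dg lg.
have sgn (u : bool) n : exists2 S, ping_pong act2 [set v | v != 0] S
    ((if u then g^-1 else g) ^+ n.+1)%g & (forall s, exists t, S s = cone t).
  case: u.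
    exists (cone \o negb); last by move=> s; exists (~~ s).
    by apply: (ping_pongX act2M); exact: (ping_pongV (G := gl2)).
  by exists cone; [apply: (ping_pongX act2M)|move=> s; exists s].
have [S Sp St] := sgn i k; have [S' Sp' St'] := sgn j l.
apply: (ping_pong_free act2_1 act2M Sp (conj_ping_pong e Sp')) => s t.
apply/seteqP; split=> // v [/=]; have [s' ->] := St s; have [t' ->] := St' t.
by move=> h1 h2; exact: (cone_disjoint te de be ae h1 h2).
Qed.

End GL2.

(** * A trace criterion for free meridians *)

Section TracelessConjugator.
Context {R : realType}.
Implicit Types (g e h : @gl2 R) (t : R).

Lemma det2M g h : det2 (g * h)%g = det2 g * det2 h.
Proof. by rewrite /det2 /=; ring. Qed.

Lemma det2V g : det2 (g^-1)%g = (det2 g)^-1.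
Proof.
apply: (mulfI (det2_neq0 g)); rewrite -det2M mulgV divff ?det2_neq0 //.
by rewrite /det2 /=; ring.
Qed.

Lemma tr2C g h : tr2 (g * h)%g = tr2 (h * g)%g.
Proof. by rewrite /tr2 /=; ring. Qed.

(** The larger root of [l ^ 2 - t l + 1] is at least [(5 + 4) / 2] in absolute value. *)
Lemma large_eigenvalue t : 25 <= t ^+ 2 -> exists2 l, l * (t - l) = 1 & 4 < `|l|.
Proof.
move=> t25; pose s := Num.sqrt (t ^+ 2 - 4).
have s2 : s ^+ 2 = t ^+ 2 - 4 by rewrite sqr_sqrtr //; lra.
have s0 : 0 <= s by exact: sqrtr_ge0.
have [t0|t0] := leP 0 t.
  have t5 : 5 <= t by rewrite -ler_sqr ?nnegrE //; lra.
  have s4 : 4 <= s by rewrite -ler_sqr ?nnegrE //; lra.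
  exists ((t + s) / 2); last by rewrite ger0_norm; lra.
  suff : t ^+ 2 - s ^+ 2 = 4 by lra.
  by rewrite s2; ring.
have t5 : 5 <= - t by rewrite -ler_sqr ?nnegrE ?sqrrN //; lra.
have s4 : 4 <= s by rewrite -ler_sqr ?nnegrE //; lra.
exists ((t - s) / 2); last by rewrite ltr0_norm; lra.
suff : t ^+ 2 - s ^+ 2 = 4 by lra.
by rewrite s2; ring.
Qed.

Fact eigen_det (l m b c : R) : c != 0 -> l != m -> (l - b) * c - c * (m - b) != 0.
Proof.
move=> c0 lm; rewrite (_ : _ - _ = c * (l - m)); last by ring.
by rewrite mulf_neq0 // subr_eq0.
Qed.

Fact diag_det (l m : R) : l != 0 -> m != 0 -> l * m - 0 * 0 != 0.
Proof. by move=> l0 m0; rewrite mulr0 subr0 mulf_neq0. Qed.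

(** In an eigenbasis of [g], the trace of [g e] is [l - m] times the diagonal entry of [e], and
    [(l - m) ^ 2 = tr2 g ^+ 2 - 4]: the last hypothesis says that this entry has square at least 2.
    A further diagonal conjugation equalizes the off-diagonal entries, as [diagonal_free]
    demands. *)
Lemma traceless_free g e : det2 g = 1 -> g12 g != 0 -> 25 <= tr2 g ^+ 2 ->
  tr2 e = 0 -> det2 e ^+ 2 = 1 -> 2 * (tr2 g ^+ 2 - 4) <= tr2 (g * e)%g ^+ 2 ->
  free_meridians g g e.
Proof.
move=> dg gb tg te de tge; have [l lm l4] := large_eigenvalue tg.
set m := tr2 g - l in lm.
have l0 : l != 0 by apply/eqP => l0; move/eqP: lm; rewrite l0 mul0r eq_sym oner_eq0.
have m0 : m != 0 by apply/eqP => m0; move/eqP: lm; rewrite m0 mulr0 eq_sym oner_eq0.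
have lneqm : l != m.
  apply: contraTneq l4 => e1; rewrite -leNgt -ler_sqr ?nnegrE ?normr_ge0 //.
  have -> : `|l| ^+ 2 = 1 by rewrite expr2 -normrM {2}e1 lm normr1.
  by lra.
(* The rows of [h] are left eigenvectors of [g] for [l] and [m]. *)
pose h := Gl2 (eigen_det (g22 g) gb lneqm); pose d := Gl2 (diag_det l0 m0).
have hg : (h * g = d * h)%g.
  have mE : m = g11 g + g22 g - l by [].
  move: dg; rewrite /det2 => dg.
  by apply: gl2_eq; split=> /=; rewrite ?mul0r ?addr0 ?add0r; move: lm; rewrite mE; lra.
have gE : (g = h^-1 * d * h)%g by rewrite -mulgA -hg mulKg.
have [e1 e1E] : exists e1, e1 = (h * e * h^-1)%g by exists (h * e * h^-1)%g.
have te1 : tr2 e1 = 0 by rewrite e1E tr2C mulgA mulVg mul1g.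
have de1 : det2 e1 = det2 e.
  by rewrite e1E !det2M det2V mulrAC mulfV ?mul1r ?det2_neq0.
have e1_22 : g22 e1 = - g11 e1 by move: te1; rewrite /tr2; lra.
have a2 : 2 <= g11 e1 ^+ 2.
  have tdE : tr2 (g * e)%g = g11 e1 * (l - m).
    have -> : tr2 (g * e)%g = tr2 (d * e1)%g.
      by rewrite gE e1E -!mulgA [LHS]tr2C -!mulgA.
    by rewrite /tr2 /= e1_22; ring.
  have lm2 : (l - m) ^+ 2 = tr2 g ^+ 2 - 4.
    have -> : tr2 g = l + m by rewrite /m; ring.
    by rewrite -[4]mulr1 -{2}lm; ring.
  by move: tge; rewrite tdE exprMn lm2 ler_pM2r //; lra.
have dE : (g11 e1 ^+ 2 + g12 e1 * g21 e1) ^+ 2 = 1.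
  by rewrite -de -de1 /det2 e1_22; ring.
have bc0 : g12 e1 * g21 e1 != 0.
  apply/eqP => bc0; move: dE; rewrite bc0 addr0 => dE.
  have : 2 * 2 <= (g11 e1 ^+ 2) ^+ 2 by rewrite [leRHS]expr2 ler_pM.
  by rewrite dE leNgt => /negP; apply; lra.
have [b0 c0] : g12 e1 != 0 /\ g21 e1 != 0.
  by move: bc0; rewrite mulf_eq0 negb_or => /andP[].
pose t := Num.sqrt (`|g12 e1| / `|g21 e1|).
have t2 : t ^+ 2 = `|g12 e1| / `|g21 e1| by rewrite sqr_sqrtr // divr_ge0.
have t0 : 0 < t by rewrite sqrtr_gt0 divr_gt0 ?normr_gt0.
pose k := Gl2 (diag_det (oner_neq0 R) (lt0r_neq0 t0)).
pose H := (k * h)%g; pose e2 := (k * e1 * k^-1)%g.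
have te2 : tr2 e2 = 0 by rewrite /e2 tr2C mulgA mulVg mul1g.
have de2 : det2 e2 = det2 e.
  by rewrite /e2 !det2M det2V mulrAC mulfV ?mul1r ?det2_neq0.
have dk : (d * k = k * d)%g by apply: gl2_eq; split=> /=; ring.
have tn0 := lt0r_neq0 t0.
have e2_11 : g11 e2 = g11 e1 by rewrite /e2 /= /det2 /=; field.
have e2_12 : g12 e2 = g12 e1 / t by rewrite /e2 /= /det2 /=; field.
have e2_21 : g21 e2 = t * g21 e1 by rewrite /e2 /= /det2 /=; field.
have f : free_meridians d d e2.
  apply: diagonal_free; rewrite ?e2_11 ?de2 //.
  - by rewrite /det2 /= mulr0 subr0.
  - rewrite e2_12 e2_21 !normrM normfV (gtr0_norm t0).
    have -> : `|g12 e1| = t ^+ 2 * `|g21 e1| by rewrite t2 divfK ?normr_eq0.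
    by field.
apply: (free_meridians_conj (g := (H^-1)%g) (k := (H^-1)%g) f).
- by rewrite invgK conjgE [LHS]gE /H (mulgA d) dk invgM -!mulgA mulKg.
- by rewrite invgK conjgE [LHS]gE /H (mulgA d) dk invgM -!mulgA mulKg.
- have -> : e2 = (H * e * H^-1)%g by rewrite /e2 e1E /H invgM !mulgA.
  by move=> z; rewrite -mulgA mulKg.
Qed.

End TracelessConjugator.

(** * Representations of the knot groups *)

Section SquarePowers.
Context {R : realType}.
Implicit Types (u rho : R) (r g : @gl2 R).

(* If [r ^ 2 = rho r + 1] then [r ^ (2 n) = p r + p'] with [(p, p') = luc rho n]. *)
Fixpoint luc rho (n : nat) : R * R :=
  if n is n'.+1 then
    let p := luc rho n' in ((rho * rho + 1) * p.1 + rho * p.2, rho * p.1 + p.2)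
  else (0, 1).

Lemma luc_pos rho n : 0 <= rho -> 0 <= (luc rho n).1 /\ 1 <= (luc rho n).2.
Proof.
move=> r0; elim: n => [|n [h1 h2]] /=; first by split.
have m1 := mulr_ge0 r0 h1; have m2 := mulr_ge0 (mulr_ge0 r0 r0) h1.
have m3 : 0 <= rho * (luc rho n).2 by rewrite mulr_ge0 //; lra.
by split; lra.
Qed.

Lemma luc_ge rho n : 0 <= rho -> (0 < n)%N ->
  rho <= (luc rho n).1 /\ rho * (luc rho n).2 <= (luc rho n).1.
Proof.
move=> r0; case: n => // n _ /=; have [h1 h2] := luc_pos n r0.
have m1 := mulr_ge0 r0 h1; have m2 := mulr_ge0 (mulr_ge0 r0 r0) h1.
have m3 : rho * 1 <= rho * (luc rho n).2 by rewrite ler_wpM2l.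
by split; [lra|rewrite mulrDr mulrA; lra].
Qed.

Lemma continuous_luc (X : topologicalType) (f : X -> R) n : continuous f ->
  continuous (fun x => (luc (f x) n).1) /\ continuous (fun x => (luc (f x) n).2).
Proof.
move=> cf; elim: n => [|n [c1 c2]] /=; first by split; exact: continuous_const.
by split; cont.
Qed.

(** For determinant -1 Cayley-Hamilton reads [r ^ 2 = tr2 r * r + 1], whence the recursion of
    [luc]. *)
Lemma square_power r n (p := luc (tr2 r) n) : det2 r = -1 ->
  [/\ g11 ((r * r) ^+ n)%g = p.1 * g11 r + p.2, g12 ((r * r) ^+ n)%g = p.1 * g12 r,
      g21 ((r * r) ^+ n)%g = p.1 * g21 r & g22 ((r * r) ^+ n)%g = p.1 * g22 r + p.2].
Proof.
rewrite /p {p} => dr; elim: n => [|n [e1 e2 e3 e4]].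
  by rewrite expg0 /=; split; ring.
have r22 : g22 r = tr2 r - g11 r by rewrite /tr2; ring.
have r12 : g12 r * g21 r = g11 r * g22 r + 1 by move: dr; rewrite /det2; lra.
rewrite expgSr /= e1 e2 e3 e4 r22 in r12 *.
set t := tr2 r in r22 r12 *; set p := luc t n; move: r12.
move: (g11 r) (g12 r) (g21 r) => a b c bc.
have cb : c * b = a * (t - a) + 1 by rewrite mulrC.
split.
- have -> : (p.1 * a + p.2) * (a * a + b * c) + p.1 * b * (c * a + (t - a) * c) =
    (p.1 * a + p.2) * (a * a + b * c) + p.1 * t * (b * c) by ring.
  by rewrite bc; ring.
- have -> : (p.1 * a + p.2) * (a * b + b * (t - a)) + p.1 * b * (c * b + (t - a) * (t - a)) =
    b * ((p.1 * a + p.2) * t + p.1 * (c * b) + p.1 * (t - a) ^+ 2) by ring.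
  by rewrite cb; ring.
- have -> : p.1 * c * (a * a + b * c) + (p.1 * (t - a) + p.2) * (c * a + (t - a) * c) =
    c * (p.1 * (a * a) + p.1 * (b * c) + (p.1 * (t - a) + p.2) * t) by ring.
  by rewrite bc; ring.
- have -> : p.1 * c * (a * b + b * (t - a)) + (p.1 * (t - a) + p.2) * (c * b + (t - a) * (t - a)) =
    p.1 * t * (c * b) + (p.1 * (t - a) + p.2) * (c * b + (t - a) ^+ 2) by ring.
  by rewrite cb; ring.
Qed.

Lemma sqr_traceless g : tr2 g = 0 -> forall e, g12 e = 0 -> g21 e = 0 ->
  g11 e = - det2 g -> g22 e = - det2 g -> (g ^+ 2 = e)%g.
Proof.
move=> t0 e e12 e21 e11 e22; have g22E : g22 g = - g11 g by move: t0; rewrite /tr2; lra.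
by apply: gl2_eq; rewrite e12 e21 e11 e22 /det2 /= g22E; split; ring.
Qed.

Lemma det2X g n : det2 (g ^+ n)%g = det2 g ^+ n.
Proof.
elim: n => [|n ih]; first by rewrite expg0 expr0 /det2 /=; ring.
by rewrite expgSr det2M ih -exprSr.
Qed.

Lemma diag_power (a b : R) (a0 : a != 0) (b0 : b != 0) (g := Gl2 (diag_det a0 b0)) m :
  [/\ g11 (g ^+ m)%g = a ^+ m, g12 (g ^+ m)%g = 0, g21 (g ^+ m)%g = 0 & g22 (g ^+ m)%g = b ^+ m].
Proof.
elim: m => [|m [e1 e2 e3 e4]]; first by rewrite expg0.
by rewrite expgSr /= e1 e2 e3 e4 !exprSr; split; ring.
Qed.

End SquarePowers.

(** * Matrices for the slopes [2m, -2n] *)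

Section HyperbolicRepresentation.
Context {R : realType}.
Variables (m n : nat).
Hypotheses (m_gt0 : (0 < m)%N) (n_gt0 : (0 < n)%N).
Let A : R := 8 ^+ m.
Let B : R := (- 8^-1) ^+ m.

Lemma diag_product : (A * B) ^+ 2 = 1.
Proof. by rewrite /A /B -exprMn mulrN divff ?pnatr_eq0 // -exprM mulnC exprM sqrrN expr1n expr1n. Qed.

Lemma A_neq0 : A != 0. Proof. by rewrite /A expf_neq0 // pnatr_eq0. Qed.
Lemma B_neq0 : B != 0. Proof. by rewrite /B expf_neq0 // oppr_eq0 invr_eq0 pnatr_eq0. Qed.

Lemma sqr_A_ge : 64 <= A ^+ 2.
Proof.
rewrite /A -exprM -(prednK m_gt0) mulSn exprD -[64]mulr1; apply: ler_pM => //.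
  by rewrite expr2; lra.
by apply: exprn_ege1; lra.
Qed.

(* The equation says that [Z ^- n * Q] is traceless, for [Q = diag(8, -1/8)] and
   [c] the reflection with first row [(- y, x)], [x ^ 2 + y ^ 2 = 1]. *)
Lemma trace_root : exists2 x : R, 0 < x & x ^+ 2 <= 2^-1 /\
  let p := luc (x * (A ^+ 2 - B ^+ 2)) n in
  p.1 * x * (A ^+ 2 / 8 + 8 * B ^+ 2) = p.2 * (8 - 8^-1).
Proof.
have p12 : A ^+ 2 * B ^+ 2 = 1 by rewrite -exprMn diag_product.
have := sqr_A_ge; set p1 := A ^+ 2 in p12 *; set p2 := B ^+ 2 in p12 * => p1_ge.
have p2_gt0 : 0 < p2.
  by rewrite -(pmulr_rgt0 _ (_ : 0 < p1)) ?p12 //; lra.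
have p2_le : p2 <= 1 by rewrite -p12; have := ler_wpM2r (ltW p2_gt0) p1_ge; lra.
pose rho x : R := x * (p1 - p2).
pose phi x : R := (luc (rho x) n).1 * x * (p1 / 8 + 8 * p2) - (luc (rho x) n).2 * (8 - 8^-1).
have crho : continuous rho by rewrite /rho; cont.
have [cl1 cl2] := continuous_luc n crho.
have cphi : continuous phi by rewrite /phi; cont.
(* The interval ends at the square root of [1/2] because [x ^ 2 <= 1/2] later keeps the squared
   trace [(1 - x ^ 2) (8 + 1/8) ^ 2] of the meridian above 25. *)
pose z : R := Num.sqrt 2^-1.
have z2 : z ^+ 2 = 2^-1 by rewrite sqr_sqrtr // invr_ge0.
have z0 : 0 <= z by exact: sqrtr_ge0.
have phi0 : phi 0 < 0.
  rewrite /phi mulr0 mul0r sub0r oppr_lt0.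
  have [_ h] := luc_pos n (lexx (0 : R)); rewrite /rho mul0r.
  by rewrite mulr_gt0 //; lra.
(* By [luc_ge] the first term of [phi z] is at least [p.2 * 63 * 8 / 2], well above the second. *)
have phiz : 0 <= phi z.
  have r0 : 0 <= rho z by rewrite mulr_ge0 //; lra.
  have [_ h1] := luc_pos n r0; have [_ h2] := luc_ge r0 n_gt0.
  set p := luc (rho z) n in h1 h2; rewrite /phi -/p.
  have k0 : 0 <= p1 / 8 + 8 * p2 by lra.
  have h3 : rho z * p.2 * z <= p.1 * z by rewrite ler_wpM2r.
  have h4 := ler_wpM2r k0 h3.
  have e4 : rho z * p.2 * z * (p1 / 8 + 8 * p2) =
      p.2 * (2^-1 * (p1 - p2) * (p1 / 8 + 8 * p2)) by rewrite /rho -z2; ring.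
  rewrite e4 in h4; apply: le_trans (_ : 0 <= p.2 * (2^-1 * (p1 - p2) * (p1 / 8 + 8 * p2)) - _) _; last first.
    by rewrite lerB.
  rewrite -mulrBr mulr_ge0 //; first by lra.
  have : 63 * 8 <= (p1 - p2) * (p1 / 8 + 8 * p2) by apply: ler_pM; lra.
  by lra.
have cw : {within `[0, z], continuous phi}.
  by apply: continuous_subspaceT => x; exact: cphi.
have mM : Num.min (phi 0) (phi z) <= 0 <= Num.max (phi 0) (phi z).
  by rewrite ge_min (ltW phi0) le_max phiz orbT.
have [x xz fx] := IVT z0 cw mM.
move: xz; rewrite in_itv /= => /andP[x0 xz]; exists x.
  rewrite lt_neqAle x0 andbT; apply/eqP => xe.
  by have : phi x < 0; [rewrite -xe|rewrite fx ltxx].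
split; first by rewrite -z2 ler_sqr.
by apply/eqP; rewrite -subr_eq0; apply/eqP.
Qed.

Fact minus8_neq0 : - 8^-1 != 0 :> R. Proof. by rewrite oppr_eq0 invr_eq0 pnatr_eq0. Qed.
Fact eight_neq0 : 8 != 0 :> R. Proof. by rewrite pnatr_eq0. Qed.

(** The diagonal entries of [P ^ 2] have product 1, so a quarter turn conjugates [P ^ 2] to
    [P ^- 2]. Combined with [c] it gives the reflection [f], up to sign, and [Z] is the square of
    [r = P ^ 2 f]. As [det r = -1], the powers of [Z] are given by [luc]. *)
Lemma hyperbolic_representation : exists Q c : @gl2 R,
  let P := (Q ^+ m)%g in let Z := (P ^+ 2 * c * P ^- 2 * c^-1)%g in
  [/\ (c * c = 1)%g, ((Z ^- n * Q) ^+ 2 = 1)%g &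
      free_meridians (c * Q)%g (c * Q)%g (P^-1 * Q^-1 * Z ^+ n * P)%g].
Proof.
have [x x0 [x2 root]] := trace_root.
pose y := Num.sqrt (1 - x ^+ 2).
have y2 : y ^+ 2 = 1 - x ^+ 2 by rewrite sqr_sqrtr //; lra.
have y0 : 0 <= y by exact: sqrtr_ge0.
have xy : x * x + y * y = 1 by rewrite -!expr2 y2; ring.
have c_det : - y * y - x * x != 0.
  by rewrite (_ : _ - _ = - 1) ?oppr_eq0 ?oner_neq0 // -xy; ring.
have f_det : x * (- x) - y * y != 0.
  by rewrite (_ : _ - _ = - 1) ?oppr_eq0 ?oner_neq0 // -xy; ring.
pose c := Gl2 c_det; pose f := Gl2 f_det.
pose Q := Gl2 (diag_det eight_neq0 minus8_neq0); exists Q, c => P Z.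
have cc : (c * c = 1)%g by apply: gl2_eq; split=> /=; [rewrite -[RHS]xy| | |rewrite -[RHS]xy]; ring.
have cV : (c^-1 = c)%g by apply: (mulgI c); rewrite mulgV cc.
have [P11 P12 P21 P22] := diag_power eight_neq0 minus8_neq0 m.
rewrite -/Q -/P -/A -/B in P11 P12 P21 P22.
have := diag_product; have := sqr_A_ge; have := A_neq0; have := B_neq0.
move: root P11 P22; clearbody A B; move: A B => a b root P11 P22 b0 a0 a64 ab.
have dP : det2 P ^+ 2 = 1 by rewrite /det2 P11 P12 P22 mul0r subr0.
have dP1 : det2 P * det2 P = 1 by rewrite -expr2.
pose r := (P ^+ 2 * f)%g.
have PV : (P ^- 2 = Gl2 (diag_det (expf_neq0 2 b0) (expf_neq0 2 a0)))%g.
  apply: (mulgI (P ^+ 2)%g); rewrite mulgV.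
  apply: gl2_eq; split; rewrite /= P11 P12 P21 P22; try ring.
    by rewrite -[LHS]ab; ring.
  by rewrite -[LHS]ab; ring.
have ZE : Z = (r * r)%g.
  rewrite /Z PV cV /r; apply: gl2_eq; split; rewrite /= P11 P12 P21 P22; ring.
have r11 : g11 r = a ^+ 2 * x by rewrite /r /= P11 P12 P21 P22; ring.
have r12 : g12 r = a ^+ 2 * y by rewrite /r /= P11 P12 P21 P22; ring.
have r21 : g21 r = b ^+ 2 * y by rewrite /r /= P11 P12 P21 P22; ring.
have r22 : g22 r = - b ^+ 2 * x by rewrite /r /= P11 P12 P21 P22; ring.
have tr : tr2 r = x * (a ^+ 2 - b ^+ 2) by rewrite /tr2 r11 r22; ring.
have dr : det2 r = -1.
  rewrite /det2 r11 r12 r21 r22 (_ : _ - _ = - ((a * b) ^+ 2 * (x * x + y * y))); last by ring.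
  by rewrite ab xy mulr1.
have [Z11 Z12 Z21 Z22] := square_power n dr.
rewrite tr -ZE r11 r12 r21 r22 in Z11 Z12 Z21 Z22.
move: root Z11 Z12 Z21 Z22; set p := luc _ n => root Z11 Z12 Z21 Z22.
have dc : det2 c = -1 by rewrite /det2 /= -[1]xy; ring.
have dQ : det2 Q = -1 by rewrite /det2 /=; field.
have dZ : det2 (Z ^+ n)%g = 1.
  by rewrite det2X ZE det2M dr mulrNN mulr1 expr1n.
split=> //.
- apply: sqr_traceless => /=; rewrite ?oppr0 //.
  + rewrite /tr2 /= dZ Z11 Z12 Z21 Z22 !divr1.
    by move: root; rewrite /=; lra.
  + by rewrite det2M det2V dZ dQ; field.
  + by rewrite det2M det2V dZ dQ; field.
set E := (P^-1 * Q^-1 * Z ^+ n * P)%g.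
pose k := (p.1 * x * a ^+ 2 + p.2) / 8.
have E11 : g11 E = k.
  by rewrite /E /k /= /det2 /= P11 P12 P21 P22 Z11 Z12 Z21 Z22; field; rewrite ?a0 ?b0.
have E12 : g12 E = a * b * p.1 * y / 8.
  by rewrite /E /= /det2 /= P11 P12 P21 P22 Z11 Z12 Z21 Z22; field; rewrite ?a0 ?b0.
have E21 : g21 E = - 8 * (a * b) * p.1 * y.
  by rewrite /E /= /det2 /= P11 P12 P21 P22 Z11 Z12 Z21 Z22; field; rewrite ?a0 ?b0.
(* The root equation, that is the relation of the knot, makes [E] traceless here. *)
have E22 : g22 E = - k.
  have -> : g22 E = 8 * (p.1 * b ^+ 2 * x - p.2).
    by rewrite /E /= /det2 /= P11 P12 P21 P22 Z11 Z12 Z21 Z22; field; rewrite ?a0 ?b0.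
  by move: root; rewrite /k /=; lra.
have dE : det2 E ^+ 2 = 1.
  by rewrite /E !det2M !det2V dZ dQ invrN1 mulr1 mulrN1 mulNr mulVf ?det2_neq0 // sqrrN expr1n.
clearbody E; clear Z11 Z12 Z21 Z22 r11 r12 r21 r22 P11 P12 P21 P22 tr dr PV ZE dZ dP dP1.
apply: traceless_free => //.
- by rewrite det2M dc dQ mulrNN mulr1.
- rewrite /= !mulr0 add0r mulf_neq0 ?minus8_neq0 //; exact: lt0r_neq0.
- have -> : tr2 (c * Q)%g = - y * (8 + 8^-1) by rewrite /tr2 /=; field.
  by rewrite exprMn sqrrN y2; lra.
- by rewrite /tr2 E11 E22 subrr.
have -> : tr2 (c * Q)%g = - y * (8 + 8^-1) by rewrite /tr2 /=; field.
have -> : tr2 (c * Q * E)%g = - y * (k * (8 - 8^-1) - 2 * (a * b) * (p.1 * x)).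
  by rewrite /tr2 /= E11 E12 E21 E22; field.
rewrite !exprMn !sqrrN y2.
have b64 : 64 * b ^+ 2 <= 1.
  by have := ler_wpM2r (sqr_ge0 b) a64; rewrite -exprMn ab.
have rho0 : 0 <= x * (a ^+ 2 - b ^+ 2).
  by rewrite mulr_ge0 ?(ltW x0) //; have := sqr_ge0 b; lra.
have [u0 u1] := luc_pos n rho0; rewrite -/p in u0 u1.
have X0 : 0 <= p.1 * x by rewrite mulr_ge0 // ltW.
have ab1 : a * b <= 1.
  by move/eqP: ab; rewrite sqrf_eq1 => /orP[]/eqP ->; rewrite ?lexx // (le_trans (lerN10 _)) ?ler01.
have h1 := ler_wpM2r X0 b64; have h2 := ler_wpM2r X0 a64; have h3 := ler_wpM2r X0 ab1.
(* After squaring, [(8 - 1/8) ^ 2 = (8 + 1/8) ^ 2 - 4] turns this bound into the trace inequality of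
   [traceless_free]. *)
have h4 : 2 * (8 - 8^-1) <= k * (8 - 8^-1) - 2 * (a * b) * (p.1 * x).
  by move: root; rewrite /k /=; lra.
have h5 : (2 * (8 - 8^-1)) ^+ 2 <= (k * (8 - 8^-1) - 2 * (a * b) * (p.1 * x)) ^+ 2.
  have c0 : 0 <= 2 * (8 - 8^-1) :> R by lra.
  by rewrite ler_sqr // nnegrE (le_trans c0 h4).
have y12 : 0 <= 1 - x ^+ 2 by rewrite subr_ge0 (le_trans x2) // invf_le1 ?ler1n.
by have := ler_wpM2l y12 h5; lra.
Qed.

End HyperbolicRepresentation.

(** * Matrices for the slopes [2m, 2n] *)

Section EllipticRepresentation.
Context {R : realType}.
Variables (m n : nat).
Hypotheses (m_gt0 : (0 < m)%N) (n_gt0 : (0 < n)%N).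
Let M : R := m%:R.

(* The equation says that [Z ^+ n * Q] is traceless, for [Q] the rotation of angle [t]
   and [c] with first row [(X, Y)], [Y ^ 2 = X ^ 2 + 1]. *)
Lemma angle_root : exists t X : R,
  [/\ 0 < sin t, 0 <= cos t, cos ((2 * M + 1) * t) <= 0, 3 <= X * sin t & 3 <= X] /\
  1 <= X * sin (2 * M * t) /\
  let p := luc (2 * X * sin (2 * M * t)) n in
  p.1 * X * sin ((2 * M + 1) * t) + p.2 * cos t = 0.
Proof.
have M1 : 1 <= M by rewrite /M ler1n.
have pi0 : 0 < pi :> R by exact: pi_gt0.
(* For [t] between [pi / (2 M + 1)] and [2 d], the angle [(2 M + 1) t] runs from [pi] to [pi + d],
   while [t] and [pi - 2 M t] stay in [[d, pi / 2]]. *)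
pose d : R := pi / (4 * M + 1).
have d0 : 0 < d by rewrite divr_gt0 //; lra.
have piE : pi = 4 * M * d + d by rewrite /d; field; apply: lt0r_neq0; lra.
have Md : d <= M * d by rewrite ler_peMl // ltW.
pose t0 : R := pi / (2 * M + 1).
have t0E : 2 * M * t0 + t0 = pi by rewrite /t0; field; apply: lt0r_neq0; lra.
have t0_gt0 : 0 < t0 by rewrite divr_gt0 //; lra.
have t01 : t0 <= 2 * d.
  have h : (2 * M + 1) * t0 <= (2 * M + 1) * (2 * d) by lra.
  by move: h; rewrite ler_pM2l //; lra.
have bounds t : t0 <= t <= 2 * d ->
    [/\ d <= t <= pi / 2, d <= pi - 2 * M * t <= pi / 2 & 0 <= (2 * M + 1) * t - pi <= d].
  move=> /andP[h0 h1].
  have Mt : M * t <= M * (2 * d) by rewrite ler_wpM2l //; lra.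
  have Mt0 : M * t0 <= M * t by rewrite ler_wpM2l //; lra.
  have Mtt : t <= M * t by rewrite ler_peMl //; lra.
  by split; apply/andP; split; lra.
have sin_mono a b : 0 <= a -> a <= b -> b <= pi / 2 -> sin a <= sin b.
  move=> a0 ab bpi; rewrite leNgt ltr_sin -?leNgt // in_itv /=; apply/andP; split; lra.
have dpi : d <= pi / 2 by lra.
pose s : R := sin d.
have s0 : 0 < s by apply: sin_gt0_pi; apply/andP; split; lra.
have s1 : s <= 1 by exact: sin_le1.
(* Makes [X sin t] and [X sin (2 M t)] at least 3 on the whole interval. The trace [2 Y sin t] is
   then at least 6, and at the right end [psi] is at most [(1 - 18) p.2 < 0]. *)
pose X : R := 3 / s.
have Xs : X * s = 3 by rewrite /X divfK ?lt0r_neq0.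
have X3 : 3 <= X.
  by rewrite /X ler_pdivlMr //; lra.
have sin1 t : t0 <= t <= 2 * d -> s <= sin t.
  by move=> /bounds[/andP[h1 h2] _ _]; apply: sin_mono => //; exact: ltW.
have sin2 t : t0 <= t <= 2 * d -> s <= sin (2 * M * t).
  move=> /bounds[_ /andP[h1 h2] _].
  rewrite -[2 * M * t]opprK sinN -sinDpi addrC.
  by apply: sin_mono => //; exact: ltW.
have cos1 t : t0 <= t <= 2 * d -> 0 <= cos t.
  by move=> /bounds[/andP[h1 h2] _ _]; apply: cos_ge0_pihalf; apply/andP; split; lra.
pose rho t : R := 2 * X * sin (2 * M * t).
pose psi t : R := (luc (rho t) n).1 * X * sin ((2 * M + 1) * t) + (luc (rho t) n).2 * cos t.
have crho : continuous rho by rewrite /rho; cont.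
have [cl1 cl2] := continuous_luc n crho.
have cc : continuous (fun t : R => cos t) by exact: continuous_cos.
have cpsi : continuous psi by rewrite /psi; cont.
have rho0 t : t0 <= t <= 2 * d -> 0 <= rho t.
  by move=> /sin2 h; rewrite mulr_ge0 //; lra.
have psi0 : 0 <= psi t0.
  have ht : t0 <= t0 <= 2 * d by rewrite lexx.
  have [_ h] := luc_pos n (rho0 _ ht).
  rewrite /psi (_ : (2 * M + 1) * t0 = pi); last by lra.
  by rewrite sinpi mulr0 add0r mulr_ge0 ?cos1 //; lra.
have psi1 : psi (2 * d) <= 0.
  have ht : t0 <= 2 * d <= 2 * d by rewrite lexx t01.
  have [_ h1] := luc_pos n (rho0 _ ht); have [_ h2] := luc_ge (rho0 _ ht) n_gt0.
  rewrite /psi; set p := luc _ n in h1 h2 *.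
  rewrite (_ : (2 * M + 1) * (2 * d) = d + pi); last by lra.
  rewrite sinDpi -/s mulrN; have c1 := cos_le1 (2 * d).
  have h3 : p.2 * cos (2 * d) <= p.2 * 1 by rewrite ler_wpM2l //; lra.
  have Xs0 : 0 <= X * s by rewrite Xs.
  have h4 := ler_wpM2r Xs0 h2.
  have r6 : 6 <= rho (2 * d) by rewrite /rho; have := ler_wpM2l (_ : 0 <= X) (sin2 _ ht); lra.
  have h5 : 6 * p.2 <= rho (2 * d) * p.2 by rewrite ler_wpM2r //; lra.
  rewrite Xs in h4; rewrite -[p.1 * X * s]mulrA Xs.
  by lra.
have cw : {within `[t0, 2 * d], continuous psi}.
  by apply: continuous_subspaceT => x; exact: cpsi.
have mM : Num.min (psi t0) (psi (2 * d)) <= 0 <= Num.max (psi t0) (psi (2 * d)).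
  by rewrite ge_min psi1 orbT le_max psi0.
have [t tI pt] := IVT t01 cw mM.
move: tI; rewrite in_itv /= => tI; exists t, X.
have st := sin1 t tI; have st2 := sin2 t tI; have [_ _ /andP[h1 h2]] := bounds t tI.
have X0 : 0 <= X by lra.
split; [split|split] => //.
- by lra.
- exact: cos1.
- rewrite -[_ * t](subrK pi) cosDpi oppr_le0; apply: cos_ge0_pihalf.
  by apply/andP; split; lra.
- by rewrite -Xs ler_wpM2l.
- by have := ler_wpM2l X0 st2; lra.
Qed.

Fact rot_det t : cos t * cos t - (- sin t) * sin t != 0 :> R.
Proof.
rewrite (_ : _ - _ = cos t ^+ 2 + sin t ^+ 2); last by ring.
by rewrite cos2Dsin2 oner_neq0.
Qed.

Lemma rot_power t k (g := Gl2 (rot_det t)) :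
  [/\ g11 (g ^+ k)%g = cos (k%:R * t), g12 (g ^+ k)%g = - sin (k%:R * t),
      g21 (g ^+ k)%g = sin (k%:R * t) & g22 (g ^+ k)%g = cos (k%:R * t)].
Proof.
elim: k => [|k [e1 e2 e3 e4]]; first by rewrite expg0 /= mul0r cos0 sin0 oppr0.
have -> : k.+1%:R * t = k%:R * t + t by rewrite -natr1; ring.
by rewrite expgSr /= e1 e2 e3 e4 cosD sinD; split; ring.
Qed.

Fact minus1_neq0 : -1 != 0 :> R. Proof. by rewrite oppr_eq0 oner_neq0. Qed.

(** Exchanging the coordinates inverts rotations. Combined with [c] it gives [f] with [f ^ 2 = 1]
    and [c P ^- 2 c^-1 = f P ^ 2 f], so [P] conjugates [Z] to the square of [r = P f P], again of
    determinant -1. Here [c ^ 2] is the scalar -1. *)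
Lemma elliptic_representation : exists Q c e : @gl2 R,
  let P := (Q ^+ m)%g in let Z := (P ^+ 2 * c * P ^- 2 * c^-1)%g in
  [/\ (c * c = e)%g, (e * e = 1)%g, forall z, (e * z = z * e)%g,
      ((Z ^+ n * Q) ^+ 2 = e)%g &
      free_meridians (Q * c)%g (Q * c)%g (P^-1 * Q * Z ^+ n * P)%g].
Proof.
have [t [X [[S0 C0 C'0 XS X3] [Xs root]]]] := angle_root.
pose Y := Num.sqrt (1 + X ^+ 2).
have Y2 : Y ^+ 2 = 1 + X ^+ 2 by rewrite sqr_sqrtr //; have := sqr_ge0 X; lra.
have Y0 : 0 <= Y by exact: sqrtr_ge0.
have YX : Y * Y - X * X = 1 by rewrite -!expr2 Y2; ring.
have c_det : X * (- X) - Y * (- Y) != 0.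
  by rewrite (_ : _ - _ = 1) ?oner_neq0 // -[RHS]YX; ring.
have f_det : Y * (- Y) - X * (- X) != 0.
  by rewrite (_ : _ - _ = - 1) ?oppr_eq0 ?oner_neq0 // -[in RHS]YX; ring.
pose c := Gl2 c_det; pose f := Gl2 f_det; pose Q := Gl2 (rot_det t).
pose e := Gl2 (diag_det minus1_neq0 minus1_neq0); exists Q, c, e => P Z.
have cc : (c * c = e)%g.
  by apply: gl2_eq; split=> /=; [rewrite -[in RHS]YX| | |rewrite -[in RHS]YX]; ring.
have ee : (e * e = 1)%g by apply: gl2_eq; split=> /=; ring.
have eC z : (e * z = z * e)%g by apply: gl2_eq; split=> /=; ring.
have [P11 P12 P21 P22] := rot_power t m.
rewrite -/Q -/P -/M in P11 P12 P21 P22.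
have uv := cos2Dsin2 (M * t).
have k2E : sin (2 * M * t) = 2 * cos (M * t) * sin (M * t).
  by rewrite -mulrA mulr_natl sin_mulr2n -mulrA mulr_natl.
have k1E : cos (2 * M * t) = cos (M * t) ^+ 2 - sin (M * t) ^+ 2.
  by rewrite -mulrA mulr_natl cos_mulr2n cos2sin2 mulr2n; ring.
have s'E : sin ((2 * M + 1) * t) = sin (2 * M * t) * cos t + cos (2 * M * t) * sin t.
  by rewrite mulrDl mul1r sinD.
have c'E : cos ((2 * M + 1) * t) = cos (2 * M * t) * cos t - sin (2 * M * t) * sin t.
  by rewrite mulrDl mul1r cosD.
have CS := cos2Dsin2 t.
rewrite c'E in C'0; rewrite s'E in root.
have k2E' := k2E; have k1E' := k1E.
set p := luc _ n in root.
move: P11 P12 P21 P22 uv k1E k2E; move: (cos (M * t)) (sin (M * t)) => u v.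
move=> P11 P12 P21 P22 uv k1E k2E.
have uv0 : u * u - v * - v != 0.
  by rewrite (_ : _ - _ = 1) ?oner_neq0 // -[RHS]uv; ring.
have PV : (P^-1 = Gl2 uv0)%g.
  apply: (mulgI P); rewrite mulgV; apply: gl2_eq.
  by split; rewrite /= ?P11 ?P12 ?P21 ?P22; [rewrite -[LHS]uv| | |rewrite -[LHS]uv]; ring.
have cV : (c^-1 = e * c)%g by apply: (mulgI c); rewrite mulgV mulgA -eC -mulgA cc ee.
have W : (c * P ^- 2 * c^-1 = f * P ^+ 2 * f)%g.
  have -> : (P ^- 2 = P^-1 * P^-1)%g by rewrite -invgM.
  rewrite PV cV; apply: gl2_eq; split; rewrite /= ?P11 ?P12 ?P21 ?P22; ring.
pose r := (P * f * P)%g.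
have ZP : conjg Z P = (r * r)%g.
  rewrite conjgE /Z -!(mulgA (P ^+ 2)%g) W /r expg2 -!mulgA mulKg.
  by rewrite !mulgA.
set k1 := cos (2 * M * t) in root C'0 k1E k1E' *.
set k2 := sin (2 * M * t) in root C'0 k2E k2E' *.
have r11 : g11 r = Y + k2 * X.
  rewrite (_ : Y = Y * (u ^+ 2 + v ^+ 2)); last by rewrite uv mulr1.
  by rewrite /r /= ?P11 ?P12 ?P21 ?P22 k2E; ring.
have r12 : g12 r = k1 * X by rewrite /r /= ?P11 ?P12 ?P21 ?P22 k1E; ring.
have r21 : g21 r = - k1 * X by rewrite /r /= ?P11 ?P12 ?P21 ?P22 k1E; ring.
have r22 : g22 r = k2 * X - Y.
  rewrite (_ : Y = Y * (u ^+ 2 + v ^+ 2)); last by rewrite uv mulr1.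
  by rewrite /r /= ?P11 ?P12 ?P21 ?P22 k2E; ring.
have tr : tr2 r = 2 * X * k2 by rewrite /tr2 r11 r22; ring.
have dP : det2 P = 1 by rewrite /det2 P11 P12 P21 P22 -uv; ring.
have df : det2 f = -1 by rewrite /det2 /= -[in RHS]YX; ring.
have dr : det2 r = -1 by rewrite /r !det2M dP df mul1r mulr1.
have [Z11 Z12 Z21 Z22] := square_power n dr.
rewrite tr -ZP -conjXg -/p r11 r12 r21 r22 in Z11 Z12 Z21 Z22.
have dQ : det2 Q = 1 by rewrite /det2 /= -CS; ring.
have dZ : det2 (Z ^+ n)%g = 1.
  have : det2 (conjg (Z ^+ n) P)%g = 1 by rewrite conjXg ZP det2X det2M dr mulrNN mulr1 expr1n.
  by rewrite conjgE !det2M det2V dP invr1 mul1r mulr1.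
pose W' := (conjg (Z ^+ n) P)%g.
have EE : (P^-1 * Q * Z ^+ n * P = Q * W')%g.
  have cPQ : (P^-1 * Q = Q * P^-1)%g.
    by apply/esym; exact: (commuteV (commuteX m (commute_refl Q))).
  by rewrite cPQ /W' conjgE !mulgA.
rewrite EE; rewrite -/W' in Z11 Z12 Z21 Z22.
have dW : det2 W' = 1 by rewrite /W' conjgE !det2M det2V dP dZ invr1 !mulr1.
have tZQ : tr2 (Z ^+ n * Q)%g = tr2 (Q * W')%g by rewrite -EE [RHS]tr2C -(mulgA P^-1%g) mulVKg tr2C.
clearbody W'.
pose C := cos t; pose S := sin t.
have E11 : g11 (Q * W')%g = p.1 * Y * C.
  by move: root; rewrite /= Z11 Z21 /C; lra.
have E12 : g12 (Q * W')%g = p.1 * (Y * S + X * (k1 * C - k2 * S)) - p.2 * S.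
  by rewrite /= Z12 Z22 /C /S; ring.
have E21 : g21 (Q * W')%g = p.1 * (Y * S - X * (k1 * C - k2 * S)) + p.2 * S.
  by rewrite /= Z11 Z21 /C /S; ring.
have E22 : g22 (Q * W')%g = - (p.1 * Y * C).
  by move: root; rewrite /= Z12 Z22 /C; lra.
have tE : tr2 (Q * W')%g = 0 by rewrite /tr2 E11 E22 subrr.
have dE : det2 (Q * W')%g = 1 by rewrite det2M dQ dW mulr1.
split=> //.
  apply: sqr_traceless => //=; first by rewrite tZQ.
    by rewrite det2M dZ dQ mulr1.
  by rewrite det2M dZ dQ mulr1.
move: E11 E12 E21 E22 tE dE; move: (Q * W')%g => E E11 E12 E21 E22 tE dE.
clear root tr dr uv uv0 PV W ZP P11 P12 P21 P22 Z11 Z12 Z21 Z22 r11 r12 r21 r22.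
clear k1E k2E k1E' k2E' s'E c'E tZQ EE dZ dW dP df cV.
have trQc : tr2 (Q * c)%g = 2 * S * Y by rewrite /tr2 /= /S; ring.
have XY : X <= Y by rewrite -ler_sqr ?nnegrE ?Y2; lra.
rewrite -/S in XS S0 CS; rewrite -/C in C0 CS; rewrite -/C -/S in C'0.
rewrite -/k2 in Xs; have SXY := ler_wpM2l (ltW S0) XY.
apply: traceless_free => //.
- rewrite det2M dQ mul1r /det2 /= -YX; ring.
- have h : 0 <= C * Y by rewrite mulr_ge0.
  by apply: lt0r_neq0; rewrite /= -/C -/S mulrNN; lra.
- rewrite trQc -[25]/(25%:R) (_ : 25 = 5 ^+ 2); last by ring.
  by rewrite ler_sqr ?nnegrE //; lra.
- by rewrite dE expr1n.
(* [C'] is [cos ((2 M + 1) t)], which is at most 0: the subtracted term of the trace is not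
   positive, and the first term alone gives the lower bound. *)
pose C' := k1 * C - k2 * S.
have -> : tr2 (Q * c * E)%g = 2 * Y * (p.1 * X * (C ^+ 2 + S ^+ 2) - p.1 * X * (C * C') + p.2 * (C * S)).
  by rewrite /tr2 /= E11 E12 E21 E22 /C' -/C -/S; ring.
rewrite CS mulr1 trQc; have rho2 : 2 <= 2 * X * k2 by lra.
have rho0 : 0 <= 2 * X * k2 by lra.
have [_ u1] := luc_pos n rho0; have [u0 _] := luc_ge rho0 n_gt0.
rewrite -/p in u0 u1.
have h1 : 2 <= p.1 * X.
  by have := ler_pM (_ : 0 <= 2 :> R) (_ : 0 <= 1 :> R) (le_trans rho2 u0) (_ : 1 <= X); lra.
have h2 : p.1 * X * (C * C') <= 0.
  by rewrite mulr_ge0_le0 //; [lra|rewrite mulr_ge0_le0].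
have h3 : 0 <= p.2 * (C * S) by rewrite !mulr_ge0 ?(ltW S0) //; lra.
have h4 : 2 * (2 * Y) <= 2 * Y * (p.1 * X - p.1 * X * (C * C') + p.2 * (C * S)).
  by rewrite mulrC ler_wpM2l ?mulr_ge0 //; lra.
have h5 : (2 * (2 * Y)) ^+ 2 <= (2 * Y * (p.1 * X - p.1 * X * (C * C') + p.2 * (C * S))) ^+ 2.
  have g1 : 0 <= 2 * (2 * Y) by lra.
  by rewrite ler_sqr // nnegrE (le_trans g1 h4).
have SY : S ^+ 2 * Y ^+ 2 <= 1 * Y ^+ 2.
  by rewrite ler_wpM2r ?sqr_ge0 //; have := sqr_ge0 C; lra.
by apply: le_trans h5; have := sqr_ge0 Y; lra.
Qed.

End EllipticRepresentation.

(** * Upper and lower pairs *)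

(** Common shape of both families: [[2m, 2n] = 2n / (4mn + 1)] and [[2m, -2n] = 2n / (4mn - 1)]. *)
Definition upper_type (r : rat) (m n : nat) : Prop :=
  numq r = 2 * n%:Z /\
  (denq r = 4 * m%:Z * n%:Z + 1 \/ denq r = 4 * m%:Z * n%:Z - 1).

Lemma blocks_trivial (G : groupType) (a : G) m n :
  (((a^-1 * a) ^+ m * (a^-1^-1 * a^-1) ^+ m) ^+ n = 1)%g.
Proof. by rewrite mulVg mulVg expg1n mulg1 expg1n. Qed.

Lemma blocks_trivial' (G : groupType) (a : G) m n :
  (((a * a^-1) ^+ m * (a^-1 * a^-1^-1) ^+ m) ^+ n = 1)%g.
Proof. by rewrite !mulgV expg1n mulg1 expg1n. Qed.

Definition has_free_arc {R : realType} {X : topologicalType} (K : set X) (h : X -> X)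
    (tau : set X) : Prop :=
  exists (G : groupType) (A B D : G) lam th E E' C Cz,
    arc_representation (R := R) K h tau A B D lam th E E' C Cz /\ free_meridians A B D.

Lemma upper_free_arc (R : realType) (r : rat) (m n : nat) :
  (0 < m)%N -> (0 < n)%N -> upper_type r m n ->
  has_free_arc (R := R) (two_bridge_knot R r) (@upper_inversion R r) (upper_tunnel R r).
Proof.
move=> m0 n0 [numqE [denqE|denqE]].
- have [Q [c [e [cc ee eC rel fr]]]] := @elliptic_representation R m n m0 n0.
  have dE : denq r = 2 * (2 * m%:Z * n%:Z) + 1 by rewrite denqE; ring.
  have bz : denq r * 1 - numq r * (2 * m%:Z) = 1 by rewrite denqE numqE; ring.
  have per := plus_period cc ee eC m0 n0 rel.
  have perz := period_plus (exponent 1) (exponent 1)^-1%g m0 n0.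
  cbv zeta in perz; rewrite blocks_trivial invg1 !mul1g mulVg in perz.
  have frD := plus_free cc ee eC m0 n0 fr.
  rewrite -denqE -numqE in per perz frD.
  exists (@gl2 R), (Q * c)%g, (c * Q)%g.
  do 7 eexists; split; last exact: frD.
  apply: (upper_representation dE numqE bz per).
  exact: perz.
- have [Q [c [cc rel fr]]] := @hyperbolic_representation R m n m0 n0.
  have ee : (1 * 1 = 1 :> @gl2 R)%g by rewrite mulg1.
  have eC (z : @gl2 R) : (1 * z = z * 1)%g by rewrite mulg1 mul1g.
  have dE : denq r = 2 * (2 * m%:Z * n%:Z - 1) + 1 by rewrite denqE; ring.
  have bz : denq r * -1 - numq r * (- (2 * m%:Z)) = 1 by rewrite denqE numqE; ring.
  have per := minus_period cc ee eC m0 n0 rel.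
  have perz := period_minus (exponent 1) (exponent 1)^-1%g m0 n0.
  cbv zeta in perz; rewrite blocks_trivial' invg1 !mul1g mulVg in perz.
  have frD := minus_free cc eC m0 n0 fr.
  rewrite -denqE -numqE in per perz frD.
  exists (@gl2 R), (Q * c)%g, (c * Q)%g.
  do 7 eexists; split; last exact: frD.
  apply: (upper_representation dE numqE bz per).
  apply: (mulgI (exponent 1)); apply: (mulIg (exponent 1)^-1%g); rewrite mulg1 mulgV.
  exact: perz.
Qed.

(** * Exchange of the two tangles *)

Section Swap.
Context {R : realType} (r r' : rat) (delta : int).
Local Open Scope quotient_scope.
Local Notation slab := (@slab R).
Hypothesis denqE : denq r' = denq r.
Hypothesis deltaE : denq r - numq r * numq r' = delta.
Hypothesis delta1 : delta = 1 \/ delta = -1.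
Implicit Types (x y : R * R) (t : R) (p q : slab).

(* The linear map exchanging the slope [oo] with the slope [numq r' / denq r] of
   [r'], and the slope of [r] with [oo]. *)
Definition swap x : R * R := (@transverse R r x, (numq r')%:~R * x.2 - x.1).

(** Reversing the height exchanges the two collapsed ends. *)
Definition flip p : slab := (swap p.1, height (1 - level p)).

Definition turn (z : @two_bridge_sphere R r) : @two_bridge_sphere R r' :=
  pr r' (flip (repr z)).

Lemma swapD x y : swap (x + y) = swap x + swap y.
Proof. by rewrite /swap transverseD; congr pair; rewrite /=; ring. Qed.

Lemma swapN x : swap (- x) = - swap x.
Proof. by rewrite /swap transverseN; congr pair; rewrite /=; ring. Qed.

Lemma swap_lattice (k : int * int) :
  swap (lattice k) = lattice (transverse_int r k, numq r' * k.2 - k.1).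
Proof. by congr pair; [exact: transverse_lattice|rewrite intrB intrM]. Qed.

Lemma swap_double (k : int * int) :
  swap (double k) = double (transverse_int r k, numq r' * k.2 - k.1).
Proof. by rewrite /double swapD swap_lattice. Qed.

Lemma swap_orbit x y : same_orbit x y -> same_orbit (swap x) (swap y).
Proof.
move=> /same_orbitP[k [->|->]]; apply/same_orbitP;
  exists (transverse_int r k, numq r' * k.2 - k.1).
  by left; rewrite swapD swap_double.
by right; rewrite swapD swapN swap_double.
Qed.

(** Vertical lines, collapsed at height 0 for [r], thus become lines of slope [r'], collapsed at
    height 1. *)
Lemma transverse_swap x : @transverse R r' (swap x) = - delta%:~R * x.1.
Proof. by rewrite /transverse /swap /transverse /= denqE -deltaE intrB intrM; ring. Qed.

Lemma glued_bottom_even x y (k : int) :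
  y.1 = x.1 + 2 * k%:~R \/ y.1 = 2 * k%:~R - x.1 ->
  glued r' (x, height 0) (y, height 0).
Proof.
move=> xy; have orb z : same_orbit x z -> z.1 = y.1 ->
    glued r' (x, height 0) (y, height 0).
  move=> xz zy; rewrite -pr_eqP.
  have -> : pr r' (x, height 0) = pr r' (z, height 0).
    by apply/pr_eqP; exact: glued_orbit.
  by apply/pr_eqP; exact: glued_bottom.
case: xy => e; [apply: (orb (x + double (k, 0)))|apply: (orb (double (k, 0) - x))].
- by apply/same_orbitP; exists (k, 0); left.
- by rewrite doubleE e.
- by apply/same_orbitP; exists (k, 0); right.
- by rewrite doubleE e.
Qed.

Lemma glued_flip p q : glued r p q -> pr r' (flip p) = pr r' (flip q).
Proof.
move=> pq; apply/pr_eqP; rewrite /flip -(glued_level pq).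
have := I01_level p; rewrite /I01 => /andP[].
rewrite le_eqVlt => /orP[/eqP l0|l0].
  have [|k xy] := glued_vertical pq; first by rewrite -l0.
  move=> _; rewrite -l0 subr0; apply/glued_top; rewrite !transverse_swap.
  case: delta1 => ->.
    by exists (- k); case: xy => ->; [left|right]; rewrite mulrNz; ring.
  by exists k; case: xy => ->; [left|right]; rewrite mulrNz; ring.
rewrite le_eqVlt => /orP[/eqP l1|l1].
  have [|k xy] := glued_transverse pq; first by rewrite l1.
  by rewrite l1 subrr; exact: (glued_bottom_even (k := k)).
apply/glued_orbit/swap_orbit.
move: pq; rewrite (slabP p) (slabP q) -?(glued_level pq) => pq.
have := glued_level pq; rewrite !level_height !clampE; [|exact: I01_level..] => lpq.
by move: pq; rewrite -lpq glued_mid // l0.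
Qed.

Lemma turn_place x t : I01 t -> turn (place r x t) = place r' (swap x) (1 - t).
Proof.
move=> tI; rewrite /turn (@quotient_lift_pr _ r _ (fun p => pr r' (flip p))).
  by rewrite /flip level_height clampE.
exact: glued_flip.
Qed.

Lemma continuous_turn : continuous turn.
Proof.
apply: (continuous_quotient_lift (g := fun p => pr r' (flip p))); last exact: glued_flip.
have c1 := @continuous_fst1 R; have c2 := @continuous_fst2 R; have c3 := @continuous_level R.
apply: continuous_place; last by cont.
by rewrite /swap /transverse; cont.
Qed.

Lemma turn_knot z : two_bridge_knot R r z -> two_bridge_knot R r' (turn z).
Proof.
have [x [t [tI ->]]] := placeP z => /(knot_place tI)[k /eq_place ->].
rewrite turn_place // swap_lattice.
by exists (lattice (transverse_int r k, numq r' * k.2 - k.1), height (1 - t)) => //; eexists.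
Qed.

Lemma level_tunnel x t s : I01 t -> I01 s ->
  (pr r @` [set p | level p = s]) (place r x t) <-> t = s.
Proof.
move=> tI sI; split=> [[p ps /pr_eqP /glued_level]|->].
  by rewrite level_height clampE // => <-.
by exists (x, height s) => //=; rewrite level_height clampE.
Qed.

End Swap.

Lemma turnK {R : realType} (r r' : rat) (delta : int) :
  denq r' = denq r -> denq r - numq r * numq r' = delta -> delta = 1 \/ delta = -1 ->
  cancel (@turn R r r') (@turn R r' r).
Proof.
move=> dE de d1 z; have [x [t [tI ->]]] := placeP z.
have tI' : I01 (1 - t) by move: tI; rewrite /I01; lra.
have de' : denq r' - numq r' * numq r = delta by rewrite dE mulrC.
rewrite (turn_place dE de d1 x tI) (turn_place (esym dE) de' d1 _ tI').
rewrite (_ : 1 - (1 - t) = t); last by ring.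
have -> : swap r' r (swap r r' x) = (- delta%:~R * x.1, - delta%:~R * x.2).
  by rewrite {1}/swap (transverse_swap dE de) -de /swap /transverse intrB intrM /=; congr pair; ring.
apply/eq_place/glued_orbit/same_orbitP; exists (0, 0); rewrite doubleE /= mulr0.
by case: d1 => ->; [right|left]; rewrite [x]surjective_pairing;
  congr pair; rewrite /= ?mulrN1z ?mulr1z; ring.
Qed.

(** [numq r * numq r' = 4 m n] differs from the common denominator by 1, so [swap] is unimodular and
    [turn] is a homeomorphism. It takes the knot, lower tunnel and lower inversion of [r] to the
    knot, upper tunnel and upper inversion of [r']. *)
Lemma lower_free_arc (R : realType) (r r' : rat) (m n : nat) :
  (0 < m)%N -> (0 < n)%N -> upper_type r m n -> upper_type r' n m -> denq r' = denq r ->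
  has_free_arc (R := R) (two_bridge_knot R r) (@lower_inversion R r) (lower_tunnel R r).
Proof.
move=> m0 n0 [nE dE] [nE' dE'] dd.
have [G [A [B [D [lam [th [E [E' [C [Cz [rep fr]]]]]]]]]]] :=
  upper_free_arc R n0 m0 (conj nE' dE').
pose delta := denq r - numq r * numq r'.
have d1 : delta = 1 \/ delta = -1.
  by rewrite /delta nE nE'; case: dE => ->; [left|right]; ring.
have de' : denq r' - numq r' * numq r = delta by rewrite dd mulrC.
pose F := @turn R r r'; pose F' := @turn R r' r.
have FK : cancel F F' by exact: (turnK dd erefl d1).
have FK' : cancel F' F by exact: (turnK (esym dd) de' d1).
have cF : continuous F by exact: (continuous_turn dd erefl d1).
have cF' : continuous F' by exact: (continuous_turn (esym dd) de' d1).
have FP x t : I01 t -> F (place r x t) = place r' (swap r r' x) (1 - t).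
  exact: (turn_place dd erefl d1).
exists G, A, B, D; do 6 eexists; split; last exact: fr.
have := arc_representation_transport cF cF' FK FK' rep.
have -> : F @^-1` two_bridge_knot R r' = two_bridge_knot R r.
  apply/seteqP; split=> z /=; last exact: (turn_knot dd erefl d1).
  by move=> /(turn_knot (esym dd) de' d1); rewrite -/F' FK.
have -> : F @^-1` upper_tunnel R r' = lower_tunnel R r.
  apply/seteqP; split=> z /=; have [x [t [tI ->]]] := placeP z;
    have tI' : I01 (1 - t) by [move: tI; rewrite /I01; lra].
    rewrite FP // => /(level_tunnel r' _ tI' I01_0) e; apply/level_tunnel => //; last by lra.
    exact: I01_1.
  by move=> /(level_tunnel r _ tI I01_1) ->; rewrite FP // ?I01_1 //; apply/level_tunnel; rewrite ?subrr ?I01_0.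
have -> : F' \o @upper_inversion R r' \o F = @lower_inversion R r.
  apply/funext => z /=; have [x [t [tI ->]]] := placeP z.
  have tI' : I01 (1 - t) by move: tI; rewrite /I01; lra.
  apply: (can_inj FK); rewrite FK' FP // upper_inversion_place.
  have -> : @lower_inversion R r (place r x t) =
      place r (x + ((denq r)%:~R, (numq r)%:~R)) t by rewrite /lower_inversion /place translation_pr.
  rewrite FP // swapD; apply/eq_place/glued_orbit/same_orbitP.
  (* The translation vector of the lower inversion becomes [(0, - delta)], which is [(0, 1)] up to
     an even vector. *)
  have -> : swap r r' ((denq r)%:~R, (numq r)%:~R) = (0, - delta%:~R) :> R * R.
    by rewrite /swap /transverse /delta intrB intrM; congr pair; rewrite /=; ring.
  case: d1 => ->; [exists (0, -1)|exists (0, 0)]; left; rewrite doubleE -addrA; congr (_ + _);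
    by congr pair; rewrite /= ?mulrN1z ?mulr1z; ring.
exact.
Qed.

(** * The continued fractions in lowest terms, and the conclusion *)

Lemma upper_type_ratio (p : int) (m n : nat) : 0 < p ->
  p = 4 * m%:Z * n%:Z + 1 \/ p = 4 * m%:Z * n%:Z - 1 ->
  numq ((2 * n%:Z)%:~R / p%:~R) = 2 * n%:Z /\ denq ((2 * n%:Z)%:~R / p%:~R) = p.
Proof.
move=> p0 pE; have cop : coprime `|(2 * n%:Z)%R|%N `|p|%N.
  rewrite -coprimezE /coprimez; apply/eqP.
  have : (gcdz (2 * n%:Z) p %| 1)%Z.
    have d1 := dvdz_gcdl (2 * n%:Z) p; have d2 := dvdz_gcdr (2 * n%:Z) p.
    move: (gcdz _ _) d1 d2 => d d1 d2.
    have d3 : (d %| 4 * m%:Z * n%:Z)%Z.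
      have -> : 4 * m%:Z * n%:Z = 2 * m%:Z * (2 * n%:Z) by ring.
      exact: dvdz_mull.
    case: pE => e.
      have <- : p - 4 * m%:Z * n%:Z = Posz 1 by rewrite e; ring.
      exact: rpredB.
    have <- : 4 * m%:Z * n%:Z - p = Posz 1 by rewrite e; ring.
    exact: rpredB.
  by rewrite dvdz1 /gcdz absz_nat => /eqP ->.
by rewrite coprimeq_num // coprimeq_den // gtr0_sg // mul1r gt_eqF // gtr0_norm.
Qed.

Lemma cfrac2_ratio (m n : nat) (e p : int) : (0 < n)%N -> e = 1 \/ e = -1 ->
  p = 4 * m%:Z * n%:Z + e -> 0 < p ->
  cfrac2 (2 * m%:Z) (e * (2 * n%:Z)) = (2 * n%:Z)%:~R / p%:~R.
Proof.
move=> n0 e1 pE p0; rewrite /cfrac2.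
have N0 : n%:R != 0 :> rat by rewrite pnatr_eq0 -lt0n.
have P0 : p%:~R != 0 :> rat by rewrite intr_eq0 gt_eqF.
have PE : p%:~R = 4 * m%:R * n%:R + e%:~R :> rat by rewrite pE intrD !intrM.
rewrite PE in P0 *; case: e1 P0 {pE PE} => ->; rewrite ?mulN1r ?mul1r ?mulrNz !intrM => P0.
  by field; rewrite N0 andbT.
field; rewrite N0 P0 /= -oppr_eq0.
by move: P0; congr (_ != 0); ring.
Qed.

Lemma cfrac2_type (m n : nat) (r : rat) : (0 < m)%N -> (0 < n)%N ->
  r = cfrac2 (2 * m%:Z) (2 * n%:Z) \/ r = cfrac2 (2 * m%:Z) (- (2 * n%:Z)) ->
  upper_type r m n /\ exists r', upper_type r' n m /\ denq r' = denq r.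
Proof.
move=> m0 n0 rE.
have [p [p0 pE ->]] : exists p : int, [/\ 0 < p,
    p = 4 * m%:Z * n%:Z + 1 \/ p = 4 * m%:Z * n%:Z - 1 &
    r = (2 * n%:Z)%:~R / p%:~R].
  case: rE => ->.
    exists (4 * m%:Z * n%:Z + 1); split; [lia|by left|].
    rewrite -[2 * n%:Z in LHS]mul1r; apply: cfrac2_ratio => //; try lia; by left.
  exists (4 * m%:Z * n%:Z - 1); split; [nia|by right|].
  rewrite -[- (2 * n%:Z)]mulN1r; apply: cfrac2_ratio => //; try nia; by right.
have [e1 e2] := upper_type_ratio p0 pE.
have pE' : p = 4 * n%:Z * m%:Z + 1 \/ p = 4 * n%:Z * m%:Z - 1.
  by case: pE => ->; [left|right]; ring.
have [e3 e4] := upper_type_ratio p0 pE'.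
split; first by split=> //; rewrite e2.
exists ((2 * m%:Z)%:~R / p%:~R); split; last by rewrite e4 e2.
by split=> //; rewrite e4.
Qed.

Lemma free_arc_pair (R : realType) (X : topologicalType) (K : set X) h tau
    (b : ~` K) (x y : pi1 R b) :
  has_free_arc (R := R) K h tau -> long_meridian_pair h tau x y ->
  is_free (generated [set x; y]).
Proof.
move=> [G [A [B [D [lam [th [E [E' [C [Cz [rep fr]]]]]]]]]]] xy.
by apply: free_pair_is_free; exact: arc_representation_free rep fr xy.
Qed.

Theorem theorem1p1 (R : realType) (m n : nat) (r : rat)
  (m_gt0 : (0 < m)%N) (n_gt0 : (0 < n)%N)
  (r_def : r = cfrac2 (2 * m%:Z) (2 * n%:Z) \/
           r = cfrac2 (2 * m%:Z) (- (2 * n%:Z)))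
  (b : ~` two_bridge_knot R r) (x y : pi1 R b)
  (xy_long : long_upper_meridian_pair x y \/ long_lower_meridian_pair x y) :
  is_free (generated [set x; y]).
Proof.
have [rmn [r' [r'nm dd]]] := cfrac2_type m_gt0 n_gt0 r_def.
case: xy_long; apply: free_arc_pair.
- exact: upper_free_arc rmn.
- exact: lower_free_arc rmn r'nm dd.
Qed.
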